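(* Let $\mu\in\mathcal{P}_1(\mathbb{R})$ and let $\beta:\mathbb{R}^+\to\mathbb{R}^+$ be a convex cost function such that $\{t\in\mathbb{R}^+:\beta(t)=0\}=[0,t_o]$, where $t_o>0$ is some positive constant. The following are equivalent: (i) There exists $a>0$ such that $\mu$ satisfies the transport-entropy inequality $\mathrm{T}(\beta(a\,\cdot\,))$. (ii) There exists $a'>0$ such that $\mu$ satisfies the weak transport-entropy inequality $\overline{\mathrm{T}}(\beta(a'\,\cdot\,))$. (iii) There exists $b>0$ such that $\max(K^+(b),K^-(b))<\infty$, where $$K^+(b):=\sup_{x\ge m}\frac{1}{\mu((x,\infty))}\int_{(x,\infty)}e^{\beta(b(u-x))}\mu(du),\qquad K^-(b):=\sup_{x\le m}\frac{1}{\mu((-\infty,x))}\int_{(-\infty,x)}e^{\beta(b(x-u))}\mu(du),$$ and $m$ is a median of $\mu$ (with the convention $0/0=0$). (iv) There exists $d>0$ such that $$|U_\mu(u)-U_\mu(v)|\le\frac1d\,\beta^{-1}(|u-v|)\qquad\forall u\ne v\in\mathbb{R}.$$ In particular: - if (i) holds with $a$, then (ii) holds with $a'=a$; - if (ii) holds with $a'$, then (iii) holds with $b=a'/2$; - if (ii) holds with $a'$, then (iv) holds with $d=a'\,\dfrac{t_o}{8\beta^{-1}(\log3)}$; - if (iv) holds with $d$, then (ii) holds with $a'=d\,\dfrac{t_o}{9\beta^{-1}(2)}$.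
   Context: $\mathbb{R}^+=[0,\infty)$. $\mathcal{P}(\mathbb{R})$ is the set of Borel probability measures on $\mathbb{R}$ and $\mathcal{P}_1(\mathbb{R})$ the subset of those with finite first moment. A cost function is a measurable $\theta:\mathbb{R}^+\to\mathbb{R}^+$ with $\theta(0)=0$; $\theta(a\,\cdot\,)$ denotes $x\mapsto\theta(ax)$. The inverse $\beta^{-1}$ is well defined on $(0,\infty)$ (with values in $(t_o,\infty)$). Relative entropy: $\mathrm{H}(\nu|\mu)=\int\log\left(\frac{d\nu}{d\mu}\right)d\nu$ if $\nu$ is absolutely continuous with respect to $\mu$, $+\infty$ otherwise. Classical transport cost: $\mathcal{T}_\theta(\nu,\mu)=\inf_\pi\iint\theta(|x-y|)\,\pi(dxdy)$ over all couplings $\pi$ of $\mu$ and $\nu$. $\mu$ satisfies $\mathrm{T}(\theta)$ if $\mathcal{T}_\theta(\nu,\mu)\le\mathrm{H}(\nu|\mu)$ for all $\nu\in\mathcal{P}(\mathbb{R})$. Weak transport cost: $\overline{\mathcal{T}}_\theta(\nu|\mu)=\inf_\pi\int\theta\left(\left|x-\int y\,p(x,dy)\right|\right)\mu(dx)$, where the infimum runs over all couplings $\pi(dxdy)=p(x,dy)\mu(dx)$ of $\mu$ (first marginal) and $\nu$ (second marginal), $p(x,\cdot)$ being the disintegration kernel of $\pi$ with respect to its first marginal. $\mu$ satisfies $\overline{\mathrm{T}}(\theta)$ ($\theta$ convex) if, for all $\nu\in\mathcal{P}_1(\mathbb{R})$, both $\overline{\mathcal{T}}_\theta(\nu|\mu)\le\mathrm{H}(\nu|\mu)$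 and $\overline{\mathcal{T}}_\theta(\mu|\nu)\le\mathrm{H}(\nu|\mu)$. The map $U_\mu$: let $F_\mu(x)=\mu((-\infty,x])$ and $F_\mu^{-1}(u)=\inf\{x\in\mathbb{R}:F_\mu(x)\ge u\}$ for $u\in[0,1]$; let $\tau(dx)=\frac12e^{-|x|}dx$. Then $U_\mu:=F_\mu^{-1}\circ F_\tau:\mathbb{R}\to\mathbb{R}$. *)

(* Defs.v *)
From HB Require Import structures.
From mathcomp Require Import all_boot all_order all_algebra.
From mathcomp Require Import all_classical all_reals all_analysis.

Set Implicit Arguments.
Unset Strict Implicit.
Unset Printing Implicit Defensive.

Import Order.TTheory GRing.Theory Num.Theory.
Import numFieldNormedType.Exports.

Local Open Scope classical_set_scope.
Local Open Scope ring_scope.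
Local Open Scope charge_scope.

Definition finite_first_moment (R : realType) (mu : probability R R) : Prop :=
  (\int[mu]_x (`|x|)%:E < +oo)%E.

(* A function from [0, +oo[ to itself is a total function R -> R of which only
   the values on [0, +oo[ are constrained; every definition below evaluates
   it only there. *)
Record cost_function (R : realType) (theta : R -> R) : Prop := CostFunction {
  cost_ge0 : forall x, 0 <= x -> 0 <= theta x ;
  cost_measurable : measurable_fun (`[0, +oo[ : set R) theta ;
  cost0 : theta 0 = 0 }.

Definition convex_cost (R : realType) (theta : R -> R) : Prop :=
  @convex_function R R^o `[0, +oo[ theta.

Definition dilate (R : realType) (a : R) (theta : R -> R) : R -> R :=
  fun x => theta (a * x).

(* The negative part of log (dnu/dmu) is nu-integrable, with integral at most
   1/e, so the integral is well defined in ]-oo, +oo]. *)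
Definition rel_entropy (R : realType) (nu mu : probability R R) : \bar R :=
  if `[< nu `<< mu >]
  then (\int[nu]_x lne ('d (charge_of_finite_measure nu) '/d mu x))%E
  else +oo%E.

Definition coupling (R : realType) (mu nu : probability R R)
    (pi : probability (R * R)%type R) : Prop :=
  (forall A, measurable A -> pi (A `*` setT) = mu A) /\
  (forall B, measurable B -> pi (setT `*` B) = nu B).

Definition transport_cost (R : realType) (theta : R -> R) (nu mu : probability R R) :
    \bar R :=
  ereal_inf [set (\int[pi]_z (theta `|z.1 - z.2|)%:E)%E
            | pi in [set pi | coupling mu nu pi]].

Definition transport_entropy (R : realType) (mu : probability R R) (theta : R -> R) :
    Prop :=
  forall nu : probability R R, (transport_cost theta nu mu <= rel_entropy nu mu)%E.

Definition disintegration (R : realType) (mu : probability R R)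
    (pi : probability (R * R)%type R)
    (p : R.-pker R ~> R) : Prop :=
  forall A B, measurable A -> measurable B ->
    pi (A `*` B) = (\int[mu]_(x in A) p x B)%E.

(* When nu has a finite first moment, y is p x-integrable for mu-almost every x,
   so that \int[p x]_y y is the actual mean of p x. *)
Definition weak_transport_cost (R : realType) (theta : R -> R)
    (nu mu : probability R R) : \bar R :=
  ereal_inf [set c | exists pi p, [/\ coupling mu nu pi,
     disintegration mu pi p &
     c = (\int[mu]_x (theta `|x - (\int[p x]_y y)%R|)%:E)%E]].

Definition weak_transport_entropy (R : realType) (mu : probability R R)
    (theta : R -> R) : Prop :=
  forall nu : probability R R, finite_first_moment nu ->
    (weak_transport_cost theta nu mu <= rel_entropy nu mu)%E /\
    (weak_transport_cost theta mu nu <= rel_entropy nu mu)%E.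

Definition is_median (R : realType) (mu : probability R R) (m : R) : Prop :=
  ((2^-1)%:E <= mu `]-oo, m]%classic)%E /\
  ((2^-1)%:E <= mu `[m, +oo[%classic)%E.

(* In \bar R the inverse of 0 is +oo and +oo * 0 = 0, so a quotient 0 / 0
   below has the value 0. *)
Definition Kplus (R : realType) (mu : probability R R) (beta : R -> R) (m b : R) :
    \bar R :=
  ereal_sup [set ((mu `]x, +oo[%classic)^-1 *
      \int[mu]_(u in `]x, +oo[) (expR (beta (b * (u - x))))%:E)%E
    | x in `[m, +oo[].

Definition Kminus (R : realType) (mu : probability R R) (beta : R -> R) (m b : R) :
    \bar R :=
  ereal_sup [set ((mu `]-oo, x[%classic)^-1 *
      \int[mu]_(u in `]-oo, x[) (expR (beta (b * (x - u))))%:E)%E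
    | x in `]-oo, m]].

(* The library's cdf is attached to a random variable; this one takes a set
   function, so that it applies to exp_law as well. *)
Definition dist_fun (R : realType) (mu : set R -> \bar R) (x : R) : \bar R :=
  mu `]-oo, x]%classic.

Definition quantile (R : realType) (mu : set R -> \bar R) (u : \bar R) :
    \bar R :=
  ereal_inf [set x%:E | x in [set x : R | (u <= dist_fun mu x)%E]].

Definition exp_law (R : realType) (A : set R) : \bar R :=
  (\int[lebesgue_measure]_(x in A) (2^-1 * expR (- `|x|))%:E)%E.

(* dist_fun exp_law takes its values in ]0, 1[, where quantile mu is finite,
   so that fine is harmless here. *)
Definition Umap (R : realType) (mu : probability R R) (x : R) : R :=
  fine (quantile mu (dist_fun (@exp_law R) x)).

(* For a convex cost vanishing exactly on [0, t_o], each y > 0 has exactly one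
   antecedent in [0, +oo[, and it lies in ]t_o, +oo[. *)
Definition cost_inv (R : realType) (beta : R -> R) (y : R) : R :=
  get [set t | 0 <= t /\ beta t = y].

Definition Umap_modulus (R : realType) (mu : probability R R) (beta : R -> R) (d : R) :
    Prop :=
  forall u v : R, u != v ->
    `|Umap mu u - Umap mu v| <= d^-1 * cost_inv beta `|u - v|.

(* Main.v *)
Require Import Defs.
From HB Require Import structures.
From mathcomp Require Import all_boot all_order all_algebra.
From mathcomp Require Import all_classical all_reals all_analysis.
From mathcomp Require Import measurable_realfun.
From mathcomp Require Import ring lra.

(** The proof follows the cycle (i) => (ii) => (iii) => (iv) => (i), each step
    keeping track of the constants.

    (i) => (ii).  If pi couples mu and nu and p (x, dy) is its disintegration,
    Jensen's inequality in each fibre bounds the cost between x and the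
    barycentre of p (x, dy) by the mean cost under p (x, dy), so that weak costs
    are dominated by the usual one (weak_transport_le_transport).  The kernel p
    is obtained by sampling: y is written as a conditional quantile T (x, u) of
    an independent uniform u (conditional_sampling).

    (ii) => (iii).  Let phi be the distance to a half-line A of mass at least
    1/2, and theta = beta (a' .).  Conditioning mu on A costs the entropy
    - log mu(A), and the barycentres stay in A, so the first weak inequality
    bounds the integral of theta o phi by - log mu(A).  The second weak
    inequality is then applied to the law proportional to e^(2 beta (a' phi / 2)).
    By convexity, 2 beta (a' phi(x) / 2) <= theta (phi y) + theta |x - y|, and
    the mean of the exponent cancels between the two sides, which leaves an
    integral of e^(2 beta (a' phi / 2)) of at most 1 / mu(A)
    (integral_exp_cost).  Subtracting the mass of A, where the integrand is 1,
    leaves at most 3 mu(A^c).  Both halves rest on one duality inequality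
    (weak_transport_duality).

    (iii) => (iv).  Markov's inequality applied to the exponential tail bounds
    compares the masses of two nested half-lines, hence beta of the increments
    of U_mu on one side of the median with log K plus the increment of the
    argument.  Increments across 0 are split at the median, which halves the
    constant.  Superadditivity of beta then turns log K + s into
    beta (A + B), where A and B are the inverses of log K and of s, and
    A + B <= 2 A B / t_o since both exceed t_o
    (Umap_modulus_of_tail_bound).

    (iv) => (i).  Let nu have density h with respect to mu, q be the quantile
    function of mu, rho the law on ]0, 1[ with density h o q, and S the quantile
    function of rho.  Then (q v, q (S v)), for v uniform, couples mu and nu, and
    rho has the same entropy as nu.  By (iv), the cost of this pair vanishes
    unless v and S v are far apart on the exponential scale, and eight times the
    cost is at most
      (log (v / S v) - 1)_+ + (log (S v / v) - 1)_+
    plus the same terms for 1 - v and 1 - S v (modulus_cost_clog).  Each of the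
    four terms integrates to at most twice the entropy of rho, by the variational
    formula of the entropy and Tonelli's theorem (rearr_excess and
    rearr_deficit), so the factor 8 cancels. *)

Set Implicit Arguments.
Unset Strict Implicit.
Unset Printing Implicit Defensive.

Import Order.TTheory GRing.Theory Num.Theory.
Import numFieldNormedType.Exports.

Local Open Scope classical_set_scope.
Local Open Scope ring_scope.
Local Open Scope charge_scope.

(** * Convex functions and convex costs *)

(** Convexity on the whole line, for functions such as y |-> theta |x - y|, whereas
    convex_cost only concerns the half-line. *)
Definition convexR (R : realType) (f : R -> R) : Prop :=
  forall x y t, 0 <= t -> t <= 1 ->
    f (t * x + (1 - t) * y) <= t * f x + (1 - t) * f y.

Lemma convexR_slope (R : realType) (f : R -> R) : convexR f ->
  forall x m y, x < m -> m < y ->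
    (f m - f x) / (m - x) <= (f y - f m) / (y - m).
Proof.
move=> cf x m y xm my.
have xy : 0 < y - x by lra.
have := cf x y ((y - m) / (y - x)).
have -> : (y - m) / (y - x) * x + (1 - (y - m) / (y - x)) * y = m.
  by field; lra.
have t0 : 0 <= (y - m) / (y - x) by rewrite divr_ge0//; lra.
have t1 : (y - m) / (y - x) <= 1 by rewrite ler_pdivrMr//; lra.
move=> /(_ t0 t1) h.
rewrite ler_pdivrMr ?subr_gt0// mulrAC ler_pdivlMr ?subr_gt0//.
have : f m * (y - x) <= (y - m) * f x + (m - x) * f y.
  rewrite -ler_pdivlMr//; apply: le_trans h _.
  rewrite le_eqVlt; apply/orP; left; apply/eqP; field; lra.
by nra.
Qed.

(** The supporting line at m has for slope the supremum of the slopes of the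
    chords that end at m. *)
Lemma convexR_support (R : realType) (f : R -> R) : convexR f ->
  forall m, exists c, forall y, f m + c * (y - m) <= f y.
Proof.
move=> cf m.
pose S := [set (f m - f x) / (m - x) | x in [set x | x < m]].
have ubS y : m < y -> ubound S ((f y - f m) / (y - m)).
  by move=> my _ [x xm <-]; exact: convexR_slope.
have S0 : S !=set0 by exists ((f m - f (m - 1)) / (m - (m - 1))), (m - 1) => //=; lra.
have hS : has_sup S.
  by split => //; exists ((f (m + 1) - f m) / (m + 1 - m)); apply: ubS; lra.
exists (sup S) => y.
case: (ltgtP y m) => [ym|my|->]; last by rewrite subrr mulr0 addr0.
- have : (f m - f y) / (m - y) <= sup S by apply: ub_le_sup; [case: hS|exists y].
  by rewrite ler_pdivrMr ?subr_gt0//; nra.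
- have : sup S <= (f y - f m) / (y - m) by apply: ge_sup => //; exact: ubS.
  by rewrite ler_pdivlMr ?subr_gt0//; nra.
Qed.

Section convex_cost_theory.
Context (R : realType) (beta : R -> R) (to : R).
Hypotheses (hbeta : cost_function beta) (hconv : convex_cost beta)
  (hto : 0 < to) (hzero : [set t | 0 <= t /\ beta t = 0] = `[0, to]%classic).

Implicit Types x y t a : R.

Lemma cost_convex x y t : 0 <= x -> 0 <= y -> 0 <= t -> t <= 1 ->
  beta (t * x + (1 - t) * y) <= t * beta x + (1 - t) * beta y.
Proof.
move=> x0 y0 t0 t1.
have tP : Itv.spec (@Itv.num_sem R) (Itv.Real `[0%Z, 1%Z]) t.
  by apply/andP; split; rewrite ?num_real //= in_itv/= t0 t1.
have xD : (x : convex_lmodType R^o) \in (`[0, +oo[%classic : set R).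
  by rewrite inE/= in_itv/= x0.
have yD : (y : convex_lmodType R^o) \in (`[0, +oo[%classic : set R).
  by rewrite inE/= in_itv/= y0.
exact: (hconv (Itv.mk tP) xD yD).
Qed.

Lemma cost_midpoint x y : 0 <= x -> 0 <= y ->
  beta ((x + y) / 2) <= (beta x + beta y) / 2.
Proof.
move=> x0 y0; have h0 : 0 <= 2^-1 :> R by [].
have h1 : 2^-1 <= 1 :> R by rewrite invf_le1// ler1n.
have := cost_convex x0 y0 h0 h1.
have -> : 2^-1 * x + (1 - 2^-1) * y = (x + y) / 2 by field.
by have -> : 2^-1 * beta x + (1 - 2^-1) * beta y = (beta x + beta y) / 2 by field.
Qed.

Lemma cost_nonneg t : 0 <= t -> 0 <= beta t. Proof. exact: cost_ge0. Qed.

Lemma cost_eq0 t : 0 <= t -> t <= to -> beta t = 0.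
Proof.
move=> t0 tt; have : (`[0, to]%classic : set R) t by rewrite /= in_itv/= t0 tt.
by rewrite -hzero => -[].
Qed.

Lemma cost_gt0 t : to < t -> 0 < beta t.
Proof.
have to_gt0 := hto.
move=> tt; have t0 : 0 <= t by lra.
rewrite lt_neqAle cost_nonneg// andbT eq_sym; apply/eqP => bt.
have : [set t | 0 <= t /\ beta t = 0] t by [].
by rewrite hzero /= in_itv/= => /andP[_]; lra.
Qed.

(** Convexity between 0, where beta vanishes, and y. *)
Lemma cost_star t y : 0 <= t -> t <= 1 -> 0 <= y -> beta (t * y) <= t * beta y.
Proof.
move=> t0 t1 y0; have := cost_convex y0 (lexx 0) t0 t1.
by rewrite (cost0 hbeta) !mulr0 !addr0.
Qed.

Lemma cost_le x y : 0 <= x -> x <= y -> beta x <= beta y.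
Proof.
move=> x0 xy; have [->//|y0] := eqVneq x y.
have yp : 0 < y by rewrite (le_lt_trans x0)// lt_neqAle y0.
have := @cost_star (x / y) y; rewrite divfK ?gt_eqF// => h.
have t1 : x / y <= 1 by rewrite ler_pdivrMr// mul1r.
apply: le_trans (h _ t1 (ltW yp)) _; first by rewrite divr_ge0// ltW.
by rewrite ler_piMl// cost_nonneg// ltW.
Qed.

Lemma cost_lt x y : 0 <= x -> x < y -> to < y -> beta x < beta y.
Proof.
have to_gt0 := hto.
move=> x0 xy ty; have yp : 0 < y by lra.
have := @cost_star (x / y) y; rewrite divfK ?gt_eqF// => h.
apply: le_lt_trans (h _ _ (ltW yp)) _.
- by rewrite divr_ge0// ltW.
- by rewrite ler_pdivrMr// mul1r ltW.
- by rewrite gtr_pMl ?cost_gt0// ltr_pdivrMr// mul1r.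
Qed.

(** Each term is compared with beta (x + y) by cost_star. *)
Lemma cost_superadd x y : 0 <= x -> 0 <= y -> beta x + beta y <= beta (x + y).
Proof.
move=> x0 y0; have [xy0|xy0] := eqVneq (x + y) 0.
  have -> : x = 0 by lra.
  have -> : y = 0 by lra.
  by rewrite addr0 (cost0 hbeta) addr0.
have p : 0 < x + y by rewrite lt_neqAle eq_sym xy0 addr_ge0.
have hh z : 0 <= z -> z <= x + y -> beta z <= z / (x + y) * beta (x + y).
  move=> z0 zl; rewrite -{1}(divfK xy0 z); apply: cost_star.
  - by rewrite divr_ge0// ltW.
  - by rewrite ler_pdivrMr// mul1r.
  - by rewrite ltW.
have hx := @hh x x0; have hy := @hh y y0.
have -> : beta (x + y) = x / (x + y) * beta (x + y) + y / (x + y) * beta (x + y).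
  by field.
by apply: lerD; [apply: hx|apply: hy]; lra.
Qed.

Lemma cost_unbounded y : exists2 M, to < M & y < beta M.
Proof.
have to_gt0 := hto.
have c0 : 0 < beta (to + 1) by apply: cost_gt0; lra.
pose n := (Num.bound (`|y| / beta (to + 1))).+1.
have nM : `|y| < n%:R * beta (to + 1).
  rewrite -ltr_pdivrMr//; apply: lt_trans (archi_boundP _) _.
    by rewrite divr_ge0// ltW.
  by rewrite ltr_nat.
have n1 : 1 <= n%:R :> R by rewrite ler1n.
exists (n%:R * (to + 1)); first by nra.
apply: le_lt_trans (ler_norm y) (lt_le_trans nM _).
have n0 : 0 < n%:R :> R by lra.
rewrite mulrC -ler_pdivlMr// mulrC.
have := @cost_star n%:R^-1 (n%:R * (to + 1)).
rewrite mulrA mulVf ?gt_eqF// mul1r; apply.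
- by rewrite invr_ge0 ltW.
- by rewrite invf_le1.
- by apply: mulr_ge0; lra.
Qed.

(** The supremum s of the sublevel set of y is the antecedent.  The case
    beta s > y is excluded by convexity between s + 1 and a point t < s of the
    sublevel set close to s, the case beta s < y by convexity between s and s + 1. *)
Lemma cost_surj y : 0 < y -> exists t, 0 <= t /\ beta t = y.
Proof.
have to_gt0 := hto.
move=> y0; have [M tM yM] := cost_unbounded y.
pose S := [set t | 0 <= t /\ beta t <= y].
have S0 : S 0 by split => //; rewrite (cost0 hbeta) ltW.
have ubS : ubound S M.
  move=> t [t0 ty]; rewrite leNgt; apply/negP => Mt.
  by have := @cost_le M t; lra.
have hS : has_sup S by split; [exists 0|exists M].
pose s := sup S.
have s0 : 0 <= s by apply: ub_le_sup => //; exists M.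
exists s; split => //; apply/eqP; rewrite eq_le; apply/andP; split.
- rewrite leNgt; apply/negP => ys.
  pose C := beta (s + 1) - beta s.
  have C0 : 0 <= C by rewrite subr_ge0; apply: cost_le; lra.
  pose e := (beta s - y) / (C + 1).
  have e0 : 0 < e by rewrite divr_gt0//; lra.
  have [t [t0 ty] ts] := sup_adherent e0 hS; rewrite -/s in ts.
  have ts' : t < s.
    rewrite ltNge; apply/negP => st.
    by have := cost_le s0 st; lra.
  have q : 0 < s + 1 - t by lra.
  have := @cost_convex t (s + 1) ((s + 1 - t)^-1) t0.
  have -> : (s + 1 - t)^-1 * t + (1 - (s + 1 - t)^-1) * (s + 1) = s.
    by field; lra.
  have i0 : 0 <= (s + 1 - t)^-1 by rewrite invr_ge0 ltW.
  have i1 : (s + 1 - t)^-1 <= 1 by rewrite invf_le1//; lra.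
  move=> /(_ _ i0 i1) h.
  have {}h : beta s <= (s + 1 - t)^-1 * beta t + (1 - (s + 1 - t)^-1) * beta (s + 1).
    by apply: h; lra.
  have h2 : (s + 1 - t) * beta s <= beta t + (s - t) * beta (s + 1).
    rewrite mulrC -ler_pdivlMr//; apply: le_trans h _.
    rewrite le_eqVlt; apply/orP; left; apply/eqP; field; lra.
  have h3 : beta s - beta t <= (s - t) * C by rewrite /C; nra.
  have h4 : (s - t) * (C + 1) < beta s - y.
    by rewrite -ltr_pdivlMr ?ltr_wpDl//; rewrite -/e; lra.
  by nra.
- rewrite leNgt; apply/negP => ys.
  pose B := beta (s + 1).
  have B0 : 0 <= B by apply: cost_nonneg; lra.
  pose e := (y - beta s) / (B + y).
  have By : 0 < B + y by lra.
  have bs0 := cost_nonneg s0.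
  have e0 : 0 < e by rewrite divr_gt0//; lra.
  have e1 : e <= 1 by rewrite ler_pdivrMr//; lra.
  have s1 : 0 <= s + 1 by lra.
  have := cost_convex s1 s0 (ltW e0) e1.
  have -> : e * (s + 1) + (1 - e) * s = s + e by ring.
  rewrite -/B => h.
  have eB : e * (B + y) = y - beta s by rewrite divfK ?gt_eqF.
  have : s + e <= s.
    apply: ub_le_sup; first by exists M.
    split; first lra.
    by nra.
  by lra.
Qed.

Lemma cost_invP y : 0 < y -> to < cost_inv beta y /\ beta (cost_inv beta y) = y.
Proof.
have to_gt0 := hto.
move=> y0; have [t0 bt] : [set t | 0 <= t /\ beta t = y] (cost_inv beta y).
  exact: getPex (cost_surj y0).
split => //; rewrite ltNge; apply/negP => tt.
by have := cost_eq0 t0 tt; lra.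
Qed.

Lemma convexR_cost_comp a (phi : R -> R) : 0 < a -> convexR phi ->
  (forall x, 0 <= phi x) -> convexR (fun z => beta (a * phi z)).
Proof.
move=> a0 cphi phi0 x y t t0 t1.
have t1' : 0 <= 1 - t by lra.
apply: le_trans (cost_convex _ _ t0 t1); last 2 first.
- by rewrite mulr_ge0// ltW.
- by rewrite mulr_ge0// ltW.
apply: cost_le; first by rewrite mulr_ge0// ltW.
have := cphi x y t t0 t1.
by rewrite (mulrCA t) (mulrCA (1 - t)) -mulrDr ler_pM2l.
Qed.

Lemma measurable_cost_comp d (T : measurableType d) a (phi : T -> R) : 0 < a ->
  (forall z, 0 <= phi z) -> measurable_fun setT phi ->
  measurable_fun setT (fun z => beta (a * phi z)).
Proof.
move=> a0 phi0 mphi.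
pose g z : measurableTypeR R := a * phi z.
have mg : measurable_fun setT g by exact: measurable_funM.
rewrite [X in measurable_fun _ X](_ : _ = beta \o g)//.
refine (measurable_comp _ _ (cost_measurable hbeta) mg).
  exact: measurable_itv.
by move=> _ [z _ <-] /=; rewrite in_itv/= andbT mulr_ge0// ltW.
Qed.

End convex_cost_theory.

(** * Laws, quantiles and the uniform law on the unit interval *)

Lemma measurable_preimage d1 d2 (T1 : measurableType d1) (T2 : measurableType d2)
    (f : T1 -> T2) (Y : set T2) :
  measurable_fun setT f -> measurable Y -> measurable (f @^-1` Y).
Proof. by move=> mf mY; rewrite -[X in measurable X]setTI; exact: mf. Qed.

Section law_def.
Context d1 d2 (T1 : measurableType d1) (T2 : measurableType d2) (R : realType).
Variables (P : probability T1 R) (f : T1 -> T2) (mf : measurable_fun setT f).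

Definition mfun_of : {mfun T1 >-> T2} :=
  HB.pack_for {mfun T1 >-> T2} f (isMeasurableFun.Build _ _ _ _ f mf).

Definition law : probability T2 R := distribution P mfun_of.

Lemma ge0_integral_law (g : T2 -> \bar R) : measurable_fun setT g ->
  (forall y, 0 <= g y)%E -> (\int[law]_y g y = \int[P]_x g (f x))%E.
Proof. by move=> mg g0; rewrite ge0_integral_distribution. Qed.

End law_def.

Section rays.
Context (R : realType).

Lemma finite_measure_eq_gen d (T : measurableType d) (G : set (set T))
    (m1 m2 : {measure set T -> \bar R}) :
  @measurable _ T = <<s G >> -> setI_closed G ->
  (m1 setT < +oo)%E -> m1 setT = m2 setT ->
  (forall B, G B -> m1 B = m2 B) ->
  forall A, measurable A -> m1 A = m2 A.
Proof.
move=> GE GI m1oo m12T m12 A mA.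
have m2oo : (m2 setT < +oo)%E by rewrite -m12T.
apply: (@dynkin_induction _ T G (fun A => m1 A = m2 A) GE) => //; last by rewrite -GE.
- move=> S mS mmS; rewrite -!setTD !measureD// !setTI.
  by congr (_ - _)%E.
- move=> F mF tF mmF; rewrite !measure_semi_bigcup//; last 2 first.
  + exact: bigcup_measurable.
  + exact: bigcup_measurable.
  by apply: eq_eseriesr => n _; exact: mmF.
Qed.

Lemma finite_measure_eq_lrays (m1 m2 : {measure set R -> \bar R}) :
  (m1 setT < +oo)%E -> m1 setT = m2 setT ->
  (forall x, m1 `]-oo, x[%classic = m2 `]-oo, x[%classic) ->
  forall A, measurable A -> m1 A = m2 A.
Proof.
move=> m1oo m12T m12.
apply: (@finite_measure_eq_gen _ R (@RGenInftyO.G R)) => //.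
- exact: RGenInftyO.measurableE.
- move=> _ _ [x ->] [y ->]; exists (Order.min x y).
  by apply/seteqP; split => z /=; rewrite !in_itv/= lt_min => /andP.
- by move=> _ [x ->]; exact: m12.
Qed.

Lemma finite_measure_eq_rrays (m1 m2 : {measure set R -> \bar R}) :
  (m1 setT < +oo)%E -> m1 setT = m2 setT ->
  (forall x, m1 `]x, +oo[%classic = m2 `]x, +oo[%classic) ->
  forall A, measurable A -> m1 A = m2 A.
Proof.
move=> m1oo m12T m12.
apply: (@finite_measure_eq_gen _ R (@RGenOInfty.G R)) => //.
- exact: RGenOInfty.measurableE.
- move=> _ _ [x ->] [y ->]; exists (Order.max x y).
  apply/seteqP; split => z /=; rewrite !in_itv/= !andbT gt_max; first by move=> [-> ->].
  by move=> /andP.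
- by move=> _ [x ->]; exact: m12.
Qed.

End rays.

Section distribution_function.
Context (R : realType) (P : probability R R).

Let idRV : {RV P >-> R} := mfun_of (@measurable_id _ R setT).

Lemma dist_funE x : dist_fun P x = cdf idRV x.
Proof. by []. Qed.

Lemma dist_fun_le x y : x <= y -> (dist_fun P x <= dist_fun P y)%E.
Proof. by move=> xy; rewrite !dist_funE; exact: cdf_nondecreasing. Qed.

Definition cumul x := fine (dist_fun P x).

Lemma dist_fun_fin x : dist_fun P x = (cumul x)%:E.
Proof. by rewrite /cumul fineK// fin_num_measure. Qed.

Lemma cumul_le x y : x <= y -> cumul x <= cumul y.
Proof. by move=> /dist_fun_le; rewrite !dist_fun_fin lee_fin. Qed.

Lemma cumul_ge0 x : 0 <= cumul x. Proof. exact: fine_ge0. Qed.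

Lemma cumul_le1 x : cumul x <= 1.
Proof. by rewrite -lee_fin -dist_fun_fin; exact: probability_le1. Qed.

(** The value 0 outside ]0, 1[, where the quantile may be infinite, makes this a
    real function on the whole line. *)
Definition quant v := if (0 < v) && (v < 1) then fine (quantile P v%:E) else 0.

Let S v := [set x : R | (v%:E <= dist_fun P x)%E].

Lemma quantile_set0 v : v < 1 -> S v !=set0.
Proof.
move=> v1; apply: contrapT => /nonemptyPn S0.
have : (1 <= v%:E :> \bar R)%E; last by rewrite lee_fin; lra.
apply: cvge_to_le (@cvg_cdfy1 _ _ _ P idRV) _.
apply: nearW => x; rewrite -dist_funE leNgt; apply/negP => vx.
have : S v x by exact: ltW.
by rewrite S0.
Qed.

Lemma quantile_set_lb v : 0 < v -> has_lbound (S v).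
Proof.
move=> v0; have [x0 x0v] : exists x0, (dist_fun P x0 < v%:E)%E.
  apply: contrapT => /forallNP h.
  have : (v%:E <= 0 :> \bar R)%E; last by rewrite lee_fin; lra.
  apply: cvge_to_ge (@cvg_cdfNy0 _ _ _ P idRV) _.
  by apply: nearW => x; rewrite -dist_funE leNgt; apply/negP; exact: h.
exists x0 => x Sx; rewrite leNgt; apply/negP => xx0.
by have := le_lt_trans (le_trans Sx (dist_fun_le (ltW xx0))) x0v; rewrite ltxx.
Qed.

Lemma quantileE v : 0 < v -> v < 1 -> quantile P v%:E = (quant v)%:E.
Proof.
move=> v0 v1; rewrite /quant v0 v1 /quantile ereal_inf_EFin//.
- exact: quantile_set_lb.
- exact: quantile_set0.
Qed.

(** The direction from left to right is the right-continuity of the distribution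
    function. *)
Lemma quant_le v x : 0 < v -> v < 1 -> (quant v <= x) = (v <= cumul x).
Proof.
move=> v0 v1.
have -> : quant v = inf (S v).
  apply/EFin_inj; rewrite -quantileE// /quantile ereal_inf_EFin//.
  - exact: quantile_set_lb.
  - exact: quantile_set0.
rewrite -lee_fin -[RHS]lee_fin -dist_fun_fin.
apply/idP/idP => [|vx]; last first.
  by rewrite lee_fin; apply: ge_inf => //; exact: quantile_set_lb.
rewrite lee_fin => Sx.
apply: cvge_to_ge (@cdf_right_continuous _ _ _ P idRV x) _.
near=> y.
have xy : x < y by near: y; exact: nbhs_right_gt.
have [z Sz zy] : exists2 z, S v z & z < y.
  by apply: inf_lt => //; [exact: quantile_set0|exact: le_lt_trans Sx xy].
exact: le_trans Sz (dist_fun_le (ltW zy)).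
Unshelve. all: by end_near. Qed.

Lemma quant_lt v x : 0 < v -> v < 1 -> (x < quant v) = (cumul x < v).
Proof. by move=> v0 v1; rewrite !ltNge quant_le. Qed.

Lemma cumul_quant v : 0 < v -> v < 1 -> v <= cumul (quant v).
Proof. by move=> v0 v1; rewrite -quant_le. Qed.

Lemma quant_homo u v : 0 < u -> u <= v -> v < 1 -> quant u <= quant v.
Proof.
move=> u0 uv v1; have u1 : u < 1 by exact: le_lt_trans v1.
rewrite quant_le//; apply: (le_trans uv); apply: cumul_quant => //.
exact: lt_le_trans uv.
Qed.

Lemma measurable_quant : measurable_fun setT quant.
Proof.
apply: (measurability (@RGenInftyO.G R)) => [|/= _ [_] [r] -> <-].
  exact: RGenInftyO.measurableE.
rewrite setTI.
(* The second set of the union accounts for the value 0 of quant outside ]0, 1[. *)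
have -> : quant @^-1` `]-oo, r[%classic =
   (`]0, 1[ `&` \bigcup_n [set v | v <= cumul (r - n.+1%:R^-1)]) `|`
   (if 0 < r then ~` `]0, 1[ else set0)%classic.
  apply/seteqP; split => v /=.
    rewrite in_itv/= => qr.
    have [v01|v01] := boolP ((0 < v) && (v < 1)).
      left; rewrite in_itv/= v01; split => //; case/andP: v01 => v0 v1.
      have e0 : 0 < r - quant v by rewrite subr_gt0.
      have [n nr] := ltr_add_invr e0.
      rewrite add0r in nr.
      exists n => //=; rewrite -quant_le//.
      by rewrite lerBrDl -lerBrDr ltW.
    right; move: qr; rewrite /quant (negbTE v01) => -> /=.
    by rewrite in_itv/=; exact/negP.
  move=> [[+ [n _ /=]]|].
    rewrite !in_itv/= => /andP[v0 v1]; rewrite -quant_le// => h.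
    by apply: le_lt_trans h _; rewrite ltrBlDr ltrDl invr_gt0.
  case: ifPn => // r0 /=; rewrite !in_itv/= => /negP v01.
  by rewrite /quant (negbTE v01).
apply: measurableU; last by case: ifPn => // _; exact: measurableC.
apply: measurableI => //; apply: bigcupT_measurable => n.
by rewrite (_ : [set _ | _] = `]-oo, cumul (r - n.+1%:R^-1)]%classic)//;
  apply/seteqP; split => z /=; rewrite in_itv.
Qed.

End distribution_function.

Section uniform_on_unit_interval.
Context (R : realType).

Lemma measurable_id_ocitv : measurable_fun setT (idfun : measurableTypeR R -> R).
Proof. exact: measurable_id. Qed.

(** uniform_prob lives on measurableTypeR R, whose measurable structure is not
    syntactically that of R; its image under the identity is a probability on R. *)
Definition unif : probability R R :=
  law (uniform_prob (@ltr01 R)) measurable_id_ocitv.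

Lemma ge0_integral_unif (f : R -> \bar R) : measurable_fun setT f ->
  (forall x, 0 <= f x)%E ->
  (\int[unif]_x f x = \int[lebesgue_measure]_(x in `]0%R, 1%R[) f x)%E.
Proof.
move=> mf f0; rewrite ge0_integral_law// integral_uniform// subr0 invr1 mul1e.
by rewrite integral_itv_bndoo//; exact: measurable_funTS.
Qed.

Lemma unifE (A : set R) : measurable A ->
  unif A = lebesgue_measure (A `&` `]0, 1[%classic).
Proof.
move=> mA; rewrite -[LHS]mul1e -[LHS]integral_cst//.
rewrite -[X in (\int[_]_(x in X) _ = _)%E]setTI integral_mkcondr.
rewrite ge0_integral_unif//.
- by rewrite -integral_mkcondr integral_cst//= ?mul1e 1?setIC//; exact: measurableI.
- exact/(measurable_restrict _ _ _).
- by move=> x; rewrite patchE; case: ifP.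
Qed.

Lemma ae_unif : {ae unif, forall v, 0 < v /\ v < 1}.
Proof.
exists (~` `]0, 1[%classic); split.
- exact: measurableC.
- by rewrite unifE ?setICl ?measure0//; exact: measurableC.
- by move=> v /= h; rewrite in_itv/= => /andP[v0 v1]; apply: h.
Qed.

Lemma unif_ray c : 0 <= c -> c <= 1 -> unif [set v | v <= c] = c%:E.
Proof.
move=> c0 c1.
have -> : [set v | v <= c] = `]-oo, c]%classic by apply/seteqP; split => x /=; rewrite in_itv.
rewrite unifE//.
have [->|cn1] := eqVneq c 1.
  rewrite (_ : _ `&` _ = `]0, 1[%classic).
    by rewrite lebesgue_measure_itv/= lte_fin ltr01 oppr0 adde0.
  by apply/seteqP; split => x /=; rewrite !in_itv/=; [case|move=> /andP[-> x1]; split => //; exact: ltW].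
rewrite (_ : _ `&` _ = `]0, c]%classic).
  rewrite lebesgue_measure_itv/= lte_fin oppr0 adde0; case: ltP => // c0'.
  by congr _%:E; lra.
have {}c1 : c < 1 by lra.
apply/seteqP; split => x /=; rewrite !in_itv/=.
  by move=> [xc /andP[-> _]].
by move=> /andP[-> xc]; split => //=; lra.
Qed.

(** Sampling by the quantile function: by quant_le, quant v <= x is the event
    v <= cumul x, which has mass cumul x. *)
Lemma law_quant (P : probability R R) A : measurable A ->
  law unif (measurable_quant P) A = P A.
Proof.
apply: finite_measure_eq_rrays => //.
- by rewrite (_ : _ setT = 1%E) ?ltry//; exact: probability_setT.
- by transitivity (1%E : \bar R); [|apply/esym]; exact: probability_setT.
move=> x; transitivity (unif (quant P @^-1` `]x, +oo[%classic)) => //.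
have -> : `]x, +oo[%classic = ~` `]-oo, x]%classic :> set R by rewrite setCitvl.
have m1 : measurable (quant P @^-1` `]-oo, x]%classic).
  exact: (measurable_preimage (measurable_quant P)).
transitivity (1 - unif (quant P @^-1` `]-oo, x]%classic))%E.
  exact: probability_setC.
transitivity (1 - P `]-oo, x]%classic)%E; last first.
  by apply/esym; exact: probability_setC.
congr (_ - _)%E.
transitivity (unif [set v | v <= cumul P x]); last first.
  by rewrite unif_ray ?cumul_ge0 ?cumul_le1// -dist_fun_fin.
have m2 : measurable [set v | v <= cumul P x].
  by rewrite (_ : [set _ | _] = `]-oo, cumul P x]%classic)//;
    apply/seteqP; split => z /=; rewrite in_itv.
rewrite !unifE//; congr (lebesgue_measure _).
apply/seteqP; split => v /=; rewrite !in_itv/= => -[h /andP[v0 v1]].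
  by rewrite -quant_le// v0 v1.
by rewrite quant_le// v0 v1.
Qed.

End uniform_on_unit_interval.

(** * Jensen's inequality, densities and relative entropy *)

Lemma measurable_expR_comp d (T : measurableType d) (R : realType) (f : T -> R) :
  measurable_fun setT f -> measurable_fun setT (fun x => expR (f x)).
Proof. by move=> mf; exact: (measurableT_comp (@measurable_expR R) mf). Qed.

Section integral_tools.
Context d (T : measurableType d) (R : realType).

Lemma prob_cst (P : probability T R) (c : \bar R) : (\int[P]_x c = c)%E.
Proof.
rewrite (integral_cst P measurableT).
by rewrite (_ : _ setT = 1%E) ?mule1//; exact: probability_setT.
Qed.

Lemma integrable_bounded (P : probability T R) (f : T -> R) (M : R) :
  measurable_fun setT f -> (forall x, `|f x| <= M) ->
  P.-integrable setT (EFin \o f).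
Proof.
move=> mf fM; apply/integrableP; split; first exact/measurable_EFinP.
apply: (@le_lt_trans _ _ (\int[P]_x M%:E)%E); last by rewrite prob_cst ltry.
apply: ge0_le_integral => //.
- by apply: measurableT_comp => //; exact/measurable_EFinP.
- by move=> x _; rewrite lee_fin.
Qed.

Lemma ge0_integrable (P : {measure set T -> \bar R}) (f : T -> \bar R) :
  measurable_fun setT f -> (forall x, 0 <= f x)%E -> (\int[P]_x f x < +oo)%E ->
  P.-integrable setT f.
Proof.
move=> mf f0 foo; apply/integrableP; split => //.
by under eq_integral do rewrite gee0_abs//.
Qed.

End integral_tools.

Section jensen.
Context (R : realType).

(** Integrate a supporting line at the mean. *)
Lemma jensen (P : probability R R) (g : R -> R) : convexR g ->
  (forall x, 0 <= g x) -> measurable_fun setT g ->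
  P.-integrable setT (EFin \o (id : R -> R)) ->
  ((g (\int[P]_y y)%R)%:E <= \int[P]_y (g y)%:E)%E.
Proof.
move=> cg g0 mg iid; set m := (\int[P]_y y)%R.
have [goo|goo] := boolP (\int[P]_y (g y)%:E < +oo)%E; last first.
  by move: goo; rewrite -leNgt leye_eq => /eqP ->; rewrite leey.
have [c hc] := convexR_support cg m.
have mE : (\int[P]_y y%:E = m%:E)%E.
  by rewrite /m /Rintegral fineK//; exact: integrable_fin_num.
have ig : P.-integrable setT (EFin \o g).
  by apply: ge0_integrable => //; exact/measurable_EFinP.
have icst (r : R) : P.-integrable setT (cst r%:E).
  by apply: (@integrable_bounded _ _ _ _ (cst r) `|r|).
have il : P.-integrable setT (fun y => (g m - c * m)%:E + c%:E * y%:E)%E.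
  exact: (integrableD measurableT (icst _) (integrableZl measurableT c iid)).
apply: (@le_trans _ _ (\int[P]_y ((g m - c * m)%:E + c%:E * y%:E)%E)%E).
  rewrite (integralD measurableT (icst _) (integrableZl measurableT c iid)).
  rewrite (integralZl measurableT iid) mE prob_cst -EFinM -EFinD lee_fin; lra.
apply: le_integral => // y _; rewrite -EFinM -EFinD lee_fin.
by have := hc y; lra.
Qed.

End jensen.

Section density.
Context (R : realType).
Implicit Types (mu nu : probability R R) (k : R -> R).

Definition has_density nu mu k : Prop :=
  [/\ measurable_fun setT k, forall x, 0 <= k x &
   forall A, measurable A -> nu A = (\int[mu]_(x in A) (k x)%:E)%E].

Lemma density_dominates nu mu k : has_density nu mu k -> nu `<< mu.
Proof.
move=> [mk k0 kE]; apply/null_content_dominatesP => A mA A0.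
rewrite kE//; apply: null_set_integral => //.
by apply/measurable_EFinP; exact: measurable_funTS.
Qed.

Lemma has_density_ex nu mu : nu `<< mu -> exists k, has_density nu mu k.
Proof.
move=> numu; pose f := Radon_Nikodym_SigmaFinite.f nu mu.
have fE x : (fine (f x))%:E = f x by rewrite fineK//; exact: Radon_Nikodym_SigmaFinite.f_fin_num.
have mf : measurable_fun setT f.
  exact: measurable_int (Radon_Nikodym_SigmaFinite.f_integrable numu).
exists (fine \o f); split.
- exact: measurableT_comp.
- by move=> x; apply: fine_ge0; exact: Radon_Nikodym_SigmaFinite.f_ge0.
- move=> A mA; rewrite (Radon_Nikodym_SigmaFinite.f_integral numu mA).
  by apply: eq_integral => x _; rewrite /= fE.
Qed.

Lemma density_ae_RN nu mu k : has_density nu mu k ->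
  ae_eq mu setT (EFin \o k) (Radon_Nikodym_SigmaFinite.f nu mu).
Proof.
move=> hk; have numu := density_dominates hk; case: hk => mk k0 kE.
apply: integral_ae_eq => //.
- apply: ge0_integrable; first exact/measurable_EFinP.
    by move=> x; rewrite lee_fin.
  by rewrite -kE// (_ : _ setT = 1%E) ?ltry//; exact: probability_setT.
- exact: measurable_int (Radon_Nikodym_SigmaFinite.f_integrable numu).
- by move=> A _ mA; rewrite -(Radon_Nikodym_SigmaFinite.f_integral numu mA) -kE.
Qed.

Lemma density_integral nu mu k (G : R -> \bar R) : has_density nu mu k ->
  measurable_fun setT G -> (forall x, 0 <= G x)%E ->
  (\int[nu]_x G x = \int[mu]_x (G x * (k x)%:E))%E.
Proof.
move=> hk mG G0; have numu := density_dominates hk.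
rewrite -(Radon_Nikodym_SigmaFinite.change_of_variables numu)//.
have mf := measurable_int _ (Radon_Nikodym_SigmaFinite.f_integrable numu).
apply: ge0_ae_eq_integral => //.
- exact: emeasurable_funM.
- by apply: emeasurable_funM => //; apply/measurable_EFinP; case: hk.
- by move=> x _; rewrite mule_ge0//; exact: Radon_Nikodym_SigmaFinite.f_ge0.
- by move=> x _; rewrite mule_ge0// lee_fin; case: hk.
- by apply: ae_eqe_mul2l; apply: ae_eq_sym; exact: density_ae_RN.
Qed.

Lemma measurable_lne_EFin k : measurable_fun setT k ->
  measurable_fun setT (fun x => lne (k x)%:E).
Proof.
move=> mk.
have -> : (fun x => lne (k x)%:E) =
    (fun x => if 0 < k x then (ln (k x))%:E else -oo%E).
  apply/funext => x; case: ifPn => [k0|]; first by rewrite lne_EFin.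
  by rewrite -leNgt => k0; rewrite le0_lneNy ?lee_fin.
apply: measurable_fun_ifT => //.
- exact: measurable_fun_ltr.
- by apply/measurable_EFinP; exact: measurableT_comp.
Qed.

Lemma density_entropy nu mu k : has_density nu mu k ->
  rel_entropy nu mu = (\int[nu]_x lne (k x)%:E)%E.
Proof.
move=> hk; have numu := density_dominates hk.
rewrite /rel_entropy asboolT//.
have h : ae_eq mu setT (EFin \o k) ('d (charge_of_finite_measure nu) '/d mu).
  apply: ae_eq_trans (density_ae_RN hk) _.
  exact: ae_eq_Radon_Nikodym_SigmaFinite.
have mk : measurable_fun setT k by case: hk.
pose g := 'd (charge_of_finite_measure nu) '/d mu.
have mg : measurable_fun setT g.
  by apply: measurable_int; apply: Radon_Nikodym_integrable.
have gE : (fun x => lne (g x)) = (fun x => lne ((fine \o g) x)%:E).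
  by apply/funext => x; rewrite /comp fineK//; exact: Radon_Nikodym_fin_num.
apply: ae_eq_integral => //.
- by rewrite gE; apply: measurable_lne_EFin; exact: measurableT_comp.
- exact: measurable_lne_EFin.
- case: h => N [mN N0 hN]; exists N; split => //.
    by move/null_content_dominatesP : numu; apply.
  move=> x nx; apply: hN => hx; apply: nx => _.
  congr lne; exact/esym/(hx Logic.I).
Qed.

Lemma density_pos_ae nu mu k : has_density nu mu k ->
  {ae nu, forall x, 0 < k x}.
Proof.
move=> hk; have mk : measurable_fun setT k by case: hk.
exists [set x | k x <= 0]; split.
- by rewrite -[X in measurable X]setTI; exact: measurable_fun_le.
- have mA : measurable [set x | k x <= 0].
    by rewrite -[X in measurable X]setTI; exact: measurable_fun_le.
  case: hk => _ k0 ->//; rewrite (eq_integral (cst 0%E)) ?integral0//.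
  move=> x; rewrite inE/= => kx; congr _%:E; apply/eqP.
  by rewrite eq_le kx k0.
- by move=> x /= /negP; rewrite -leNgt.
Qed.

(** The logarithm of the density, made finite on the nu-null set where the density
    vanishes. *)
Definition pln k x := if 0 < k x then ln (k x) else 0.

Lemma measurable_pln k : measurable_fun setT k -> measurable_fun setT (pln k).
Proof.
move=> mk; apply: measurable_fun_ifT => //.
- exact: measurable_fun_ltr.
- exact: measurableT_comp.
Qed.

Lemma density_entropy_pln nu mu k : has_density nu mu k ->
  rel_entropy nu mu = (\int[nu]_x (pln k x)%:E)%E.
Proof.
move=> hk; rewrite (density_entropy hk); have mk : measurable_fun setT k by case: hk.
apply: ae_eq_integral => //.
- exact: measurable_lne_EFin.
- by apply/measurable_EFinP; exact: measurable_pln.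
- have [N [mN N0 hN]] := density_pos_ae hk; exists N; split => //.
  move=> x nx; apply: hN => hx; apply: nx => _.
  by rewrite /pln hx lne_EFin.
Qed.

(** The easy half of the variational formula of the entropy: with L the logarithm
    of the density of nu, integrate 1 + (phi - L) <= e^(phi - L) against nu. *)
Lemma gibbs nu mu k (phi : R -> R) M : has_density nu mu k ->
  measurable_fun setT phi -> (forall x, `|phi x| <= M) ->
  (\int[nu]_x (phi x)%:E + 1 <=
   rel_entropy nu mu + \int[mu]_x (expR (phi x))%:E)%E.
Proof.
move=> hk mphi phiM.
have mk : measurable_fun setT k by case: hk.
have k0 : forall x, 0 <= k x by case: hk.
have mL := measurable_pln mk.
pose G (psi : R -> R) x := expR (psi x - pln k x).
have mG psi : measurable_fun setT psi -> measurable_fun setT (G psi).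
  move=> mpsi; apply: measurable_expR_comp.
  exact: measurable_funB.
have IG psi : measurable_fun setT psi ->
    (\int[nu]_x (G psi x)%:E <= \int[mu]_x (expR (psi x))%:E)%E.
  move=> mpsi; rewrite (density_integral hk); last 2 first.
  - by apply/measurable_EFinP; exact: mG.
  - by move=> x; rewrite lee_fin expR_ge0.
  apply: ge0_le_integral => //.
  - by move=> x _; rewrite mule_ge0// lee_fin// expR_ge0.
  - by apply/measurable_EFinP/measurable_funM => //; exact: mG.
  - by apply/measurable_EFinP; exact: measurable_expR_comp.
  - move=> x _; rewrite -EFinM lee_fin /G /pln; case: ltP => [kx|kx].
      by rewrite expRD expRN lnK ?posrE// divfK// gt_eqF.
    have -> : k x = 0 by apply/eqP; rewrite eq_le kx k0.
    by rewrite mulr0 expR_ge0.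
rewrite (density_entropy_pln hk).
have Iexp : (\int[mu]_x (expR (phi x))%:E < +oo)%E.
  apply: (@le_lt_trans _ _ (\int[mu]_x (expR M)%:E)%E); last by rewrite prob_cst ltry.
  apply: ge0_le_integral => //.
  - by apply/measurable_EFinP; exact: measurable_expR_comp.
  - by move=> x _; rewrite lee_fin ler_expR; apply: le_trans (ler_norm _) _.
have iG : nu.-integrable setT (EFin \o G phi).
  apply: ge0_integrable; first by apply/measurable_EFinP; exact: mG.
    by move=> x; rewrite lee_fin expR_ge0.
  exact: le_lt_trans (IG _ mphi) Iexp.
have Lneg : (\int[nu]_x ((EFin \o pln k)^\- x) < +oo)%E.
  apply: (@le_lt_trans _ _ (\int[nu]_x (G (cst 0) x)%:E)%E).
    apply: ge0_le_integral => //.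
    - by apply: measurable_funeneg; apply/measurable_EFinP.
    - by apply/measurable_EFinP; apply: mG.
    - move=> x _; rewrite funenegE ge_max; apply/andP; split; last first.
        by rewrite lee_fin expR_ge0.
      rewrite /= lee_fin.
      by have := expR_ge1Dx (- pln k x); rewrite /G /= sub0r; lra.
  apply: le_lt_trans (IG (cst 0) _) _ => //.
  by rewrite /= expR0 prob_cst ltry.
(* If the positive part of L is not integrable, then the entropy is +oo. *)
have [Lpos|Lpos] := boolP (\int[nu]_x ((EFin \o pln k)^\+ x) < +oo)%E; last first.
  have -> : (\int[nu]_x (pln k x)%:E = +oo)%E.
    transitivity (\int[nu]_x (EFin \o pln k)^\+ x - \int[nu]_x (EFin \o pln k)^\- x)%E.
      exact: integralE.
    move: Lpos; rewrite -leNgt leye_eq => /eqP ->.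
    by rewrite addye// -ltNye lteNr.
  have I0 : (0 <= \int[mu]_x (expR (phi x))%:E)%E by apply: integral_ge0.
  by rewrite addye ?leey// -ltNye; apply: lt_le_trans I0.
have iL : nu.-integrable setT (EFin \o pln k).
  have mLE : measurable_fun setT (EFin \o pln k) by exact/measurable_EFinP.
  apply/integrableP; split => //.
  rewrite (_ : (fun x => _) = (fun x => (EFin \o pln k)^\+ x + (EFin \o pln k)^\- x)%E); last first.
    by apply/funext => x; rewrite -[LHS]/((abse \o (EFin \o pln k)) x) fune_abse.
  rewrite ge0_integralD//; last 2 first.
  - exact: measurable_funepos.
  - exact: measurable_funeneg.
  exact: lte_add_pinfty.
have iphi : nu.-integrable setT (EFin \o phi).
  exact: integrable_bounded mphi phiM.
apply: (@le_trans _ _ (\int[nu]_x ((pln k x)%:E + (G phi x)%:E))%E).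
  rewrite -[X in (_ + X)%E](prob_cst nu 1%E) -integralD//; last first.
    by apply: (@integrable_bounded _ _ _ _ (cst 1) 1) => // x; rewrite normr1.
  apply: le_integral => //.
  - apply: integrableD => //.
    by apply: (@integrable_bounded _ _ _ _ (cst 1) 1) => // x; rewrite normr1.
  - exact: integrableD.
  move=> x _; rewrite -!EFinD lee_fin /G.
  by have := expR_ge1Dx (phi x - pln k x); lra.
rewrite integralD//; apply: leeD2l; exact: IG.
Qed.

End density.

Section density_prob.
Context (R : realType) (mu : probability R R) (k : R -> R).

Definition density_measure (mk : measurable_fun setT k) (k0 : forall x, 0 <= k x)
    (k1 : (\int[mu]_x (k x)%:E = 1)%E) : set R -> \bar R :=
  fun A => (\int[mu]_(x in A) (k x)%:E)%E.

Hypotheses (mk : measurable_fun setT k) (k0 : forall x, 0 <= k x)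
  (k1 : (\int[mu]_x (k x)%:E = 1)%E).

Local Notation dm := (density_measure mk k0 k1).

Let dm0 : dm set0 = 0%E.
Proof. by rewrite /density_measure integral_set0. Qed.

Let dm_ge0 A : (0 <= dm A)%E.
Proof. by apply: integral_ge0 => x _; rewrite lee_fin. Qed.

Let dm_sigma_additive : semi_sigma_additive dm.
Proof.
move=> F mF tF mUF; apply: cvg_toP.
  apply: ereal_nondecreasing_is_cvgn => m n mn.
  by apply: lee_sum_nneg_natr => // j _ _; exact: dm_ge0.
rewrite /density_measure ge0_integral_bigcup//=.
  by apply/measurable_EFinP; exact: measurable_funTS.
by move=> x _; rewrite lee_fin.
Qed.

HB.instance Definition _ := isMeasure.Build _ _ _ dm dm0 dm_ge0 dm_sigma_additive.
HB.instance Definition _ := Measure_isProbability.Build _ _ _ dm k1.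

Lemma density_prob : exists nu : probability R R, has_density nu mu k.
Proof. by exists dm; split. Qed.

End density_prob.

Section integral_law.
Context d1 d2 (T1 : measurableType d1) (T2 : measurableType d2) (R : realType).

Lemma integral_law (P : probability T1 R) (f : T1 -> T2) (mf : measurable_fun setT f)
    (g : T2 -> \bar R) : measurable_fun setT g ->
  (\int[law P mf]_y g y = \int[P]_x g (f x))%E.
Proof.
move=> mg; rewrite integralE [RHS]integralE.
have -> : ((fun x => g (f x))^\+)%E = (fun x => g^\+%E (f x)).
  by apply/funext => x; rewrite !funeposE.
have -> : ((fun x => g (f x))^\-)%E = (fun x => g^\-%E (f x)).
  by apply/funext => x; rewrite !funenegE.
by congr (_ - _)%E; apply: ge0_integral_law => //;
  [exact: measurable_funepos|exact: measurable_funeneg].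
Qed.

End integral_law.

(** * Sampling from a coupling *)

Section finite_measure_of.
Context d (T : measurableType d) (R : realType) (m : {measure set T -> \bar R}).

Definition as_finite_measure (mfin : fin_num_fun m) : set T -> \bar R := m.

Hypothesis mfin : fin_num_fun m.

HB.instance Definition _ := Measure.on (as_finite_measure mfin).
HB.instance Definition _ :=
  Measure_isFinite.Build _ _ _ (as_finite_measure mfin) mfin.

End finite_measure_of.

Lemma finite_measure_density (R : realType) (mu : probability R R)
    (m : {measure set R -> \bar R}) :
  (forall A, measurable A -> (m A <= mu A)%E) ->
  exists f : R -> R, [/\ measurable_fun setT f, forall x, 0 <= f x &
    forall A, measurable A -> m A = (\int[mu]_(x in A) (f x)%:E)%E].
Proof.
move=> mle.
have mfin : fin_num_fun m.
  move=> A mA; rewrite ge0_fin_numE//; apply: le_lt_trans (mle A mA) _.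
  by apply: le_lt_trans (probability_le1 mu mA) _; rewrite ltry.
pose m' : {finite_measure set R -> \bar R} := as_finite_measure mfin.
have m'mu : m' `<< mu.
  apply/null_content_dominatesP => A mA A0.
  by apply/eqP; rewrite eq_le measure_ge0 andbT -A0; exact: mle.
pose f := Radon_Nikodym_SigmaFinite.f m' mu.
exists (fine \o f); split.
- apply: measurableT_comp => //.
  exact: measurable_int (Radon_Nikodym_SigmaFinite.f_integrable m'mu).
- by move=> x; apply: fine_ge0; exact: Radon_Nikodym_SigmaFinite.f_ge0.
- move=> A mA; transitivity (m' A) => //.
  rewrite (Radon_Nikodym_SigmaFinite.f_integral m'mu mA).
  by apply: eq_integral => x _; rewrite /= fineK//; exact: Radon_Nikodym_SigmaFinite.f_fin_num.
Qed.

Section restricted_image.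
Context d1 d2 (T1 : measurableType d1) (T2 : measurableType d2) (R : realType).
Context (Q : {measure set T1 -> \bar R}) (f : T1 -> T2) (C : set T1).

(** With Q a law on a product, f the first projection and C a strip setT x B, this
    is the measure A |-> Q (A x B). *)
Definition restricted_image (mf : measurable_fun setT f) (mC : measurable C) :
    set T2 -> \bar R :=
  fun A => Q (f @^-1` A `&` C).

Hypotheses (mf : measurable_fun setT f) (mC : measurable C).
Local Notation ri := (restricted_image mf mC).

Let mpre A : measurable A -> measurable (f @^-1` A `&` C).
Proof. by move=> mA; apply: measurableI => //; exact: measurable_preimage. Qed.

Let ri0 : ri set0 = 0%E.
Proof. by rewrite /restricted_image preimage_set0 set0I measure0. Qed.

Let ri_ge0 A : (0 <= ri A)%E. Proof. exact: measure_ge0. Qed.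

Let ri_sigma_additive : semi_sigma_additive ri.
Proof.
move=> F mF tF mUF.
have -> : ri (\bigcup_n F n) = Q (\bigcup_n (f @^-1` F n `&` C)).
  by rewrite /restricted_image preimage_bigcup setI_bigcupl.
apply: (@measure_semi_sigma_additive _ _ _ Q (fun n => f @^-1` F n `&` C)).
- by move=> n; exact: mpre.
- apply/trivIsetP => i j _ _ ij.
  apply/seteqP; split => // x [[Fi _] [Fj _]].
  move/trivIsetP : tF => /(_ i j Logic.I Logic.I ij) E.
  by have : (F i `&` F j) (f x) by []; rewrite E.
- by apply: bigcupT_measurable => n; exact: mpre.
Qed.

HB.instance Definition _ := isMeasure.Build _ _ _ ri ri0 ri_ge0 ri_sigma_additive.

End restricted_image.

Section product_probability.
Context d1 d2 (T1 : measurableType d1) (T2 : measurableType d2) (R : realType).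
Variables (P : probability T1 R) (Q : probability T2 R).

Definition product_prob : set (T1 * T2) -> \bar R := (P \x Q)%E.

HB.instance Definition _ := Measure.on product_prob.

Let product_prob_setT : product_prob setT = 1%E.
Proof.
rewrite -setXTT [LHS]product_measure1E//.
by rewrite -[RHS]mule1; congr (_ * _)%E; exact: probability_setT.
Qed.

HB.instance Definition _ := Measure_isProbability.Build _ _ _
  product_prob product_prob_setT.

End product_probability.

Section conditional_density.
Context (R : realType) (mu : probability R R) (pi : probability (R * R)%type R).
Hypothesis marg : forall A, measurable A -> pi (A `*` setT) = mu A.

(** f x is a version of the conditional probability of C given the first coordinate. *)
Definition cond_density (C : set R) (f : R -> R) : Prop :=
  [/\ measurable_fun setT f, forall x, 0 <= f x &
   forall A, measurable A -> pi (A `*` C) = (\int[mu]_(x in A) (f x)%:E)%E].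

Lemma cond_density_ex C : measurable C -> exists f, cond_density C f.
Proof.
move=> mC.
have mC' : measurable (setT `*` C : set (R * R)) by exact: measurableX.
pose m : {measure set R -> \bar R} :=
  restricted_image pi (@measurable_fst _ _ R R) mC'.
have mE A : m A = pi (A `*` C).
  rewrite /m /= /restricted_image; congr (pi _).
  by apply/seteqP; split => -[x y] /=; [move=> [? []]|move=> []].
have [|f [mf f0 fE]] := @finite_measure_density _ mu m.
  move=> A mA; rewrite mE -marg//; apply: le_measure; rewrite ?inE.
  - exact: measurableX.
  - exact: measurableX.
  - by move=> [x y] [].
by exists f; split => // A mA; rewrite -mE fE.
Qed.

Lemma cond_density_integrable C f : measurable C -> cond_density C f ->
  mu.-integrable setT (EFin \o f).
Proof.
move=> mC [mf f0 fE]; apply: ge0_integrable => //; first exact/measurable_EFinP.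
rewrite -fE//; apply: (@le_lt_trans _ _ 1%E); last exact: ltry.
by apply: probability_le1; exact: measurableX.
Qed.

Lemma cond_densityU C C' f f' f'' : measurable C -> measurable C' ->
  C `&` C' = set0 -> cond_density C f -> cond_density C' f' ->
  cond_density (C `|` C') f'' -> {ae mu, forall x, f'' x = f x + f' x}.
Proof.
move=> mC mC' CC' hf hf' hf''.
have : ae_eq mu setT (EFin \o f'') (fun x => (f x)%:E + (f' x)%:E)%E.
  apply: integral_ae_eq => //.
  - by apply: cond_density_integrable hf''; exact: measurableU.
  - by apply: emeasurable_funD; apply/measurable_EFinP; [case: hf|case: hf'].
  - move=> A _ mA; case: hf => mf f0 fE; case: hf' => mf' f'0 f'E; case: hf'' => _ _ f''E.
    rewrite ge0_integralD//; last 4 first.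
    + by move=> x _; rewrite lee_fin.
    + by apply/measurable_EFinP; exact: measurable_funTS.
    + by move=> x _; rewrite lee_fin.
    + by apply/measurable_EFinP; exact: measurable_funTS.
    rewrite -f''E// -fE// -f'E// -measureU//; last 3 first.
    + exact: measurableX.
    + exact: measurableX.
    + apply/seteqP; split => // -[x y] [[_ ?] [_ ?]].
      by have : (C `&` C') y by []; rewrite CC'.
    congr (pi _); apply/seteqP; split => -[x y] /=.
      by move=> [Ax [?|?]]; [left|right].
    by move=> [[Ax ?]|[Ax ?]]; split => //; [left|right].
case=> N [mN N0 hN]; exists N; split => // x nx; apply: hN => hx; apply: nx.
by have := hx Logic.I; rewrite /= -EFinD => -[->].
Qed.

Lemma cond_density_le C C' f f' : measurable C -> measurable C' -> C `<=` C' ->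
  cond_density C f -> cond_density C' f' -> {ae mu, forall x, f x <= f' x}.
Proof.
move=> mC mC' CC' hf hf'.
have mD : measurable (C' `\` C) by exact: measurableD.
have [g hg] := cond_density_ex mD.
have : {ae mu, forall x, f' x = f x + g x}.
  apply: (cond_densityU mC mD) => //; first by rewrite setDE setICA setICr setI0.
  by rewrite setDE setUIr setUCr setIT; move/setUidPr : CC' => ->.
by apply: filterS => x ->; rewrite lerDl; case: hg.
Qed.

Lemma cond_density_setT f : cond_density setT f -> {ae mu, forall x, f x = 1}.
Proof.
move=> hf.
have : ae_eq mu setT (EFin \o f) (cst 1%E).
  apply: integral_ae_eq => //.
  - exact: cond_density_integrable hf.
  - by move=> A _ mA; case: hf => _ _ fE; rewrite -fE// marg// integral_cst// mul1e.
case=> N [mN N0 hN]; exists N; split => // x nx; apply: hN => hx; apply: nx.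
by have := hx Logic.I; rewrite /= => -[].
Qed.

(** If f n x >= e for all n on a set B, then pi (B x C n) >= e * mu B for all n,
    while these sets decrease to the empty set; hence mu B = 0. *)
Lemma cond_density_small (C : nat -> set R) (f : nat -> R -> R) :
  (forall n, measurable (C n)) -> nonincreasing_seq C -> \bigcap_n C n = set0 ->
  (forall n, cond_density (C n) (f n)) ->
  {ae mu, forall x, forall e, 0 < e -> exists n, f n x < e}.
Proof.
move=> mC dC C0 hf.
have B0 k : mu (\bigcap_n [set x | k.+1%:R^-1 <= f n x]) = 0%E.
  set B := \bigcap_n _; set e : R := k.+1%:R^-1.
  have e0 : 0 < e by rewrite invr_gt0.
  have mB : measurable B.
    apply: bigcapT_measurable => n; rewrite -[X in measurable X]setTI.
    by apply: measurable_fun_le => //; case: (hf n).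
  have le n : (e%:E * mu B <= pi (B `*` C n))%E.
    case: (hf n) => mf f0 ->//.
    rewrite -integral_cst//; apply: ge0_le_integral => //.
    - by move=> x _; rewrite lee_fin ltW.
    - by apply/measurable_EFinP; exact: measurable_funTS.
    - by move=> x Bx; rewrite lee_fin; exact: Bx.
  have mBC n : measurable (B `*` C n) by exact: measurableX.
  have BC0 : \bigcap_n (B `*` C n) = set0.
    apply/seteqP; split => // -[x y] h.
    have : (\bigcap_n C n) y by move=> n _; case: (h n Logic.I).
    by rewrite C0.
  have cv : pi \o (fun n => B `*` C n) @ \oo --> 0%E.
    rewrite -(measure0 pi) -BC0; apply: nonincreasing_cvg_mu => //.
    - by apply: (@le_lt_trans _ _ 1%E); [exact: probability_le1|exact: ltry].
    - by rewrite BC0.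
    - move=> n m nm; apply/subsetPset => -[x y] [Bx Cy]; split => //.
      by have /subsetPset := dC _ _ nm; apply.
  have : (e%:E * mu B <= 0)%E by apply: cvge_to_ge cv _; apply: nearW => n; exact: le.
  by rewrite pmule_rle0 ?lte_fin// => h; apply/eqP; rewrite eq_le h measure_ge0.
have : mu.-negligible (\bigcup_k \bigcap_n [set x | k.+1%:R^-1 <= f n x]).
  apply: negligible_bigcup => k; apply/negligibleP; last exact: B0.
  apply: bigcapT_measurable => n; rewrite -[X in measurable X]setTI.
  by apply: measurable_fun_le => //; case: (hf n).
apply: negligibleS => x /= /existsNP[e /not_implyP[e0 /forallNP h]].
have [k ke] := ltr_add_invr e0; rewrite add0r in ke.
exists k => // n _ /=; apply: le_trans (ltW ke) _.
by rewrite leNgt; apply/negP; exact: h.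
Qed.

End conditional_density.

Definition rat_seq (R : realType) (n : nat) : R := ratr (odflt 0%Q (unpickle n)).

Lemma rat_seq_dense (R : realType) (x y : R) : x < y ->
  exists n, x < rat_seq R n /\ rat_seq R n < y.
Proof.
move=> /rat_in_itvoo[q]; rewrite in_itv/= => /andP[xq qy].
by exists (pickle q); rewrite /rat_seq pickleK.
Qed.

Lemma unif_ray_le (R : realType) (c : R) : 0 <= c -> (unif R [set v | v <= c]%R <= c%:E)%E.
Proof.
move=> c0; case: (leP c 1) => [c1|c1]; first by rewrite unif_ray.
apply: (@le_trans _ _ 1%E); last by rewrite lee_fin ltW.
apply: probability_le1.
by rewrite (_ : [set _ | _] = `]-oo, c]%classic)//;
    apply/seteqP; split => z /=; rewrite in_itv.
Qed.

Lemma unif_subset (R : realType) (A B : set R) : measurable A -> measurable B ->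
  (forall v, 0 < v -> v < 1 -> A v -> B v) -> (unif R A <= unif R B)%E.
Proof.
move=> mA mB AB; rewrite !unifE//; apply: le_measure; rewrite ?inE.
- exact: measurableI.
- exact: measurableI.
- move=> v /= [Av]; rewrite in_itv/= => /andP[v0 v1].
  by split; [exact: AB|rewrite v0 v1].
Qed.

Lemma measurable_rayc (R : realType) (c : R) : measurable [set v | v <= c].
Proof.
by rewrite (_ : [set _ | _] = `]-oo, c]%classic)//;
    apply/seteqP; split => z /=; rewrite in_itv.
Qed.

Section sampling_map.
Context (R : realType) (g : nat -> R -> R).
Hypothesis mg : forall n, measurable_fun setT (g n).
Local Notation r := (rat_seq R).

Definition sampling_set (z : R * R) : set R := [set r n | n in [set n | z.2 <= g n z.1]].

(** The conditional quantile T (x, u) = inf {t | u <= g t x}, along rational t only,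
    so that countably many null sets are discarded. *)
Definition sampling (z : R * R) : R := inf (sampling_set z).

Let mD n : measurable [set z : R * R | z.2 <= g n z.1].
Proof.
rewrite -[X in measurable X]setTI; apply: measurable_fun_le => //.
exact: (measurableT_comp (mg n)).
Qed.

Lemma measurable_sampling : measurable_fun setT sampling.
Proof.
(* Outside H, inf has its default value 0. *)
pose H := [set z | has_inf (sampling_set z)].
have mH : measurable H.
  rewrite (_ : H = (\bigcup_n [set z : R * R | z.2 <= g n z.1]) `&`
     \bigcup_j \bigcap_(n in [set n | r n < - j%:R]) ~` [set z : R * R | z.2 <= g n z.1]).
    apply: measurableI; apply: bigcupT_measurable => //.
    by move=> j; apply: bigcap_measurableType => n _; exact: measurableC.
  apply/seteqP; split => z.
    move=> [[_ [n zn _]] [b bz]]; split; first by exists n.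
    exists (Num.bound `|b|) => // m /= rm zm.
    have : b <= r m by apply: bz; exists m.
    have := archi_boundP (normr_ge0 b).
    by have := ler_norm (- b); rewrite normrN; lra.
  move=> [[n _ zn] [j _ h]]; split; first by exists (r n), n.
  exists (- j%:R) => _ [m zm <-]; rewrite leNgt; apply/negP => rm.
  exact: (h m rm).
apply: (measurability (@RGenInftyO.G R)) => [|/= _ [_] [t] -> <-].
  exact: RGenInftyO.measurableE.
rewrite setTI (_ : _ @^-1` _ =
   (H `&` \bigcup_(n in [set n | r n < t]) [set z : R * R | z.2 <= g n z.1]) `|`
   (~` H `&` if 0 < t then setT else set0)).
  apply: measurableU.
    by apply: measurableI => //; apply: bigcup_measurable.
  by apply: measurableI; [exact: measurableC|case: ifP].
apply/seteqP; split => z /=; rewrite in_itv/=.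
  have [Hz|Hz] := pselect (H z).
    move=> zt; left; split => //; have [_ [n zn <-] nt] := inf_lt Hz.1 zt.
    by exists n.
  by rewrite /sampling inf_out// => ->; right.
move=> [[Hz [n nt zn]]|[Hz]].
  apply: le_lt_trans nt; apply: ge_inf; first by case: Hz.
  by exists n.
by rewrite /sampling inf_out//; case: ifP.
Qed.

End sampling_map.

(** Agreement on the products A x ]-oo, t[ is enough: for fixed A it extends to
    A x B by uniqueness on rays, then to the product sigma-algebra by uniqueness
    on rectangles. *)
Section strips.
Context (R : realType) (P Q : probability (R * R)%type R).
Hypotheses
  (PQT : forall A, measurable A -> P (A `*` setT) = Q (A `*` setT))
  (PQ : forall A t, measurable A -> P (A `*` `]-oo, t[%classic) = Q (A `*` `]-oo, t[%classic)).

Let strip_finite (N : probability (R * R)%type R) E : measurable E -> (N E < +oo)%E.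
Proof. by move=> mE; apply: (@le_lt_trans _ _ 1%E); [exact: probability_le1|exact: ltry]. Qed.

Let eq_rectangle A B : measurable A -> measurable B -> P (A `*` B) = Q (A `*` B).
Proof.
move=> mA mB; have mAT : measurable (A `*` setT : set (R * R)) by exact: measurableX.
pose slice (N : probability (R * R)%type R) : {measure set R -> \bar R} :=
  restricted_image N (@measurable_snd _ _ R R) mAT.
have sliceE N C : slice N C = N (A `*` C).
  rewrite /slice /= /restricted_image; congr (N _).
  by apply/seteqP; split => -[x y] /=; [move=> [? []]|move=> []].
have := @finite_measure_eq_lrays R (slice P) (slice Q).
have -> : (slice P setT < +oo)%E by rewrite sliceE; exact: strip_finite.
have -> : slice P setT = slice Q setT by rewrite !sliceE; exact: PQT.
move=> /(_ isT erefl) h; rewrite -(sliceE P) -(sliceE Q); apply: h => // x.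
by rewrite !sliceE; exact: PQ.
Qed.

Lemma prob_eq_strips E : measurable E -> P E = Q E.
Proof.
move=> mE; apply: (@finite_measure_eq_gen R _ (R * R)%type
  [set A `*` B | A in measurable & B in measurable]) => //.
- exact: measurable_prod_measurableType.
- move=> _ _ [A1 mA1 [B1 mB1 <-]] [A2 mA2 [B2 mB2 <-]].
  exists (A1 `&` A2); first exact: measurableI.
  exists (B1 `&` B2); first exact: measurableI.
  by rewrite setXI.
- exact: strip_finite.
- by rewrite -setXTT; exact: eq_rectangle.
- by move=> _ [A mA [B mB <-]]; exact: eq_rectangle.
Qed.

End strips.

(** The functions h t x play the role of the conditional distribution function
    of the second coordinate given the first one.  For a fixed t they are only
    defined up to mu-null sets, so monotonicity and the limits at infinity hold
    simultaneously only along countably many t. *)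
Section conditional_cdf.
Context (R : realType) (mu : probability R R) (pi : probability (R * R)%type R).
Hypothesis marg : forall A, measurable A -> pi (A `*` setT) = mu A.
Variable h : R -> R -> R.
Hypothesis hh : forall t, cond_density mu pi `]-oo, t[ (h t).
Local Notation r := (rat_seq R).

Let mray t : measurable (`]-oo, t[%classic : set R). Proof. exact: measurable_itv. Qed.

Lemma cond_cdf_homo s t : s <= t -> {ae mu, forall x, h s x <= h t x}.
Proof.
move=> st; apply: (cond_density_le marg (mray s) (mray t)) => // x /=.
by rewrite !in_itv/= => xs; exact: lt_le_trans st.
Qed.

Lemma cond_cdf_le1 t : {ae mu, forall x, h t x <= 1}.
Proof.
have [f1 hf1] := cond_density_ex marg (@measurableT _ R).
have := cond_density_le marg (mray t) (@measurableT _ R) (@subsetT _ _) (hh t) hf1.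
by apply: filterS2 (cond_density_setT marg hf1) => x -> .
Qed.

Let cond_cdf_homo_rat : {ae mu, forall x, forall n j : nat,
   (r n <= - j%:R -> h (r n) x <= h (- j%:R) x) /\
   (j%:R <= r n -> h j%:R x <= h (r n) x)}.
Proof.
apply: ae_foralln => n; apply: ae_foralln => j; apply: filterI.
- have [rj|rj] := leP (r n) (- j%:R); last exact: aeW.
  by apply: filterS (cond_cdf_homo rj).
- have [rj|rj] := leP j%:R (r n); last exact: aeW.
  by apply: filterS (cond_cdf_homo rj).
Qed.

Let cond_cdf_Ny : {ae mu, forall x, forall e, 0 < e -> exists j : nat, h (- j%:R) x < e}.
Proof.
apply: (@cond_density_small _ mu pi (fun j => `]-oo, (- j%:R)[%classic)) => //.
- move=> n m nm; apply/subsetPset => x /=; rewrite !in_itv/= => xm.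
  by apply: lt_le_trans xm _; rewrite lerN2 ler_nat.
- apply/seteqP; split => // x hx; have := hx (Num.bound `|x|) Logic.I.
  rewrite /= in_itv/=; have := archi_boundP (normr_ge0 x).
  by have := ler_norm (- x); rewrite normrN; lra.
Qed.

Let cond_cdf_y : {ae mu, forall x, forall e, 0 < e -> exists j : nat, 1 - e < h j%:R x}.
Proof.
have mr j : measurable (`[j%:R, +oo[%classic : set R) by exact: measurable_itv.
have [k hk] := choice (fun j : nat => cond_density_ex marg (mr j)).
have ks : {ae mu, forall x, forall e, 0 < e -> exists j : nat, k j x < e}.
  apply: (@cond_density_small _ mu pi (fun j => `[j%:R, +oo[%classic)) => //.
  - move=> n m nm; apply/subsetPset => x /=; rewrite !in_itv/= !andbT => xm.
    by apply: le_trans xm; rewrite ler_nat.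
  - apply/seteqP; split => // x hx; have := hx (Num.bound `|x|) Logic.I.
    rewrite /= in_itv/= andbT; have := archi_boundP (normr_ge0 x).
    by have := ler_norm x; lra.
have hk1 : {ae mu, forall x, forall j : nat, h j%:R x + k j x = 1}.
  apply: ae_foralln => j.
  have [f1 hf1] := cond_density_ex marg (@measurableT _ R).
  have hu : cond_density mu pi (`]-oo, j%:R[ `|` `[j%:R, +oo[%classic) f1.
    by rewrite -setCitvl setUCr.
  have hd : `]-oo, j%:R[%classic `&` `[j%:R, +oo[%classic = set0 :> set R.
    by rewrite -setCitvl setICr.
  have := cond_densityU (mray j%:R) (mr j) hd (hh j%:R) (hk j) hu.
  by apply: filterS2 (cond_density_setT marg hf1) => x -> <-.
apply: filterS2 hk1 ks => x hk1 ks e e0.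
by have [j je] := ks e e0; exists j; have := hk1 j; lra.
Qed.

Let g n := h (r n).
Let T := sampling g.

Let has_inf_sampling_set :
  {ae mu, forall x u, 0 < u -> u < 1 -> has_inf (sampling_set g (x, u))}.
Proof.
apply: filterS3 cond_cdf_homo_rat cond_cdf_Ny cond_cdf_y => x hmono hlow hup u u0 u1; split.
  have [j uj] : exists j : nat, 1 - (1 - u) < h j%:R x by apply: hup; lra.
  have [n [jn _]] : exists n, j%:R < r n /\ r n < j%:R + 1.
    by apply: rat_seq_dense; rewrite ltrDl.
  exists (r n), n => //=; have := (hmono n j).2 (ltW jn); rewrite /g; lra.
have [j uj] := hlow u u0.
exists (- j%:R) => _ [n /= un <-]; rewrite leNgt; apply/negP => /ltW rj.
have := (hmono n j).1 rj; move: un; rewrite /g; lra.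
Qed.

Lemma sampling_lt : {ae mu, forall x t u, 0 < u -> u < 1 ->
  (T (x, u) < t <-> exists2 n, r n < t & u <= g n x)}.
Proof.
apply: filterS has_inf_sampling_set => x good t u u0 u1; split.
  move=> Tt; have [_ [n un <-] nt] := inf_lt (good u u0 u1).1 Tt.
  by exists n.
move=> [n nt un]; apply: le_lt_trans nt; apply: ge_inf; first by case: (good u u0 u1).
by exists n.
Qed.

Let mg n : measurable_fun setT (g n). Proof. by case: (hh (r n)). Qed.

Let mTz t : measurable [set z | T z < t].
Proof.
rewrite (_ : [set z | _] = T @^-1` `]-oo, t[%classic).
  apply: measurable_preimage; first exact: measurable_sampling.
  exact: measurable_itv.
by apply/seteqP; split => z /=; rewrite in_itv.
Qed.

Let xsectionT x t : [set u | T (x, u) < t] = xsection [set z | T z < t] x.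
Proof. by apply/seteqP; split => u; rewrite /xsection /= inE. Qed.

Let mTx x t : measurable [set u | T (x, u) < t].
Proof. by rewrite xsectionT; exact: measurable_xsection. Qed.

Lemma measurable_sampling_mass t :
  measurable_fun setT (fun x => unif R [set u | (T (x, u) < t)%R]).
Proof. by under eq_fun do rewrite xsectionT; exact: measurable_fun_xsection. Qed.

(** Both inequalities follow from sampling_lt: the mass of the u with
    T (x, u) < t is at least h s x for each rational s < t, and at most h t x;
    the first bound is enough because the rays ]-oo, s[ increase to ]-oo, t[. *)
Lemma sampling_mass A t : measurable A ->
  pi (A `*` `]-oo, t[%classic) = (\int[mu]_(x in A) unif R [set u | (T (x, u) < t)%R])%E.
Proof.
move=> mA; apply/eqP; rewrite eq_le; apply/andP; split.
- have le s : s < t -> (pi (A `*` `]-oo, s[%classic) <=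
      \int[mu]_(x in A) unif R [set u | (T (x, u) < t)%R])%E.
    move=> st; have [n [sn nt]] := rat_seq_dense st.
    apply: (@le_trans _ _ (pi (A `*` `]-oo, r n[%classic))).
      apply: le_measure; rewrite ?inE; try exact: measurableX.
      move=> -[x y] /= []; rewrite !in_itv/= => Ax ys; split => //.
      exact: lt_trans sn.
    case: (hh (r n)) => mh h0 ->//; apply: ae_ge0_le_integral => //.
    + by move=> x _; rewrite lee_fin.
    + by apply/measurable_EFinP; exact: measurable_funTS.
    + by apply: measurable_funTS; exact: measurable_sampling_mass.
    apply: filterS2 sampling_lt (cond_cdf_le1 (r n)) => x Tlt hx1 _.
    rewrite -unif_ray//; apply: unif_subset => //; first exact: measurable_rayc.
    by move=> u u0 u1 /= uh; apply/Tlt => //; exists n.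
  have mAr (s : R) : measurable (A `*` `]-oo, s[%classic : set (R * R)) by exact: measurableX.
  have cv : pi \o (fun j : nat => A `*` `]-oo, (t - j.+1%:R^-1)[%classic) @ \oo -->
      pi (A `*` `]-oo, t[%classic).
    have E : \bigcup_j (A `*` `]-oo, (t - j.+1%:R^-1)[%classic) = A `*` `]-oo, t[%classic.
      apply/seteqP; split => -[x y] /=.
        move=> [j _ [Ax]]; rewrite /= !in_itv/= => yt; split => //.
        by apply: lt_trans yt _; rewrite ltrBlDr ltrDl invr_gt0.
      rewrite in_itv/= => -[Ax yt].
      have e0 : 0 < t - y by rewrite subr_gt0.
      have [j je] := ltr_add_invr e0; rewrite add0r in je.
      by exists j => //; split => //=; rewrite in_itv/= ltrBrDl -ltrBrDr.
    rewrite -E; apply: nondecreasing_cvg_mu => //; first by rewrite E.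
    move=> n m nm; apply/subsetPset => -[x y] /= []; rewrite !in_itv/= => Ax yt.
    split => //; apply: lt_le_trans yt _; rewrite lerD2l lerN2 lef_pV2 ?posrE//.
    by rewrite ler_nat.
  apply: cvge_to_le cv _; apply: nearW => j; apply: le.
  by rewrite ltrBlDr ltrDl invr_gt0.
- have -> : pi (A `*` `]-oo, t[%classic) = (\int[mu]_(x in A) (h t x)%:E)%E.
    by case: (hh t) => _ _ ->.
  case: (hh t) => mh h0 _; apply: ae_ge0_le_integral => //.
  + by apply: measurable_funTS; exact: measurable_sampling_mass.
  + by move=> x _; rewrite lee_fin.
  + by apply/measurable_EFinP; exact: measurable_funTS.
  have hn : {ae mu, forall x, forall n, r n < t -> h (r n) x <= h t x}.
    apply: ae_foralln => n; have [rt|rt] := ltP (r n) t; last exact: aeW.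
    by apply: filterS (cond_cdf_homo (ltW rt)).
  apply: filterS2 sampling_lt hn => x Tlt hn _.
  apply: le_trans (unif_ray_le (h0 x)); apply: unif_subset => //.
    exact: measurable_rayc.
  by move=> u u0 u1 /= /(Tlt _ _ u0 u1)[n rt un]; apply: le_trans un (hn _ rt).
Qed.

End conditional_cdf.

(** The pair (x, y) of law pi can be simulated by drawing x from mu and an
    independent uniform u, and by putting y = T (x, u), the conditional quantile. *)
Lemma conditional_sampling (R : realType) (mu : probability R R)
    (pi : probability (R * R)%type R) :
  (forall A, measurable A -> pi (A `*` setT) = mu A) ->
  exists2 T : R * R -> R, measurable_fun setT T &
  forall E, measurable E -> pi E = product_prob mu (unif R) [set z | E (z.1, T z)].
Proof.
move=> marg; have mray t : measurable (`]-oo, t[%classic : set R) by exact: measurable_itv.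
have [h hh] := choice (fun t => cond_density_ex marg (mray t)).
pose T := sampling (fun n => h (rat_seq R n)).
have mT : measurable_fun setT T.
  by apply: measurable_sampling => n; case: (hh (rat_seq R n)).
pose f z := (z.1, T z).
have mf : measurable_fun setT f by exact: measurable_fun_pair.
pose Q : probability (R * R)%type R := law (product_prob mu (unif R)) mf.
exists T => // E mE; transitivity (Q E) => //.
apply: prob_eq_strips => // [A mA|A t mA].
- transitivity (product_prob mu (unif R) (A `*` setT)).
    rewrite marg// [RHS]product_measure1E// -[LHS]mule1; congr (_ * _)%E.
    by apply/esym; exact: probability_setT.
  have fA : f @^-1` (A `*` setT) = A `*` setT by apply/seteqP; split => -[x y] /= [].
  by rewrite -{1}fA.
rewrite (sampling_mass marg hh t mA) [LHS]integral_mkcond.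
transitivity (\int[mu]_x unif R (xsection (f @^-1` (A `*` `]-oo, t[%classic)) x))%E => //.
apply: eq_integral => x _; rewrite patchE; case: ifPn => xA.
  congr (unif R _); apply/seteqP; split => u; rewrite /xsection /= inE /= in_itv/=.
    by move=> ?; split => //; rewrite inE in xA.
  by case.
rewrite (_ : xsection _ _ = set0) ?measure0//.
apply/seteqP; split => u //; rewrite /xsection /= inE /= => -[xA' _].
by rewrite notin_setE in xA.
Qed.

(** * Kernels and mixtures *)

Section kernel_tools.
Context (R : realType).
Implicit Types (mu nu : probability R R) (p : R.-pker R ~> R).

(** The kernel p with a dummy parameter, as required by the composition of kernels. *)
Definition snd_kernel p (z : unit * R) : {measure set R -> \bar R} := p z.2.

Section snd_kernel_instance.
Variable p : R.-pker R ~> R.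

Let measurable_snd_kernel U : measurable U -> measurable_fun setT (snd_kernel p ^~ U).
Proof.
by move=> mU; exact: (measurableT_comp (measurable_kernel p U mU) measurable_snd).
Qed.

HB.instance Definition _ := isKernel.Build _ _ _ _ R (snd_kernel p) measurable_snd_kernel.

Let snd_kernel_prob z : snd_kernel p z setT = 1%E.
Proof. exact: prob_kernel. Qed.

HB.instance Definition _ :=
  Kernel_isProbability.Build _ _ _ _ R (snd_kernel p) snd_kernel_prob.
End snd_kernel_instance.

Definition cst_kernel mu (x : unit) : {measure set R -> \bar R} := mu.

Section cst_kernel_instance.
Variable mu : probability R R.

Let measurable_cst_kernel U : measurable U -> measurable_fun setT (cst_kernel mu ^~ U).
Proof. by move=> mU; exact: measurable_cst. Qed.

HB.instance Definition _ := isKernel.Build _ _ _ _ R (cst_kernel mu) measurable_cst_kernel.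

Let cst_kernel_prob z : cst_kernel mu z setT = 1%E.
Proof. exact: probability_setT. Qed.

HB.instance Definition _ :=
  Kernel_isProbability.Build _ _ _ _ R (cst_kernel mu) cst_kernel_prob.
End cst_kernel_instance.

(** The mixture nu is the composition of p with the constant kernel mu. *)
Lemma ge0_integral_mixture mu nu p (f : R -> \bar R) :
  (forall B, measurable B -> nu B = (\int[mu]_x p x B)%E) ->
  measurable_fun setT f -> (forall y, 0 <= f y)%E ->
  (\int[nu]_y f y = \int[mu]_x \int[p x]_y f y)%E.
Proof.
move=> nuE mf f0.
pose l : R.-sfker unit ~> R := cst_kernel mu.
pose k : R.-sfker (unit * R) ~> R := snd_kernel p.
transitivity (\int[kcomp l k tt]_y f y)%E.
  by apply: eq_measure_integral => A mA _; exact: nuE.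
by rewrite integral_kcomp.
Qed.

Lemma coupling_mixture mu nu pi p : coupling mu nu pi -> disintegration mu pi p ->
  forall B, measurable B -> nu B = (\int[mu]_x p x B)%E.
Proof. by move=> [_ h] dis B mB; rewrite -h// dis. Qed.

Lemma measurable_kernel_mean p :
  measurable_fun setT (fun x => (\int[p x]_y y)%R).
Proof.
apply: (measurableT_comp (fine_measurable measurableT)).
rewrite (_ : (fun x => _) = (fun x => \int[p x]_y (EFin \o id)^\+ y -
                                      \int[p x]_y (EFin \o id)^\- y)%E); last first.
  by apply/funext => x; exact: integralE.
have mid : measurable_fun setT (EFin \o (id : R -> R)) by exact/measurable_EFinP.
apply: emeasurable_funB; apply: measurable_fun_integral_kernel => //.
- exact: measurable_kernel.
- exact: measurable_funepos.
- exact: measurable_kernel.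
- exact: measurable_funeneg.
Qed.

Section prob_of_kernel.
Variables (p : R.-pker R ~> R) (x : R).

(** The measure p x with the probability structure that jensen expects. *)
Definition prob_of_kernel : set R -> \bar R := p x.

HB.instance Definition _ := isMeasure.Build _ _ _ prob_of_kernel
  (measure0 (p x)) (measure_ge0 (p x)) (@measure_semi_sigma_additive _ _ _ (p x)).
HB.instance Definition _ :=
  Measure_isProbability.Build _ _ _ prob_of_kernel (prob_kernel x).
End prob_of_kernel.

(** By the mixture formula, |y| has a p x-integral that is mu-integrable in x,
    hence finite for almost every x. *)
Lemma kernel_mean_ae mu nu p :
  (forall B, measurable B -> nu B = (\int[mu]_x p x B)%E) ->
  finite_first_moment nu ->
  {ae mu, forall x, (p x).-integrable setT (EFin \o (id : R -> R))}.
Proof.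
move=> nuE nu1.
have mabs : measurable_fun setT (fun y : R => `|y|%:E).
  by apply/measurable_EFinP; exact: normr_measurable.
have mI : measurable_fun setT (fun x => \int[p x]_y `|y|%:E)%E.
  by apply: measurable_fun_integral_kernel => //; exact: measurable_kernel.
have : mu.-integrable setT (fun x => \int[p x]_y `|y|%:E)%E.
  apply: ge0_integrable => //.
    by move=> x; apply: integral_ge0 => y _; rewrite lee_fin.
  by rewrite -(ge0_integral_mixture nuE).
move=> /(integrable_ae measurableT); apply: filterS => x h.
apply/integrableP; split; first exact/measurable_EFinP.
have := h Logic.I; rewrite fin_numElt => /andP[_].
by under [in X in (_ -> X < _)%E]eq_integral do rewrite /=.
Qed.

Lemma kernel_jensen p x (g : R -> R) : convexR g -> (forall y, 0 <= g y) ->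
  measurable_fun setT g -> (p x).-integrable setT (EFin \o (id : R -> R)) ->
  ((g (\int[p x]_y y)%R)%:E <= \int[p x]_y (g y)%:E)%E.
Proof. by move=> cg g0 mg ix; exact: (@jensen _ (prob_of_kernel p x) g). Qed.

End kernel_tools.

(** * From transport-entropy to weak transport-entropy *)

Section sampling_kernel.
Context (R : realType) (T : R * R -> R).

Definition sampling_kernel (mT : measurable_fun setT T) (x : R) :
  {measure set R -> \bar R} := law (unif R) (measurable_fun_pair2 x mT).

Hypothesis mT : measurable_fun setT T.

Let measurable_sampling_kernel U : measurable U ->
  measurable_fun setT (sampling_kernel mT ^~ U).
Proof.
move=> mU; rewrite (_ : (fun x => _) = (fun x => unif R (xsection (T @^-1` U) x))).
  by apply: measurable_fun_xsection; exact: measurable_preimage.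
apply/funext => x; congr (unif R _).
by apply/seteqP; split => u; rewrite /xsection/= inE.
Qed.

HB.instance Definition _ := isKernel.Build _ _ _ _ R (sampling_kernel mT)
  measurable_sampling_kernel.

Let sampling_kernel_prob x : sampling_kernel mT x setT = 1%E.
Proof. exact: probability_setT. Qed.

HB.instance Definition _ := Kernel_isProbability.Build _ _ _ _ R
  (sampling_kernel mT) sampling_kernel_prob.

Lemma sampling_disintegration (mu : probability R R) (pi : probability (R * R)%type R) :
  (forall E, measurable E -> pi E = product_prob mu (unif R) [set z | E (z.1, T z)]) ->
  disintegration mu pi (sampling_kernel mT).
Proof.
move=> piE A B mA mB; rewrite piE; last exact: measurableX.
rewrite [RHS]integral_mkcond; apply: eq_integral => x _; rewrite patchE.
case: ifPn => xA.
  congr (unif R _); apply/seteqP; split => u; rewrite /xsection /= inE /=.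
    by case.
  by move=> ?; split => //; rewrite inE in xA.
rewrite /= (_ : xsection _ _ = set0) ?measure0//.
apply/seteqP; split => u //; rewrite /xsection /= inE /= => -[xA' _].
by rewrite notin_setE in xA.
Qed.

Lemma measurable_sampling_integral (F : R * R -> \bar R) :
  measurable_fun setT F -> (forall z, 0 <= F z)%E ->
  measurable_fun setT (fun x => \int[sampling_kernel mT x]_y F (x, y))%E.
Proof.
move=> mF F0.
have mf : measurable_fun setT (fun z : R * R => (z.1, T z)) by exact: measurable_fun_pair.
rewrite (_ : (fun x => _) = fubini_F (unif R) (fun z => F (z.1, T z))).
  by apply: measurable_fun_fubini_tonelli_F => //; exact: (measurableT_comp mF mf).
apply/funext => x; rewrite /fubini_F [LHS]ge0_integral_law//.
exact: measurable_fun_pair2.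
Qed.

Lemma sampling_integral (mu : probability R R) (pi : probability (R * R)%type R)
    (F : R * R -> \bar R) :
  (forall E, measurable E -> pi E = product_prob mu (unif R) [set z | E (z.1, T z)]) ->
  measurable_fun setT F -> (forall z, 0 <= F z)%E ->
  (\int[pi]_z F z = \int[mu]_x \int[sampling_kernel mT x]_y F (x, y))%E.
Proof.
move=> piE mF F0.
have mf : measurable_fun setT (fun z : R * R => (z.1, T z)) by exact: measurable_fun_pair.
transitivity (\int[law (product_prob mu (unif R)) mf]_z F z)%E.
  by apply: eq_measure_integral => E mE _; exact: piE.
rewrite ge0_integral_law//.
transitivity (\int[mu]_x \int[unif R]_u F (x, T (x, u)))%E.
  by apply: fubini_tonelli1 => //; exact: (measurableT_comp mF mf).
apply: eq_integral => x _; rewrite [RHS]ge0_integral_law//.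
exact: measurable_fun_pair2.
Qed.

End sampling_kernel.

Section transport_weak_transport.
Context (R : realType) (beta : R -> R).
Hypotheses (hbeta : cost_function beta) (hconv : convex_cost beta).

Lemma convexR_dist x : convexR (fun y : R => `|x - y|).
Proof.
move=> y z t t0 t1.
have -> : x - (t * y + (1 - t) * z) = t * (x - y) + (1 - t) * (x - z) by ring.
apply: le_trans (ler_normD _ _) _; rewrite !normrM (ger0_norm t0).
by rewrite (ger0_norm (_ : 0 <= 1 - t)) ?subr_ge0.
Qed.

(** Jensen's inequality for y |-> theta |x - y| in each fibre of a disintegration
    of pi. *)
Lemma weak_transport_le_transport a (mu nu : probability R R)
    (pi : probability (R * R)%type R) : 0 < a -> finite_first_moment nu ->
  coupling mu nu pi ->
  (weak_transport_cost (dilate a beta) nu mu <=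
   \int[pi]_z (dilate a beta `|z.1 - z.2|)%:E)%E.
Proof.
move=> a0 nu1 cpl; have [marg _] := cpl.
have [T mT piE] := conditional_sampling marg.
have dis := sampling_disintegration mT piE.
pose p : R.-pker R ~> R := sampling_kernel mT.
have mF : measurable_fun setT (fun z : R * R => (dilate a beta `|z.1 - z.2|)%:E).
  apply/measurable_EFinP; apply: measurable_cost_comp => //.
  apply: measurableT_comp; first exact: normr_measurable.
  exact: measurable_funB.
have F0 (z : R) : (0 <= (dilate a beta `|z|)%:E)%E.
  by rewrite lee_fin; apply: (cost_ge0 hbeta); rewrite mulr_ge0// ltW.
rewrite (sampling_integral mT piE)//.
apply: (@le_trans _ _ (\int[mu]_x (dilate a beta `|x - (\int[p x]_y y)%R|)%:E)%E).
  by apply: ereal_inf_lbound; exists pi, p; split.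
apply: ae_ge0_le_integral => //.
- apply/measurable_EFinP; apply: measurable_cost_comp => //.
  apply: measurableT_comp; first exact: normr_measurable.
  by apply: measurable_funB => //; exact: measurable_kernel_mean.
- by move=> x _; apply: integral_ge0.
- exact: (measurable_sampling_integral mT mF).
have := kernel_mean_ae (coupling_mixture cpl dis) nu1.
apply: filterS => x ix _; apply: (kernel_jensen (g := fun y => dilate a beta `|x - y|)) => //.
- exact: (convexR_cost_comp hbeta hconv a0 (convexR_dist x)).
- by move=> y; rewrite -lee_fin.
- apply: measurable_cost_comp => //.
  apply: measurableT_comp; first exact: normr_measurable.
  exact: measurable_funB.
Qed.

End transport_weak_transport.

Section transport_entropy_weak.
Context (R : realType) (beta : R -> R).
Hypotheses (hbeta : cost_function beta) (hconv : convex_cost beta).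

Lemma coupling_swap (mu nu : probability R R) (pi : probability (R * R)%type R) :
  coupling mu nu pi -> exists2 pi', coupling nu mu pi' &
  forall theta : R -> R,
    measurable_fun setT (fun z : R * R => (theta `|z.1 - z.2|)%:E) ->
    (forall x : R, (0 <= (theta `|x|)%:E)%E) ->
    (\int[pi']_z (theta `|z.1 - z.2|)%:E = \int[pi]_z (theta `|z.1 - z.2|)%:E)%E.
Proof.
move=> [pi1 pi2].
have msw : measurable_fun setT (fun z : R * R => (z.2, z.1)) by exact: measurable_fun_pair.
exists (law pi msw).
  split => A mA.
  - rewrite -pi2//; apply: (@etrans _ _ (pi (setT `*` A))) => //.
    by congr (pi _); apply/seteqP; split => -[x y] /= [].
  - rewrite -pi1//; apply: (@etrans _ _ (pi (A `*` setT))) => //.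
    by congr (pi _); apply/seteqP; split => -[x y] /= [].
move=> theta mF F0; rewrite ge0_integral_law//.
by apply: eq_integral => z _ /=; rewrite distrC.
Qed.

(** As |x - y| is symmetric, one coupling serves both weak costs after exchanging
    its coordinates. *)
Lemma weak_transport_entropy_of_transport_entropy (mu : probability R R) a :
  finite_first_moment mu -> 0 < a ->
  transport_entropy mu (dilate a beta) -> weak_transport_entropy mu (dilate a beta).
Proof.
move=> mu1 a0 te nu nu1.
have mF : measurable_fun setT (fun z : R * R => (dilate a beta `|z.1 - z.2|)%:E).
  apply/measurable_EFinP; apply: measurable_cost_comp => //.
  apply: measurableT_comp; first exact: normr_measurable.
  exact: measurable_funB.
have F0 (z : R) : (0 <= (dilate a beta `|z|)%:E)%E.
  by rewrite lee_fin; apply: (cost_ge0 hbeta); rewrite mulr_ge0// ltW.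
split; apply: le_trans (te nu); apply: le_ereal_inf_tmp => _ [pi cpl <-].
- exact: weak_transport_le_transport.
- have [pi' cpl' <-//] := coupling_swap cpl.
  exact: weak_transport_le_transport.
Qed.

End transport_entropy_weak.

(** * Clipped logarithmic ratios and Tonelli on the unit square *)

Section clipped_log_ratio.
Context (R : realType).
Local Notation e := (expR (1 : R)).
Local Notation eV := (expR (- 1 : R)).

(** For positive a and b this is log (a / b) - 1 clipped to [0, n] (clog_minE).  The
    definition by cases has a meaningful value when a or b is 0, and is bounded. *)
Definition clog (n : nat) (a b : R) : R :=
  if a <= b * e then 0
  else if b * expR (n%:R + 1) <= a then n%:R else ln a - ln b - 1.

Let e0 : 0 < e. Proof. exact: expR_gt0. Qed.
Let en0 (x : R) : 0 < expR x. Proof. exact: expR_gt0. Qed.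

Lemma clog_minE n a b : 0 < a -> 0 < b ->
  clog n a b = Num.min (Num.max 0 (ln a - ln b - 1)) n%:R.
Proof.
move=> a0 b0; have n0 : 0 <= n%:R :> R by [].
have lnbe x : ln (b * expR x) = ln b + x by rewrite lnM ?posrE// expRK.
rewrite /clog; case: (leP a (b * e)) => [ab|ab].
  have : ln a <= ln b + 1 by rewrite -lnbe ler_ln ?posrE// mulr_gt0.
  move=> h; rewrite (max_l (_ : _ <= 0)); last by lra.
  by rewrite min_l.
have h : ln b + 1 < ln a by rewrite -lnbe ltr_ln ?posrE// mulr_gt0.
rewrite max_r; last by lra.
case: (leP (b * expR (n%:R + 1)) a) => [ba|ba].
  have : ln b + (n%:R + 1) <= ln a by rewrite -lnbe ler_ln ?posrE// mulr_gt0.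
  by move=> h'; rewrite min_r//; lra.
have : ln a < ln b + (n%:R + 1) by rewrite -lnbe ltr_ln ?posrE// mulr_gt0.
by move=> h'; rewrite min_l//; lra.
Qed.

Lemma clog0r n a : 0 < a -> clog n a 0 = n%:R.
Proof. by move=> a0; rewrite /clog !mul0r leNgt a0/= ltW. Qed.

Lemma clog0l n b : 0 <= b -> clog n 0 b = 0.
Proof. by move=> b0; rewrite /clog mulr_ge0// ltW. Qed.

Lemma clog_itv n a b : 0 <= a -> 0 <= b -> 0 <= clog n a b <= n%:R.
Proof.
move=> a0 b0; have n0 : 0 <= n%:R :> R by [].
have [->|an] := eqVneq a 0; first by rewrite clog0l// lexx.
have {an}a0 : 0 < a by rewrite lt_neqAle eq_sym an.
have [->|bn] := eqVneq b 0; first by rewrite clog0r// n0 lexx.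
have {bn}b0 : 0 < b by rewrite lt_neqAle eq_sym bn.
by rewrite clog_minE// le_min le_max lexx n0/= ge_min lexx orbT.
Qed.

(** The right-hand side is the length of the interval of the y with
    b * e < y < a and y < b * e^(n + 1): exponentials of clog become masses of
    planar regions, to which Tonelli's theorem applies. *)
Lemma expR_clog n a b : 0 <= a -> 0 < b ->
  (expR (clog n a b) - 1) * (b * e) =
  Num.max 0 (Num.min a (b * expR (n%:R + 1)) - b * e).
Proof.
move=> a0 b0; have n0 : 0 <= n%:R :> R by [].
rewrite /clog; case: leP => [ab|ab].
  by rewrite expR0 subrr mul0r max_l// subr_le0 ge_min ab.
have {}a0 : 0 < a by apply: lt_trans ab; rewrite mulr_gt0.
have bb : b * e <= b * expR (n%:R + 1) by rewrite ler_pM2l// ler_expR; lra.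
case: leP => [ba|ba].
  rewrite max_r ?subr_ge0//.
  by rewrite expRD; ring.
rewrite max_r; last by rewrite subr_ge0 ltW.
rewrite !expRD !expRN !lnK ?posrE//; field.
by rewrite !gt_eqF.
Qed.

(** The analogue of expR_clog for the negative exponential, with the interval
    of the y < a that exceed b * e and a * e^(- n). *)
Lemma expRN_clog n a b : 0 < a -> 0 <= b ->
  (1 - expR (- clog n a b)) * a =
  Num.max 0 (a - Num.max (b * e) (a * expR (- n%:R))).
Proof.
move=> a0 b0; have n0 : 0 <= n%:R :> R by [].
rewrite /clog; case: leP => [ab|ab].
  by rewrite oppr0 expR0 subrr mul0r max_l// subr_le0 le_max ab.
have nn : a * expR (- n%:R) <= a.
  apply: ler_piMr; first exact: ltW.
  by rewrite -[leRHS]expR0 ler_expR; lra.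
case: leP => [ba|ba].
  have h : b * e <= a * expR (- n%:R).
    by rewrite expRN ler_pdivlMr// -mulrA -expRD addrC.
  rewrite (max_r h) max_r ?subr_ge0//; ring.
have {}b0 : 0 < b.
  by rewrite lt_neqAle b0 andbT; apply: contraTN ba => /eqP <-; rewrite mul0r -leNgt ltW.
have h : a * expR (- n%:R) <= b * e.
  by rewrite expRN ler_pdivrMr// -mulrA -expRD addrC ltW.
rewrite (max_l h) max_r ?subr_ge0 ?ltW//.
rewrite !opprD !opprK !expRD !expRN !lnK ?posrE//; field.
by rewrite gt_eqF.
Qed.

End clipped_log_ratio.

Section unit_interval_integrals.
Context (R : realType).

Lemma integral_invR_itv (p q : R) : 0 < p -> p < q ->
  (\int[lebesgue_measure]_(z in `[p, q]) (z^-1)%:E = (ln q - ln p)%:E)%E.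
Proof.
move=> p0 pq.
rewrite (@continuous_FTC2 _ (fun z : R => z^-1) (@ln R) p q)//.
- apply: continuous_in_subspaceT => z; rewrite inE/= in_itv/= => /andP[pz _].
  by apply: inv_continuous; rewrite gt_eqF//; apply: lt_le_trans pz.
- split.
  + move=> z; rewrite in_itv/= => /andP[pz _].
    by apply: ex_derive; apply: is_derive1_ln; apply: lt_trans pz.
  + by apply: cvg_at_right_filter; apply: continuous_ln.
  + by apply: cvg_at_left_filter; apply: continuous_ln; apply: lt_trans pq.
- move=> z; rewrite in_itv/= => /andP[pz _]; rewrite derive1E.
  by apply: derive_val; apply: is_derive1_ln; apply: lt_trans pz.
Qed.

End unit_interval_integrals.

Lemma unif_itv (R : realType) (b : bool) (p q : R) : 0 <= p -> q <= 1 ->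
  unif R [set` Interval (BSide b p) (BLeft q)] = (Num.max 0 (q - p))%:E.
Proof.
move=> p0 q1; rewrite unifE//; case: (ltP p q) => pq; last first.
  rewrite max_l ?subr_le0// (_ : _ `&` _ = set0) ?measure0//.
  apply/seteqP; split => v //=; rewrite !in_itv/= => -[+ _].
  by case: b => /= /andP[pv vq]; lra.
rewrite max_r ?subr_ge0 ?ltW//.
have [p1|p1] := ltP 0 p.
  rewrite (_ : _ `&` _ = [set` Interval (BSide b p) (BLeft q)]); last first.
    apply/seteqP; split => v /=; rewrite !in_itv/=; first by case.
    by case: b => /= /andP[pv vq]; rewrite pv vq; split => //; apply/andP; split; lra.
  by rewrite lebesgue_measure_itv/= lte_fin pq EFinB.
have -> : p = 0 by lra.
rewrite (_ : _ `&` _ = `]0, q[%classic); last first.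
  apply/seteqP; split => v /=; rewrite !in_itv/=.
    by case: b => /= -[/andP[_ vq] /andP[v0 _]]; rewrite v0 vq.
  by case: b => /= /andP[v0 vq]; rewrite v0 vq ?(ltW v0); split => //=; lra.
have q0 : 0 < q by lra.
by rewrite lebesgue_measure_itv/= lte_fin q0 EFinB.
Qed.

(** The inverse on ]0, +oo[, in a form whose measurability is immediate. *)
Definition recip (R : realType) (z : R) := expR (- ln z).

Lemma recipE (R : realType) (z : R) : 0 < z -> recip z = z^-1.
Proof. by move=> z0; rewrite /recip expRN lnK ?posrE. Qed.

Lemma measurable_recip (R : realType) : measurable_fun setT (@recip R).
Proof. by apply: measurable_expR_comp; apply: measurableT_comp => //; exact: measurable_ln. Qed.

Lemma unif_recip_itv (R : realType) (b : bool) (p q : R) : 0 < p -> 0 < q -> q <= 1 ->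
  (\int[unif R]_z (recip z * \1_[set` Interval (BSide b p) (BLeft q)] z)%:E =
   (Num.max 0 (ln q - ln p))%:E)%E.
Proof.
move=> p0 q0 q1; set A := [set` _].
have mA : measurable A by exact: measurable_itv.
rewrite ge0_integral_unif; last 2 first.
- apply/measurable_EFinP; apply: measurable_funM; first exact: measurable_recip.
  exact: measurable_indic.
- by move=> z; rewrite lee_fin mulr_ge0// expR_ge0.
transitivity (\int[lebesgue_measure]_(z in `]0%R, 1%R[ `&` A) (recip z)%:E)%E.
  rewrite integral_mkcondr; apply: eq_integral => z _.
  by rewrite patchE indicE; case: ifP => _; rewrite ?mulr1 ?mulr0.
case: (ltP p q) => pq; last first.
  rewrite (_ : _ `&` _ = set0) ?integral_set0; last first.
    apply/seteqP; split => v // -[_ Av].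
    move: Av; rewrite /A /= in_itv/= => /andP[pv vq].
    by have := lt_le_trans vq (le_trans pq (lteifW pv)); rewrite ltxx.
  by rewrite max_l// subr_le0 ler_ln ?posrE.
rewrite max_r; last by rewrite subr_ge0 ler_ln ?posrE// ltW// (lt_trans p0).
rewrite -integral_invR_itv// (_ : _ `&` _ = A); last first.
  apply/seteqP; split => v /=; first by case.
  move=> Av; split => //; move: Av; rewrite /A /= !in_itv/= => /andP[pv vq].
  rewrite (lt_le_trans vq q1) andbT; apply: (lt_le_trans p0).
  exact: lteifW pv.
have mr D : measurable_fun D (fun z : R => (recip z)%:E).
  by apply: measurable_funTS; apply/measurable_EFinP; exact: measurable_recip.
transitivity (\int[lebesgue_measure]_(z in `[p, q]) (recip z)%:E)%E; last first.
  apply: eq_integral => z; rewrite inE/= in_itv/= => /andP[pz _].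
  by rewrite recipE//; apply: lt_le_trans pz.
by rewrite /A integral_itv_bndoo// [RHS]integral_itv_bndoo.
Qed.

(** Tonelli's theorem on the unit square, for the weight w z on the region E. *)
Lemma unif_swap (R : realType) (w : R -> R) (E : set (R * R)) :
  measurable_fun setT w -> (forall z, 0 <= w z) -> measurable E ->
  (\int[unif R]_z ((w z)%:E * unif R [set v | E (z, v)]) =
   \int[unif R]_v \int[unif R]_z (w z * \1_[set z | E (z, v)] z)%:E)%E.
Proof.
move=> mw w0 mE.
pose f (z : R * R) := (w z.1 * \1_E z)%:E.
have mf : measurable_fun setT f.
  apply/measurable_EFinP; apply: measurable_funM; first exact: (measurableT_comp mw).
  exact: measurable_indic.
have f0 z : (0 <= f z)%E by rewrite lee_fin mulr_ge0.
transitivity (\int[unif R]_z \int[unif R]_v f (z, v))%E; last first.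
  rewrite [LHS](fubini_tonelli f mf f0); apply: eq_integral => v _.
  by apply: eq_integral => z _.
apply: eq_integral => z _.
have mEz : measurable [set v | E (z, v)].
  rewrite (_ : [set v | _] = xsection E z); first exact: measurable_xsection.
  by apply/seteqP; split => v; rewrite /xsection/= inE.
transitivity (\int[unif R]_v ((w z)%:E * (\1_[set v | E (z, v)] v)%:E))%E => //.
rewrite ge0_integralZl//; last 2 first.
- by apply/measurable_EFinP; exact: measurable_indic.
- by rewrite lee_fin.
by rewrite integral_indic// setIT.
Qed.

Lemma measurable_unif_swap (R : realType) (w : R -> R) (E : set (R * R)) :
  measurable_fun setT w -> (forall z, 0 <= w z) -> measurable E ->
  measurable_fun setT
    (fun v => \int[unif R]_z (w z * \1_[set z | E (z, v)] z)%:E)%E.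
Proof.
move=> mw w0 mE.
rewrite (_ : (fun v => _) = fubini_G (unif R) (fun z : R * R => (w z.1 * \1_E z)%:E)).
  apply: measurable_fun_fubini_tonelli_G.
    apply/measurable_EFinP; apply: measurable_funM; first exact: (measurableT_comp mw).
    exact: measurable_indic.
  by move=> z; rewrite lee_fin mulr_ge0.
by apply/funext => v; apply: eq_integral.
Qed.

Lemma measurable_lt_set d (T : measurableType d) (R : realType) (f g : T -> R) :
  measurable_fun setT f -> measurable_fun setT g -> measurable [set x | f x < g x].
Proof.
move=> mf mg; rewrite (_ : [set x | _] = ~` [set x | g x <= f x]).
  by apply: measurableC; rewrite -[X in measurable X]setTI; exact: measurable_fun_le.
by apply/seteqP; split => x /=; rewrite ltNge => /negP.
Qed.

Lemma measurable_unif_section (R : realType) (E : set (R * R)) : measurable E ->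
  measurable_fun setT (fun z => unif R [set v | E (z, v)]).
Proof.
move=> mE; rewrite (_ : (fun z => _) = (fun z => unif R (xsection E z))).
  exact: measurable_fun_xsection.
apply/funext => z; congr (unif R _).
by apply/seteqP; split => v; rewrite /xsection/= inE.
Qed.

Lemma measurable_vsection (R : realType) (E : set (R * R)) v : measurable E ->
  measurable [set z | E (z, v)].
Proof.
move=> mE; rewrite (_ : [set z | _] = ysection E v); first exact: measurable_ysection.
by apply/seteqP; split => z; rewrite /ysection/= inE.
Qed.

(** * Entropy bounds for monotone rearrangements of the uniform law *)

Lemma ae_unif_ge0_eq (R : realType) (f g : R -> \bar R) :
  measurable_fun setT f -> measurable_fun setT g ->
  (forall v, 0 <= f v)%E -> (forall v, 0 <= g v)%E ->
  (forall v : R, 0 < v -> v < 1 -> f v = g v)%R ->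
  (\int[unif R]_v f v = \int[unif R]_v g v)%E.
Proof.
move=> mf mg f0 g0 fg; apply: ge0_ae_eq_integral => //.
by apply: filterS (ae_unif R) => v [v0 v1] _; exact: fg.
Qed.

Lemma ae_unif_ge0_le (R : realType) (f g : R -> \bar R) :
  measurable_fun setT f -> measurable_fun setT g ->
  (forall v, 0 <= f v)%E -> (forall v, 0 <= g v)%E ->
  (forall v : R, 0 < v -> v < 1 -> (f v <= g v)%E)%R ->
  (\int[unif R]_v f v <= \int[unif R]_v g v)%E.
Proof.
move=> mf mg f0 g0 fg; apply: ae_ge0_le_integral => //.
by apply: filterS (ae_unif R) => v [v0 v1] _; exact: fg.
Qed.

(** S is the monotone rearrangement of the uniform law into rho, and K is the
    distribution function of rho.  The last two fields are exchanged by the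
    reflection v |-> 1 - v, which makes the notion symmetric. *)
Record rearrangement (R : realType) (rho : probability R R) (S K : R -> R) : Prop :=
  Rearrangement {
  rearr_dom : rho `<< unif R ;
  rearr_measurable : measurable_fun setT S ;
  rearr_law : forall A, measurable A -> rho A = unif R (S @^-1` A) ;
  rearr_itv : forall v, 0 < v -> v < 1 -> 0 < S v /\ S v < 1 ;
  rearr_cdf_measurable : measurable_fun setT K ;
  rearr_cdf_itv : forall z, 0 <= K z /\ K z <= 1 ;
  rearr_cdfK : forall v, 0 < v -> v < 1 -> K (S v) = v ;
  rearr_le : forall v z, 0 < v -> v < 1 -> 0 < z -> z < 1 -> v < K z -> S v <= z ;
  rearr_ge : forall v z, 0 < v -> v < 1 -> 0 < z -> z < 1 -> K z < v -> z <= S v }.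

Section rearrangement_cost.
Context (R : realType) (rho : probability R R) (S K : R -> R).
Hypothesis hr : rearrangement rho S K.
Local Notation e := (expR (1 : R)).
Local Notation H := (rel_entropy rho (unif R)).

Let mS := rearr_measurable hr.
Let mK := rearr_cdf_measurable hr.

Lemma measurable_clog d (T : measurableType d) n (f g : T -> R) :
  measurable_fun setT f -> measurable_fun setT g ->
  measurable_fun setT (fun x => clog n (f x) (g x)).
Proof.
move=> mf mg; apply: measurable_fun_ifT => //.
  by apply: measurable_fun_ler => //; exact: measurable_funM.
apply: measurable_fun_ifT => //.
  by apply: measurable_fun_ler => //; exact: measurable_funM.
apply: measurable_funB => //; apply: measurable_funB.
- by apply: measurableT_comp => //; exact: measurable_ln.
- by apply: measurableT_comp => //; exact: measurable_ln.
Qed.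

Lemma rearr_integral (f : R -> \bar R) : measurable_fun setT f ->
  (forall z, 0 <= f z)%E ->
  (\int[rho]_z f z = \int[unif R]_v f (S v))%E.
Proof.
move=> mf f0; rewrite -(ge0_integral_law (unif R) mS)//.
by apply: eq_measure_integral => A mA _; exact: (rearr_law hr).
Qed.

(** Let x be the left-hand side, that is, the rho-mean of phi z = clog n (K z) z.
    The variational formula gives x + 1 <= H + \int e^phi.  By expR_clog,
    \int (e^phi - 1) is the integral of 1 / (e z) over the region E where
    e z < v < K z and v < z e^(n + 1).  In this region S v <= z, so integrating in
    z first gives at most clog n v (S v) / e.  Hence (1 - 1 / e) x <= H, and
    1 / e <= 1 / 2. *)
Lemma rearr_excess n :
  (\int[unif R]_v (clog n `|v| `|S v|)%:E <= 2%:E * H)%E.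
Proof.
have [k hk] := has_density_ex (rearr_dom hr).
pose phi z := clog n `|K z| `|z|.
have phi0 z : 0 <= phi z /\ phi z <= n%:R.
  by apply/andP; apply: clog_itv.
have mphi : measurable_fun setT phi.
  by apply: measurable_clog; [apply: measurableT_comp => //|]; exact: normr_measurable.
have phin z : `|phi z| <= n%:R by rewrite ger0_norm; case: (phi0 z).
set x := (X in (X <= _)%E).
have mx : measurable_fun setT (fun v : R => clog n `|v| `|S v|).
  by apply: measurable_clog; [|apply: measurableT_comp => //]; exact: normr_measurable.
have xE : (\int[rho]_z (phi z)%:E = x)%E.
  rewrite rearr_integral; last 2 first.
  - exact/measurable_EFinP.
  - by move=> z; rewrite lee_fin; case: (phi0 z).
  apply: ae_unif_ge0_eq.
  - by apply/measurable_EFinP; exact: (measurableT_comp mphi).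
  - exact/measurable_EFinP.
  - by move=> v; rewrite lee_fin; case: (phi0 (S v)).
  - by move=> v; rewrite lee_fin; case/andP: (@clog_itv _ n _ _ (normr_ge0 v) (normr_ge0 (S v))).
  - by move=> v v0 v1; rewrite /phi (rearr_cdfK hr).
have x0 : (0 <= x)%E.
  by apply: integral_ge0 => v _; rewrite lee_fin; case/andP: (@clog_itv _ n _ _ (normr_ge0 v) (normr_ge0 (S v))).
have xn : (x <= n%:R%:E)%E.
  rewrite -(prob_cst (unif R) n%:R%:E); apply: ge0_le_integral => //.
  - by move=> v _; rewrite lee_fin; case/andP: (@clog_itv _ n _ _ (normr_ge0 v) (normr_ge0 (S v))).
  - exact/measurable_EFinP.
  - by move=> v _; rewrite lee_fin; case/andP: (@clog_itv _ n _ _ (normr_ge0 v) (normr_ge0 (S v))).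
have xfin : x \is a fin_num by rewrite ge0_fin_numE// (le_lt_trans xn)// ltry.
have G := gibbs hk mphi phin.
pose E : set (R * R) := [set z | [/\ z.1 * e < z.2, z.2 < K z.1 & z.2 < z.1 * expR (n%:R + 1)]].
have mE : measurable E.
  rewrite (_ : E = [set z | z.1 * e < z.2] `&` ([set z | z.2 < K z.1] `&` [set z | z.2 < z.1 * expR (n%:R + 1)])).
    apply: measurableI; first by apply: measurable_lt_set => //; exact: measurable_funM.
    apply: measurableI; apply: measurable_lt_set => //; last exact: measurable_funM.
    exact: (measurableT_comp mK).
  by apply/seteqP; split => z [] //= ? [].
have r0 z : 0 <= @recip R z by rewrite expR_ge0.
have mr := @measurable_recip R.
have e1 : expR (- 1) = e^-1 :> R by rewrite expRN.
have mwE : measurable_fun setT (fun z => (recip z)%:E * unif R [set v | E (z, v)])%E.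
  apply: emeasurable_funM; first exact/measurable_EFinP.
  exact: measurable_unif_section.
have T : (\int[unif R]_z (expR (phi z) - 1)%:E <= (expR (-1))%:E * x)%E.
  apply: (@le_trans _ _ ((expR (-1))%:E *
      \int[unif R]_z ((recip z)%:E * unif R [set v | E (z, v)]))%E).
    rewrite -ge0_integralZl//; last first.
      by move=> z _; rewrite mule_ge0// lee_fin.
    apply: ae_unif_ge0_le.
    - by apply/measurable_EFinP; apply: measurable_funB => //; exact: measurable_expR_comp.
    - by apply: emeasurable_funM.
    - by move=> z; rewrite lee_fin subr_ge0 -[leLHS]expR0 ler_expR; case: (phi0 z).
    - by move=> z; rewrite !mule_ge0// lee_fin.
    move=> z z0 z1; have [K0 K1] := rearr_cdf_itv hr z.
    rewrite (_ : [set v | _] = [set` Interval (BSide false (z * e)) (BLeft (Num.min (K z) (z * expR (n%:R + 1))))]); last first.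
      by apply/seteqP; split => v /=; rewrite in_itv/= lt_min; [move=> [-> -> ->]|move=> /and3P[]].
    rewrite unif_itv; last 2 first.
    - by rewrite mulr_ge0 ?expR_ge0// ltW.
    - by rewrite ge_min K1.
    rewrite -expR_clog// recipE// -!EFinM lee_fin /phi (ger0_norm K0) (gtr0_norm z0) e1.
    rewrite le_eqVlt; apply/orP; left; apply/eqP; field.
    by rewrite !gt_eqF// expR_gt0.
  apply: lee_wpmul2l; first by rewrite lee_fin expR_ge0.
  rewrite unif_swap//; apply: ae_unif_ge0_le.
  - exact: measurable_unif_swap.
  - exact/measurable_EFinP.
  - by move=> v; apply: integral_ge0 => z _; rewrite lee_fin mulr_ge0.
  - by move=> v; rewrite lee_fin; case/andP: (@clog_itv _ n _ _ (normr_ge0 v) (normr_ge0 (S v))).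
  move=> v v0 v1; have [s0 s1] := rearr_itv hr v0 v1.
  pose p := Num.max (S v) (v * expR (- (n%:R + 1))).
  pose q := v * expR (- 1).
  have q0 : 0 < q by rewrite mulr_gt0// expR_gt0.
  have q1 : q < 1.
    apply: le_lt_trans v1; rewrite ler_piMr ?ltW// -[leRHS]expR0 ler_expR; lra.
  have p0 : 0 < p by rewrite lt_max s0.
  apply: (@le_trans _ _ (\int[unif R]_z (recip z * \1_[set` Interval (BSide true p) (BLeft q)] z)%:E)%E).
    apply: ae_unif_ge0_le.
    - apply/measurable_EFinP; apply: measurable_funM => //; apply: measurable_indic.
      exact: measurable_vsection.
    - by apply/measurable_EFinP; apply: measurable_funM => //; apply: measurable_indic.
    - by move=> z; rewrite lee_fin mulr_ge0.
    - by move=> z; rewrite lee_fin mulr_ge0.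
    move=> z z0 z1; rewrite lee_fin ler_wpM2l// !indicE.
    case: (boolP (z \in [set z0 | E (z0, v)])) => // /[!inE] -[/= h1 h2 h3].
    rewrite mem_set//= in_itv/= ge_max (rearr_le hr v0 v1 z0 z1 h2)/=.
    rewrite !expRN ler_pdivrMr ?expR_gt0// (ltW h3)/=.
    by rewrite /q expRN ltr_pdivlMr ?expR_gt0.
  rewrite (unif_recip_itv true p0 q0 (ltW q1)) lee_fin (gtr0_norm v0) (gtr0_norm s0) clog_minE//.
  have lq : ln q = ln v - 1 by rewrite lnM ?posrE ?expR_gt0// expRK.
  have lw : ln (v * expR (- (n%:R + 1))) = ln v - n%:R - 1.
    by rewrite lnM ?posrE ?expR_gt0// expRK; lra.
  have n0 : 0 <= n%:R :> R by [].
  rewrite lq /p; case: (leP (S v) (v * expR (- (n%:R + 1)))) => sv.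
    rewrite lw; have : ln (S v) <= ln v - n%:R - 1.
      by rewrite -lw ler_ln ?posrE ?mulr_gt0 ?expR_gt0.
    move=> h; rewrite max_r; last by lra.
    by rewrite max_r; [rewrite min_r; lra|lra].
  have : ln v - n%:R - 1 < ln (S v).
    by rewrite -lw ltr_ln ?posrE ?mulr_gt0 ?expR_gt0.
  move=> h; case: (leP 0 (ln v - ln (S v) - 1)) => h'.
    by rewrite max_r; [rewrite min_l; lra|lra].
  by rewrite max_l; [rewrite min_l|lra].
have Iexp : (\int[unif R]_z (expR (phi z))%:E = \int[unif R]_z (expR (phi z) - 1)%:E + 1)%E.
  rewrite -[X in (_ = _ + X)%E](prob_cst (unif R) 1%E) -ge0_integralD//.
  - by apply: eq_integral => z _; rewrite -EFinD subrK.
  - by move=> z _; rewrite lee_fin subr_ge0 -[leLHS]expR0 ler_expR; case: (phi0 z).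
  - by apply/measurable_EFinP; apply: measurable_funB => //; exact: measurable_expR_comp.
move: G; rewrite xE Iexp => G.
have {T}G : (x + 1 <= H + ((expR (-1))%:E * x + 1))%E.
  by apply: (le_trans G); rewrite leeD2l// leeD2r.
have e2 : expR (-1) <= 2^-1 :> R.
  rewrite e1 lef_pV2 ?posrE ?expR_gt0//.
  by have := expR_ge1Dx (1 : R); lra.
move: G x0; rewrite -(fineK xfin) -EFinM -!EFinD lee_fin => G x0.
case: H G => [h| |] G //=.
  by move: G; rewrite -EFinD !lee_fin; nra.
by rewrite mulry gtr0_sg ?mul1e ?leey.
Qed.

(** Let x be the left-hand side, that is, the rho-mean of psi z = clog n z (K z).
    The variational formula applied to - psi gives 1 - x <= H + \int e^(- psi).
    By expRN_clog and Tonelli's theorem, \int (1 - e^(- psi)) >= e x, since the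
    region E where K z <= v < z / e and z <= v e^(n + 1) contains the points with
    e v < z < S v and z <= v e^(n + 1).  Hence (e - 1) x <= H, and e >= 2. *)
Lemma rearr_deficit n :
  (\int[unif R]_v (clog n `|S v| `|v|)%:E <= 2%:E * H)%E.
Proof.
have [k hk] := has_density_ex (rearr_dom hr).
pose psi z := clog n `|z| `|K z|.
have psi0 z : 0 <= psi z /\ psi z <= n%:R.
  by apply/andP; apply: clog_itv.
have mpsi : measurable_fun setT psi.
  by apply: measurable_clog; [|apply: measurableT_comp => //]; exact: normr_measurable.
have mphi : measurable_fun setT (fun z => - psi z) by exact: measurable_funN.
have phin z : `|- psi z| <= n%:R by rewrite normrN ger0_norm; case: (psi0 z).
set x := (X in (X <= _)%E).
have c0 v : 0 <= clog n `|S v| `|v| /\ clog n `|S v| `|v| <= n%:R.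
  by apply/andP; apply: clog_itv.
have mx : measurable_fun setT (fun v : R => clog n `|S v| `|v|).
  by apply: measurable_clog; [apply: measurableT_comp => //|]; exact: normr_measurable.
have xE : (\int[rho]_z (psi z)%:E = x)%E.
  rewrite rearr_integral; last 2 first.
  - exact/measurable_EFinP.
  - by move=> z; rewrite lee_fin; case: (psi0 z).
  apply: ae_unif_ge0_eq.
  - by apply/measurable_EFinP; exact: (measurableT_comp mpsi).
  - exact/measurable_EFinP.
  - by move=> v; rewrite lee_fin; case: (psi0 (S v)).
  - by move=> v; rewrite lee_fin; case: (c0 v).
  - by move=> v v0 v1; rewrite /psi (rearr_cdfK hr).
have x0 : (0 <= x)%E.
  by apply: integral_ge0 => v _; rewrite lee_fin; case: (c0 v).
have xn : (x <= n%:R%:E)%E.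
  rewrite -(prob_cst (unif R) n%:R%:E); apply: ge0_le_integral => //.
  - by move=> v _; rewrite lee_fin; case: (c0 v).
  - exact/measurable_EFinP.
  - by move=> v _; rewrite lee_fin; case: (c0 v).
have xfin : x \is a fin_num by rewrite ge0_fin_numE// (le_lt_trans xn)// ltry.
have G := gibbs hk mphi phin.
pose E : set (R * R) := [set z | [/\ z.1 * expR (- (n%:R + 1)) <= z.2, K z.1 <= z.2 & z.2 < z.1 * expR (- 1)]].
have mE : measurable E.
  rewrite (_ : E = ~` [set z | z.2 < z.1 * expR (- (n%:R + 1))] `&`
      (~` [set z | z.2 < K z.1] `&` [set z | z.2 < z.1 * expR (- 1)])).
    apply: measurableI.
      by apply: measurableC; apply: measurable_lt_set => //; exact: measurable_funM.
    apply: measurableI; last by apply: measurable_lt_set => //; exact: measurable_funM.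
    apply: measurableC; apply: measurable_lt_set => //.
    exact: (measurableT_comp mK).
  apply/seteqP; split => z /=; first by move=> [h1 h2 h3]; split; [|split => //]; apply/negP; rewrite -leNgt.
  by move=> [/negP + [/negP + h3]]; rewrite -!leNgt.
have r0 z : 0 <= @recip R z by rewrite expR_ge0.
have mr := @measurable_recip R.
have e1 : expR (- 1) = e^-1 :> R by rewrite expRN.
have psi1 z : 0 <= 1 - expR (- psi z).
  by rewrite subr_ge0 -[leRHS]expR0 ler_expR oppr_le0; case: (psi0 z).
have m1 : measurable_fun setT (fun z => (1 - expR (- psi z))%:E).
  by apply/measurable_EFinP; apply: measurable_funB => //; exact: measurable_expR_comp.
have mwE : measurable_fun setT (fun z => (recip z)%:E * unif R [set v | E (z, v)])%E.
  apply: emeasurable_funM; first exact/measurable_EFinP.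
  exact: measurable_unif_section.
have T : (e%:E * x <= \int[unif R]_z (1 - expR (- psi z))%:E)%E.
  apply: (@le_trans _ _ (e%:E *
      \int[unif R]_z ((recip z)%:E * unif R [set v | E (z, v)]))%E); last first.
    rewrite -ge0_integralZl//; last first.
      by move=> z _; rewrite mule_ge0// lee_fin.
    apply: ae_unif_ge0_le => //.
    - by apply: emeasurable_funM.
    - by move=> z; rewrite !mule_ge0// lee_fin ?expR_ge0.
    move=> z z0 z1; have [K0 K1] := rearr_cdf_itv hr z.
    rewrite (_ : [set v | _] = [set` Interval (BSide true (Num.max (z * expR (- (n%:R + 1))) (K z))) (BLeft (z * expR (- 1)))]); last first.
      apply/seteqP; split => v /=; rewrite in_itv/= ge_max; first by move=> [-> -> ->].
      by move=> /andP[/andP[]].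
    rewrite unif_itv; last 2 first.
    - by rewrite le_max mulr_ge0 ?expR_ge0// ltW.
    - by rewrite -[leRHS]mulr1; apply: ler_pM; rewrite ?expR_ge0 ?(ltW z0) ?(ltW z1)// -[leRHS]expR0 ler_expR; lra.
    rewrite recipE// -!EFinM lee_fin /psi (ger0_norm K0) (gtr0_norm z0).
    have e0 : 0 < e by rewrite expR_gt0.
    rewrite -(ler_pM2r z0) expRN_clog//.
    set Y := z * expR (- 1) - _; set W := z - _.
    have -> : e * (z^-1 * Num.max 0 Y) * z = e * Num.max 0 Y by field; rewrite gt_eqF.
    suff -> : W = e * Y by rewrite maxr_pMr ?mulr0// ltW.
    rewrite /W /Y mulrBr maxr_pMr ?(ltW e0)// maxC; congr (_ - Num.max _ _).
    - by rewrite mulrCA -expRD subrr expR0 mulr1.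
    - by rewrite mulrCA -expRD; congr (_ * expR _); ring.
    - by rewrite mulrC.
  apply: lee_wpmul2l; first by rewrite lee_fin expR_ge0.
  rewrite unif_swap//; apply: ae_unif_ge0_le.
  - exact/measurable_EFinP.
  - exact: measurable_unif_swap.
  - by move=> v; rewrite lee_fin; case: (c0 v).
  - by move=> v; apply: integral_ge0 => z _; rewrite lee_fin mulr_ge0.
  move=> v v0 v1; have [s0 s1] := rearr_itv hr v0 v1.
  pose q := Num.min (S v) (v * expR (n%:R + 1)).
  pose p := v * e.
  have p0 : 0 < p by rewrite mulr_gt0// expR_gt0.
  have q0 : 0 < q by rewrite lt_min s0 mulr_gt0// expR_gt0.
  have q1 : q <= 1 by rewrite ge_min (ltW s1).
  apply: (@le_trans _ _ (\int[unif R]_z (recip z * \1_[set` Interval (BSide false p) (BLeft q)] z)%:E)%E); last first.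
    apply: ae_unif_ge0_le.
    - by apply/measurable_EFinP; apply: measurable_funM => //; apply: measurable_indic.
    - apply/measurable_EFinP; apply: measurable_funM => //; apply: measurable_indic.
      exact: measurable_vsection.
    - by move=> z; rewrite lee_fin mulr_ge0.
    - by move=> z; rewrite lee_fin mulr_ge0.
    move=> z z0 z1; rewrite lee_fin ler_wpM2l// !indicE.
    case: (boolP (z \in [set` Interval (BSide false p) (BLeft q)])) => // /[!inE].
    rewrite /= in_itv/= lt_min => /and3P[h1 h2 h3].
    rewrite mem_set//=; split => /=.
    - by rewrite expRN ler_pdivrMr ?expR_gt0// ltW.
    - rewrite leNgt; apply/negP => vK.
      by have := lt_le_trans h2 (rearr_le hr v0 v1 z0 z1 vK); rewrite ltxx.
    - by rewrite expRN ltr_pdivlMr ?expR_gt0.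
  rewrite (unif_recip_itv false p0 q0 q1) lee_fin (gtr0_norm v0) (gtr0_norm s0) clog_minE//.
  have lp : ln p = ln v + 1 by rewrite lnM ?posrE ?expR_gt0// expRK.
  have lw : ln (v * expR (n%:R + 1)) = ln v + n%:R + 1.
    by rewrite lnM ?posrE ?expR_gt0// expRK; lra.
  have n0 : 0 <= n%:R :> R by [].
  rewrite lp /q; case: (leP (S v) (v * expR (n%:R + 1))) => sv.
    by rewrite opprD addrA ge_min lexx.
  apply: (@le_trans _ _ n%:R); first by rewrite ge_min lexx orbT.
  by rewrite lw le_max; apply/orP; right; lra.
have Itot : (1%E = \int[unif R]_z (expR (- psi z))%:E + \int[unif R]_z (1 - expR (- psi z))%:E)%E.
  rewrite -{1}(prob_cst (unif R) 1%E) -ge0_integralD//.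
  - by apply: eq_integral => z _; rewrite -EFinD addrC subrK.
  - by apply/measurable_EFinP; exact: measurable_expR_comp.
  - by move=> z _; rewrite lee_fin.
have y1 : (\int[unif R]_z (expR (- psi z))%:E <= 1)%E.
  by rewrite [leRHS]Itot leeDl//; apply: integral_ge0 => z _; rewrite lee_fin.
set u := (\int[unif R]_z (expR (- psi z))%:E)%E in Itot y1 G.
set y := (\int[unif R]_z (1 - expR (- psi z))%:E)%E in Itot T.
have u0 : (0 <= u)%E by apply: integral_ge0 => z _; rewrite lee_fin expR_ge0.
have y0 : (0 <= y)%E by apply: integral_ge0 => z _; rewrite lee_fin.
have ufin : u \is a fin_num by rewrite ge0_fin_numE// (le_lt_trans y1)// ltry.
have yfin : y \is a fin_num.
  rewrite ge0_fin_numE//; apply: (@le_lt_trans _ _ 1%E); last exact: ltry.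
  by rewrite [leRHS]Itot leeDr.
have xN : (\int[rho]_z (- psi z)%:E = - x)%E.
  rewrite -xE -integral_ge0N//.
  by move=> z _; rewrite lee_fin; case: (psi0 z).
have e2 : 2 <= e by have := expR_ge1Dx (1 : R); lra.
move: G Itot T x0; rewrite xN -(fineK xfin) -(fineK ufin) -(fineK yfin).
rewrite -EFinN -EFinM -!EFinD !lee_fin => G [Itot] T x0.
case: H G => [h| |] G //=.
  by move: G; rewrite -EFinD !lee_fin; nra.
by rewrite mulry gtr0_sg ?mul1e ?leey.
Qed.

End rearrangement_cost.

Lemma ge0_integral_truncate d (T : measurableType d) (R : realType)
    (P : {measure set T -> \bar R}) (f : T -> R) (C : \bar R) :
  measurable_fun setT f -> (forall x, 0 <= f x) ->
  (forall n : nat, (\int[P]_x (Num.min (f x) n%:R)%:E <= C)%E) ->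
  (\int[P]_x (f x)%:E <= C)%E.
Proof.
move=> mf f0 h.
have cv : (\int[P]_x (Num.min (f x) n%:R)%:E)%E @[n --> \oo] --> (\int[P]_x (f x)%:E)%E.
  rewrite (_ : (\int[P]_x (f x)%:E)%E =
    (\int[P]_x limn (fun n : nat => (Num.min (f x) n%:R)%:E))%E); last first.
    apply: eq_integral => x _; apply/esym/cvg_lim => //.
    apply: cvg_near_cst; exists (Num.bound (f x)) => // n /= fn.
    rewrite min_l//; apply: le_trans (ltW (archi_boundP (f0 x))) _.
    by rewrite ler_nat.
  apply: cvg_monotone_convergence => //.
  - by move=> n; apply/measurable_EFinP; exact: measurable_minr.
  - by move=> n x _; rewrite lee_fin le_min f0/=.
  - move=> x _ n m nm; rewrite lee_fin le_min ge_min lexx/= ge_min.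
    by apply/orP; right; rewrite ler_nat.
by apply: cvge_to_le cv _; apply: nearW.
Qed.

Section quantile_rearrangement.
Context (R : realType) (rho : probability R R).
Hypothesis hdom : rho `<< unif R.

Let rho_set1 x : rho [set x] = 0%E.
Proof.
have u0 : unif R [set x] = 0%E.
  rewrite unifE; last exact: measurable_set1.
  apply/eqP; rewrite eq_le measure_ge0 andbT.
  rewrite -(lebesgue_measure_set1 x); apply: le_measure; rewrite ?inE//.
  by apply: measurableI => //; exact: measurable_set1.
by move/null_content_dominatesP : hdom; apply; first exact: measurable_set1.
Qed.

(** A law dominated by the uniform law has no atom, so its distribution function is
    continuous. *)
Lemma cumul_quantK v : 0 < v -> v < 1 -> cumul rho (quant rho v) = v.
Proof.
move=> v0 v1; apply/eqP; rewrite eq_le cumul_quant// andbT.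
set q := quant rho v.
have -> : cumul rho q = fine (rho `]-oo, q[%classic).
  rewrite /cumul /dist_fun; congr fine.
  rewrite -(@setUitv1 _ _ -oo%O q true)//= measureU//=.
  - by rewrite [X in (_ + X)%E]rho_set1 adde0.
  - by apply/seteqP; split => // y [/=]; rewrite in_itv/= => + yq; rewrite yq ltxx.
have cv : rho \o (fun j : nat => `]-oo, (q - j.+1%:R^-1)]%classic) @ \oo -->
    rho `]-oo, q[%classic.
  have E : \bigcup_j `]-oo, (q - j.+1%:R^-1)]%classic = `]-oo, q[%classic :> set R.
    apply/seteqP; split => y /=.
      move=> [j _ /=]; rewrite !in_itv/= => yt.
      by apply: le_lt_trans yt _; rewrite ltrBlDr ltrDl invr_gt0.
    rewrite in_itv/= => yt.
    have e0 : 0 < q - y by rewrite subr_gt0.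
    have [j je] := ltr_add_invr e0; rewrite add0r in je.
    by exists j => //=; rewrite in_itv/= lerBrDl -lerBrDr ltW.
  rewrite -E; apply: nondecreasing_cvg_mu => //; first by rewrite E.
  move=> n m nm; apply/subsetPset => y /=; rewrite !in_itv/= => yt.
  apply: le_trans yt _; rewrite lerD2l lerN2 lef_pV2 ?posrE//.
  by rewrite ler_nat.
rewrite -lee_fin fineK ?fin_num_measure//.
apply: cvge_to_le cv _; apply: nearW => j /=.
rewrite -[X in (X <= _)%E]/(dist_fun rho _) dist_fun_fin lee_fin ltW// -quant_lt//.
by rewrite ltrBlDr ltrDl invr_gt0.
Qed.

Lemma quantile_rearrangement : rearrangement rho (quant rho) (cumul rho).
Proof.
have dom0 A : measurable A -> unif R A = 0%E -> rho A = 0%E.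
  by move/null_content_dominatesP : hdom; apply.
have c0 : cumul rho 0 = 0.
  rewrite /cumul /dist_fun dom0// unifE// (_ : _ `&` _ = set0) ?measure0//.
  by apply/seteqP; split => v //= []; rewrite !in_itv/= => ? /andP[]; lra.
have c1 : cumul rho 1 = 1.
  rewrite /cumul /dist_fun.
  have -> : `]-oo, (1 : R)]%classic = ~` `]1, +oo[%classic by rewrite setCitvr.
  rewrite probability_setC// dom0// ?sube0// unifE// (_ : _ `&` _ = set0) ?measure0//.
  by apply/seteqP; split => v //= []; rewrite !in_itv/= => + /andP[]; lra.
split => //.
- exact: measurable_quant.
- by move=> A mA; rewrite -(law_quant rho mA).
- move=> v v0 v1; have q0 : 0 < quant rho v by rewrite quant_lt// c0.
  split => //; rewrite lt_neqAle quant_le// c1 (ltW v1) andbT.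
  apply/eqP => q1; have := cumul_quantK v0 v1; rewrite q1 c1 => vE.
  by rewrite -vE ltxx in v1.
- apply: nondecreasing_measurable => // x y; exact: cumul_le.
- by move=> z; split; [exact: cumul_ge0|exact: cumul_le1].
- exact: cumul_quantK.
- by move=> v z v0 v1 z0 z1 /ltW; rewrite -quant_le.
- by move=> v z v0 v1 z0 z1; rewrite -quant_lt// => /ltW.
Qed.

End quantile_rearrangement.

Section mirror.
Context (R : realType).

Definition flip (v : R) : R := 1 - v.

Lemma measurable_flip : measurable_fun setT flip.
Proof. exact: measurable_funB. Qed.

Lemma flipK : involutive flip.
Proof. by move=> v; rewrite /flip subKr. Qed.

Lemma unif_flip A : measurable A -> unif R (flip @^-1` A) = unif R A.
Proof.
move=> mA; transitivity (law (unif R) measurable_flip A) => //.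
move: A mA; apply: finite_measure_eq_lrays.
- by apply: (@le_lt_trans _ _ 1%E); [exact: probability_le1|exact: ltry].
- by transitivity (1%E : \bar R); [|apply/esym]; exact: probability_setT.
move=> x; transitivity (unif R (flip @^-1` `]-oo, x[%classic)) => //.
transitivity (unif R `]-oo, x[%classic); last by [].
have [x0|x0] := leP x 0.
  rewrite !unifE//; last exact: (measurable_preimage measurable_flip).
  by congr (lebesgue_measure _); apply/seteqP; split => v /=;
    rewrite !in_itv/= /flip => -[vx /andP[v0 v1]]; lra.
have [x1|x1] := leP 1 x.
  rewrite !unifE//; last exact: (measurable_preimage measurable_flip).
  by congr (lebesgue_measure _); apply/seteqP; split => v /=;
    rewrite !in_itv/= /flip => -[vx /andP[v0 v1]]; split; lra.
have xx : 0 <= x by lra.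
have xx' : 0 <= 1 - x by lra.
have := @unif_itv R false 0 x (lexx 0) (ltW x1).
have := @unif_itv R false (1 - x) 1 xx' (lexx 1).
rewrite opprB addrCA subrr addr0 subr0 max_r// => E1 E2.
transitivity (x%:E : \bar R).
  rewrite -E1 !unifE//; last exact: (measurable_preimage measurable_flip).
  congr (lebesgue_measure _); apply/seteqP; split => v /=;
    rewrite !in_itv/= /flip => -[vx /andP[v0 v1]]; (split; [|by rewrite v0 v1]); lra.
rewrite -E2 !unifE//.
congr (lebesgue_measure _); apply/seteqP; split => v /=;
    rewrite !in_itv/= => -[vx /andP[v0 v1]]; (split; [|by rewrite v0 v1]).
- by case/andP: vx.
- by rewrite v0 vx.
Qed.

Lemma ge0_integral_unif_flip (f : R -> \bar R) : measurable_fun setT f ->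
  (forall v, 0 <= f v)%E ->
  (\int[unif R]_v f (flip v) = \int[unif R]_v f v)%E.
Proof.
move=> mf f0; rewrite -(ge0_integral_law (unif R) measurable_flip)//.
by apply: eq_measure_integral => A mA _; exact: unif_flip.
Qed.

Variables (rho : probability R R) (S K : R -> R).
Hypothesis hr : rearrangement rho S K.

Let rho' := law rho measurable_flip.

Lemma flip_density k : has_density rho (unif R) k ->
  has_density rho' (unif R) (k \o flip).
Proof.
move=> [mk k0 kE]; split.
- exact: (measurableT_comp mk measurable_flip).
- by move=> x; exact: k0.
move=> A mA; transitivity (rho (flip @^-1` A)) => //.
have mA' : measurable (flip @^-1` A) by exact: (measurable_preimage measurable_flip).
rewrite kE// integral_mkcond [RHS]integral_mkcond -ge0_integral_unif_flip; last 2 first.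
- by apply/(measurable_restrictT _ mA'); apply: measurable_funTS; exact/measurable_EFinP.
- by move=> v; rewrite patchE; case: ifP => // _; rewrite lee_fin.
apply: eq_integral => v _; rewrite !patchE.
have -> : (flip v \in flip @^-1` A) = (v \in A).
  by apply/idP/idP; rewrite !inE/= flipK.
by [].
Qed.

Lemma flip_entropy : rel_entropy rho' (unif R) = rel_entropy rho (unif R).
Proof.
have [k hk] := has_density_ex (rearr_dom hr).
rewrite (density_entropy hk) (density_entropy (flip_density hk)).
rewrite integral_law.
  by apply: eq_integral => v _; rewrite /= flipK.
by apply: measurable_lne_EFin; case: (flip_density hk).
Qed.

Lemma flip_rearrangement :
  rearrangement rho' (flip \o S \o flip) (flip \o K \o flip).
Proof.
have [k hk] := has_density_ex (rearr_dom hr).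
have mS := rearr_measurable hr; have mK := rearr_cdf_measurable hr.
have fi v : 0 < v -> v < 1 -> 0 < flip v /\ flip v < 1.
  by rewrite /flip => v0 v1; split; lra.
split.
- exact: density_dominates (flip_density hk).
- by apply: (measurableT_comp measurable_flip); exact: (measurableT_comp mS measurable_flip).
- move=> A mA; transitivity (rho (flip @^-1` A)) => //.
  have mA' : measurable (flip @^-1` A) by exact: (measurable_preimage measurable_flip).
  rewrite (rearr_law hr)// -unif_flip//.
  exact: (measurable_preimage mS).
- move=> v v0 v1; have [f0 f1] := fi v v0 v1; have [s0 s1] := rearr_itv hr f0 f1.
  exact: fi.
- by apply: (measurableT_comp measurable_flip); exact: (measurableT_comp mK measurable_flip).
- move=> z; have [k0 k1] := rearr_cdf_itv hr (flip z).
  by rewrite /flip /= in k0 k1 *; split; lra.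
- move=> v v0 v1; have [f0 f1] := fi v v0 v1.
  by rewrite /= flipK (rearr_cdfK hr f0 f1) flipK.
- move=> v z v0 v1 z0 z1 vz; have [f0 f1] := fi v v0 v1; have [g0 g1] := fi z z0 z1.
  have := rearr_ge hr f0 f1 g0 g1; rewrite /= /flip in vz *.
  by move=> h; have := h ltac:(lra); lra.
- move=> v z v0 v1 z0 z1 vz; have [f0 f1] := fi v v0 v1; have [g0 g1] := fi z z0 z1.
  have := rearr_le hr f0 f1 g0 g1; rewrite /= /flip in vz *.
  by move=> h; have := h ltac:(lra); lra.
Qed.

Local Notation H := (rel_entropy rho (unif R)).

(** The last two terms are the first two for the reflected rearrangement, which has
    the same entropy. *)
Lemma rearr_cost n :
  (\int[unif R]_v (clog n `|v| `|S v| + clog n `|S v| `|v| +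
     (clog n `|1 - v| `|1 - S v| + clog n `|1 - S v| `|1 - v|))%:E <= 8%:E * H)%E.
Proof.
have mS := rearr_measurable hr.
have c0 (a b : R) : 0 <= clog n `|a| `|b| by case/andP: (@clog_itv _ n _ _ (normr_ge0 a) (normr_ge0 b)).
have mc (f g : R -> R) : measurable_fun setT f -> measurable_fun setT g ->
    measurable_fun setT (fun v => (clog n `|f v| `|g v|)%:E).
  move=> mf mg; apply/measurable_EFinP.
  by apply: measurable_clog; apply: measurableT_comp => //; exact: normr_measurable.
have h1 := rearr_excess hr n.
have h2 := rearr_deficit hr n.
have h3 : (\int[unif R]_v (clog n `|1 - v| `|1 - S v|)%:E <= 2%:E * H)%E.
  rewrite -flip_entropy -ge0_integral_unif_flip; last 2 first.
  - by apply: mc; exact: measurable_funB.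
  - by move=> v; rewrite lee_fin.
  apply: le_trans (rearr_excess flip_rearrangement n).
  by under eq_integral do rewrite subKr.
have h4 : (\int[unif R]_v (clog n `|1 - S v| `|1 - v|)%:E <= 2%:E * H)%E.
  rewrite -flip_entropy -ge0_integral_unif_flip; last 2 first.
  - by apply: mc; exact: measurable_funB.
  - by move=> v; rewrite lee_fin.
  apply: le_trans (rearr_deficit flip_rearrangement n).
  by under eq_integral do rewrite subKr.
under eq_integral do rewrite !EFinD.
rewrite ge0_integralD//; last 4 first.
- by move=> v _; rewrite adde_ge0// lee_fin.
- by apply: emeasurable_funD; exact: mc.
- by move=> v _; rewrite adde_ge0// lee_fin.
- by apply: emeasurable_funD; apply: mc => //; exact: measurable_funB.
rewrite ge0_integralD//; last 4 first.
- by move=> v _; rewrite lee_fin.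
- exact: mc.
- by move=> v _; rewrite lee_fin.
- exact: mc.
rewrite ge0_integralD//; last 4 first.
- by move=> v _; rewrite lee_fin.
- by apply: mc => //; exact: measurable_funB.
- by move=> v _; rewrite lee_fin.
- by apply: mc => //; exact: measurable_funB.
apply: le_trans (leeD (leeD h1 h2) (leeD h3 h4)) _.
case: H => [r| |].
- by rewrite -!EFinM -!EFinD lee_fin; lra.
- by rewrite [X in (_ <= X)%E]gt0_muley ?lte_fin// leey.
- by rewrite !gt0_muleNy ?lte_fin.
Qed.

End mirror.

(** * The symmetric exponential law *)

Section exponential_law.
Context (R : realType).
Local Notation leb := (@lebesgue_measure R).
Local Notation expl := (@exp_law R).
Local Notation g := (fun x : R => (2^-1 * expR (- `|x|))%:E).

Let mg : measurable_fun setT (g : measurableTypeR R -> \bar R).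
Proof.
apply/measurable_EFinP; apply: measurable_funM => //.
apply: measurable_expR_comp; apply: measurable_funN.
exact: normr_measurable.
Qed.

Let g0 (x : R) : (0 <= g x)%E. Proof. by rewrite lee_fin mulr_ge0// expR_ge0. Qed.

Let g_half_line (A : set R) : A `<=` `[0, +oo[ -> measurable A ->
  expl A = ((2^-1)%:E * exponential_prob 1 A)%E.
Proof.
move=> A0 mA; rewrite /exponential_prob -ge0_integralZl//; last 2 first.
- apply: measurable_funTS; apply/measurable_EFinP.
  exact: measurable_exponential_pdf.
- by move=> x _; rewrite lee_fin exponential_pdf_ge0.
apply: eq_integral => x; rewrite inE => /A0/=; rewrite in_itv/= andbT => x0.
by rewrite exponential_pdfE// ger0_norm// -EFinM mul1r mulN1r.
Qed.

Let half_line1 : exponential_prob 1 (`[0, +oo[%classic : set R) = 1%E.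
Proof.
rewrite -(@integral_exponential_pdf R 1)// /exponential_prob.
rewrite [LHS]integral_mkcond; apply: eq_integral => x _.
rewrite patchE; case: ifPn => //; rewrite notin_setE/= in_itv/= andbT => /negP.
by rewrite -ltNge => x0; rewrite lt0_exponential_pdf.
Qed.

Let expl_set1 (x : R) : expl [set x] = 0%E.
Proof. by rewrite /exp_law integral_set1. Qed.

Let explU (A B : set R) : measurable A -> measurable B -> A `&` B = set0 ->
  expl (A `|` B) = (expl A + expl B)%E.
Proof.
move=> mA mB AB; rewrite /exp_law ge0_integral_setU//.
- exact: measurable_funTS.
- by apply/eqP; rewrite AB.
Qed.

Lemma exp_law_tail (x : R) : 0 <= x -> expl `]x, +oo[ = (2^-1 * expR (- x))%:E.
Proof.
move=> x0.
have E : expl `[0, +oo[ = (expl `[0%R, x] + expl `]x, +oo[)%E.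
  rewrite -explU//; last first.
    by apply/seteqP; split => // y [/=]; rewrite !in_itv/= andbT => /andP[_]; lra.
  congr expl; apply/seteqP; split => y /=; rewrite !in_itv/= !andbT.
    by move=> ->/=; case: (leP y x); [left|right].
  by case=> [/andP[]//|]; lra.
have L : expl `[0%R, x] = (2^-1 * (1 - expR (- x)))%:E.
  move: x0; rewrite le_eqVlt => /orP[/eqP <-|x0].
    by rewrite set_itv1 expl_set1 oppr0 expR0 subrr mulr0.
  rewrite g_half_line//; last by move=> y /=; rewrite !in_itv/= andbT => /andP[].
  by rewrite exponential_prob_itv0c// mulN1r -EFinB -EFinM.
move: E; rewrite L g_half_line// half_line1 mule1.
case: (expl _) => [r| |]//.
by rewrite -EFinD => -[h]; congr EFin; lra.
Qed.

Lemma exp_law_ray_le0 (x : R) : x <= 0 -> expl `]-oo, x] = (2^-1 * expR x)%:E.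
Proof.
move=> x0.
have -> : expl `]-oo, x] =
    (\int[leb]_(r in `]-oo, 0%R]) (g \_ `[(- x)%R, +oo[) (- r)%R)%E.
  rewrite /exp_law (_ : `]-oo, x] = `]-oo, 0] `&` `]-oo, x])%classic; last first.
    by apply/seteqP; split => y /=; rewrite !in_itv/=; [split; lra|case].
  rewrite integral_mkcondr; apply: eq_integral => r _; rewrite !patchE.
  rewrite !mem_setE !in_itv/= andbT lerN2 normrN.
  by [].
rewrite -ge0_integration_by_substitution0; last 2 first.
- by apply/measurable_restrict => //; exact: measurable_funTS.
- by move=> r; rewrite patchE; case: ifP.
rewrite -integral_mkcondr (_ : _ `&` _ = `[- x, +oo[%classic); last first.
  by apply/seteqP; split => y /=; rewrite !in_itv/= !andbT; [case|split; lra].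
rewrite -integral_itv_obnd_cbnd; last exact: measurable_funTS.
by rewrite -[LHS]/(expl _) exp_law_tail ?oppr_ge0// opprK.
Qed.

Definition expcdf (x : R) := if x <= 0 then 2^-1 * expR x else 1 - 2^-1 * expR (- x).

Lemma dist_fun_exp_law (x : R) : dist_fun expl x = (expcdf x)%:E.
Proof.
rewrite /dist_fun /expcdf; case: leP => x0; first exact: exp_law_ray_le0.
have {}x0 := ltW x0.
have sp (y : R) : setT = (`]-oo, y] `|` `]y, +oo[)%classic.
  apply/seteqP; split => z //= _; rewrite !in_itv/= andbT.
  by case: (leP z y); [left|right].
have ds (y : R) : (`]-oo, y] `&` `]y, +oo[ = set0)%classic.
  by apply/seteqP; split => z //= []; rewrite !in_itv/= andbT; lra.
have /esym : expl setT = (expl `]-oo, 0%R] + expl `]0%R, +oo[)%E by rewrite (sp 0) explU.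
rewrite (@exp_law_ray_le0 0)// (@exp_law_tail 0)// (sp x) explU// exp_law_tail//.
rewrite oppr0 expR0 mulr1; case: (expl _) => [r| |]//.
by rewrite -!EFinD => -[h]; congr EFin; lra.
Qed.

Lemma expcdf_itv (x : R) : 0 < expcdf x /\ expcdf x < 1.
Proof.
have h (y : R) : 0 < expR y by exact: expR_gt0.
have h1 (y : R) : y <= 0 -> expR y <= (1 : R) by move=> y0; rewrite -expR0 ler_expR.
rewrite /expcdf; case: (leP x 0) => x0.
- by have := h x; have := h1 x x0; lra.
- by have := h (- x); have := h1 (- x); lra.
Qed.

Lemma expcdf_homo (x y : R) : x <= y -> expcdf x <= expcdf y.
Proof.
move=> xy; have h1 (z : R) : z <= 0 -> expR z <= (1 : R).
  by move=> z0; rewrite -expR0 ler_expR.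
have e1 : expR x <= expR y by rewrite ler_expR.
have e2 : expR (- y) <= expR (- x) by rewrite ler_expR lerN2.
rewrite /expcdf; case: (leP x 0) => x0; case: (leP y 0) => y0; try lra.
have := h1 x x0; have := h1 (- y); lra.
Qed.

Lemma UmapE (mu : probability R R) (x : R) : Umap mu x = quant mu (expcdf x).
Proof.
by have [h0 h1] := expcdf_itv x; rewrite /Umap dist_fun_exp_law quantileE.
Qed.

Definition expquant (v : R) := if v <= 2^-1 then ln (2 * v) else - ln (2 * (1 - v)).

Lemma expquantK (v : R) : 0 < v -> v < 1 -> expcdf (expquant v) = v.
Proof.
move=> v0 v1; rewrite /expcdf /expquant; case: (leP v 2^-1) => v2.
  rewrite ln_le0; last by lra.
  by rewrite lnK ?posrE; lra.
rewrite oppr_le0 leNgt ln_lt0/=; last by apply/andP; split; lra.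
by rewrite opprK lnK ?posrE; lra.
Qed.

(** On each half of ]0, 1[, expquant is a logarithm up to a constant; across 1/2,
    each point is compared with 1/2. *)
Lemma expquant_dist (v w : R) : 0 < v -> v < 1 -> 0 < w -> w < 1 ->
  `|expquant v - expquant w| <= `|ln v - ln w| + `|ln (1 - v) - ln (1 - w)|.
Proof.
move=> v0 v1 w0 w1; rewrite /expquant.
have l2 (x : R) : 0 < x -> ln (2 * x) = ln 2 + ln x by move=> x0; rewrite lnM ?posrE.
have lh : ln (2^-1 : R) = - ln 2 by rewrite lnV ?posrE.
have h1 (x : R) : 0 < x -> x <= 2^-1 -> ln x <= - ln 2.
  by move=> x0 x2; rewrite -lh ler_ln ?posrE.
have h2 (x : R) : 2^-1 <= x -> - ln 2 <= ln x.
  by move=> x2; rewrite -lh ler_ln// posrE; lra.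
have n1 (x : R) : x <= `|x| := ler_norm x.
have n2 (x : R) : - x <= `|x| by rewrite -normrN; exact: ler_norm.
have n0 (x : R) : 0 <= `|x| by [].
case: (leP v 2^-1) => v2; case: (leP w 2^-1) => w2; rewrite !l2; try lra.
- rewrite (_ : _ - _ = ln v - ln w); last by ring.
  by rewrite lerDl.
- rewrite ler0_norm.
    have := h1 v v0 v2; have := h1 (1 - w); have := h2 w; have := h2 (1 - v).
    have := n2 (ln v - ln w); have := n1 (ln (1 - v) - ln (1 - w)); lra.
  by have := h1 v v0 v2; have := h1 (1 - w); lra.
- rewrite ger0_norm.
    have := h1 w w0 w2; have := h1 (1 - v); have := h2 v; have := h2 (1 - w).
    have := n1 (ln v - ln w); have := n2 (ln (1 - v) - ln (1 - w)); lra.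
  by have := h1 w w0 w2; have := h1 (1 - v); lra.
- rewrite (_ : - _ - _ = - (ln (1 - v) - ln (1 - w))); last by ring.
  by rewrite normrN lerDr.
Qed.

Lemma min_sum4 (x n c1 c2 c3 c4 : R) :
  0 <= n -> 0 <= c1 -> 0 <= c2 -> 0 <= c3 -> 0 <= c4 ->
  x <= c1 + c2 + (c3 + c4) ->
  Num.min x n <= Num.min c1 n + Num.min c2 n + (Num.min c3 n + Num.min c4 n).
Proof.
move=> n0 c10 c20 c30 c40 h.
have : Num.min x n <= n by rewrite ge_min lexx orbT.
have : Num.min x n <= x by rewrite ge_min lexx.
by case: (leP c1 n); case: (leP c2 n); case: (leP c3 n); case: (leP c4 n) => *; lra.
Qed.

End exponential_law.

Section modulus_cost.
Context (R : realType) (beta : R -> R) (to : R).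
Hypotheses (hbeta : cost_function beta) (hconv : convex_cost beta)
  (hto : 0 < to) (hzero : [set t | 0 <= t /\ beta t = 0] = `[0, to]%classic).
Local Notation B2 := (cost_inv beta 2).

(** If the cost does not vanish then y > 9 * B2.  As beta B2 = 2, star-shapedness
    gives s >= beta y >= 2 * y / B2 > 18, so that the left-hand side, which is at
    most 8 * s / 9, is at most s - 2. *)
Lemma cost_at_scale s y : 0 < s -> 0 <= y -> y <= cost_inv beta s ->
  8 * beta (to / (9 * B2) * y) <= Num.max 0 (s - 2).
Proof.
have to0 := hto; move=> s0 y0 yB.
have [B2to bB2] : to < B2 /\ beta B2 = 2 by exact: (cost_invP hbeta).
have [Bsto bBs] := cost_invP hbeta hconv hto hzero s0.
have h9 : 0 < 9 * B2 by lra.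
set t := to / (9 * B2).
have t0 : 0 <= t by rewrite divr_ge0; lra.
have t9 : t <= 9^-1 by rewrite /t ler_pdivrMr//; lra.
have [le_to|lt_to] := leP (t * y) to.
  rewrite (cost_eq0 hzero) ?mulr0//; first by rewrite le_max lexx.
  exact: mulr_ge0.
have y9 : 9 * B2 < y.
  move: lt_to; rewrite /t mulrAC ltr_pdivlMr// ltr_pM2l//.
have ys : beta y <= s by rewrite -bBs; exact: (cost_le hbeta).
have s18 : 18 <= s.
  have : beta (B2 / y * y) <= B2 / y * beta y.
    by apply: (cost_star hbeta hconv) => //; rewrite ?divr_ge0 ?ler_pdivrMr//; lra.
  rewrite divfK ?gt_eqF//; last by lra.
  rewrite bB2 mulrAC ler_pdivlMr; last by lra.
  by nra.
have : beta (t * y) <= t * beta y by apply: (cost_star hbeta hconv) => //; lra.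
have by0 : 0 <= beta y by exact: (cost_nonneg hbeta).
by move=> h; rewrite le_max; apply/orP; right; nra.
Qed.

(** With s the distance between v and w on the exponential scale, the cost is at
    most (s - 2)_+ by cost_at_scale, and s is at most the sum of two logarithmic
    distances (expquant_dist).  Each of them accounts for one unit of the 2 and for
    two of the four terms. *)
Lemma modulus_cost_clog (mu : probability R R) d n (v w : R) :
  0 < d -> Umap_modulus mu beta d -> 0 < v -> v < 1 -> 0 < w -> w < 1 ->
  Num.min (8 * beta (d * (to / (9 * B2)) * `|quant mu v - quant mu w|)) n%:R
  <= clog n v w + clog n w v + (clog n (1 - v) (1 - w) + clog n (1 - w) (1 - v)).
Proof.
have to0 := hto; move=> d0 hU v0 v1 w0 w1.
have v1' : 0 < 1 - v by lra.
have w1' : 0 < 1 - w by lra.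
rewrite !clog_minE//.
have m0 (x : R) : 0 <= Num.max 0 x by rewrite le_max lexx.
have m1 (x : R) : x <= Num.max 0 x by rewrite le_max lexx orbT.
apply: min_sum4 => //.
set a := d * _.
(* The modulus says nothing about equal arguments, where the cost is 0. *)
have [vw|vw] := eqVneq (expquant v) (expquant w) ; last first.
  have := hU _ _ vw.
  rewrite !UmapE !expquantK//.
  set D := `|_ - _|; set s := `|_ - _| => hD.
  have s0 : 0 < s by rewrite normr_gt0 subr_eq0.
  have dD : d * D <= cost_inv beta s by rewrite mulrC -ler_pdivlMr// mulrC.
  have := cost_at_scale s0 (mulr_ge0 (ltW d0) (normr_ge0 _)) dD.
  rewrite mulrA (mulrC _ d) -/a => h; apply: le_trans h _.
  have := expquant_dist v0 v1 w0 w1; rewrite -/s.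
  have ab (x : R) : `|x| - 1 <= Num.max 0 (x - 1) + Num.max 0 (- x - 1).
    have := m0 (x - 1); have := m0 (- x - 1); have := m1 (x - 1); have := m1 (- x - 1).
    by case: (ger0P x); lra.
  have := ab (ln v - ln w); have := ab (ln (1 - v) - ln (1 - w)).
  have := m0 (ln v - ln w - 1); have := m0 (ln w - ln v - 1).
  have := m0 (ln (1 - v) - ln (1 - w) - 1); have := m0 (ln (1 - w) - ln (1 - v) - 1).
  rewrite !opprB; case: (leP 0 (s - 2)) => _ *; lra.
have <- : v = w by rewrite -(expquantK v0 v1) vw expquantK.
by rewrite subrr normr0 mulr0 (cost0 hbeta) mulr0 addr_ge0// addr_ge0.
Qed.

End modulus_cost.

(** * From the modulus of the quantile map to transport-entropy *)

Section density_change_of_variables.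
Context (R : realType) (mu nu : probability R R) (h : R -> R).
Hypothesis hd : has_density nu mu h.
Local Notation q := (quant mu).
Local Notation k := (h \o q).

Let mh : measurable_fun setT h. Proof. by case: hd. Qed.
Let h0 x : 0 <= h x. Proof. by case: hd => _ + _; apply. Qed.
Let mq : measurable_fun setT q. Proof. exact: measurable_quant. Qed.
Let mk : measurable_fun setT k. Proof. exact: measurableT_comp. Qed.

Let density_preimage B : measurable B ->
  nu B = (\int[unif R]_(v in q @^-1` B) (k v)%:E)%E.
Proof.
move=> mB; have mhB : measurable_fun setT ((EFin \o h) \_ B).
  by apply/measurable_restrict => //; apply/measurable_EFinP; exact: measurable_funTS.
case: hd => _ _ ->//.
transitivity (\int[law (unif R) mq]_(x in B) (h x)%:E)%E.
  by apply: eq_measure_integral => A mA _; apply/esym; exact: law_quant.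
rewrite integral_mkcond ge0_integral_law//; last first.
  by move=> x; rewrite patchE; case: ifP; rewrite // lee_fin.
rewrite [RHS]integral_mkcond; apply: eq_integral => v _.
rewrite !patchE.
by rewrite (_ : (v \in q @^-1` B) = (q v \in B))//; apply/idP/idP; rewrite !inE.
Qed.

(** Take for rho the law with density h o q: as q maps the uniform law to mu, it maps
    rho to nu, and h o q has under rho the same law as h under nu. *)
Lemma quantile_density : exists rho : probability R R,
  [/\ rho `<< unif R, forall B, measurable B -> rho (q @^-1` B) = nu B &
   rel_entropy rho (unif R) = rel_entropy nu mu].
Proof.
have k1 : (\int[unif R]_v (k v)%:E = 1)%E.
  transitivity (nu setT); last exact: probability_setT.
  by rewrite density_preimage// preimage_setT.
have [rho hrho] := density_prob mk (fun v => h0 (q v)) k1.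
have rhoE B : measurable B -> rho (q @^-1` B) = nu B.
  move=> mB; case: hrho => _ _ ->; first by rewrite -density_preimage.
  exact: (measurable_preimage mq).
exists rho; split => //; first exact: density_dominates hrho.
rewrite (density_entropy hrho) (density_entropy hd).
transitivity (\int[law rho mq]_x lne (h x)%:E)%E.
  by rewrite integral_law//; exact: measurable_lne_EFin.
by apply: eq_measure_integral => A mA _; (exact: rhoE || exact: (esym (rhoE A mA))).
Qed.

End density_change_of_variables.

Section transport_entropy_of_modulus.
Context (R : realType) (beta : R -> R) (to : R).
Hypotheses (hbeta : cost_function beta) (hconv : convex_cost beta)
  (hto : 0 < to) (hzero : [set t | 0 <= t /\ beta t = 0] = `[0, to]%classic).

(** The coupling is the law of (q v, q (S v)) for v uniform, with q the quantile
    function of mu and S that of rho. *)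
Lemma transport_entropy_of_modulus (mu : probability R R) d :
  0 < d -> Umap_modulus mu beta d ->
  transport_entropy mu (dilate (d * (to / (9 * cost_inv beta 2))) beta).
Proof.
have to0 := hto; move=> d0 hU nu.
set a := d * _.
have a0 : 0 < a.
  have [B2to _] := cost_invP hbeta hconv hto hzero (ltr0Sn R 1).
  by rewrite mulr_gt0// divr_gt0; lra.
have [numu|numu] := pselect (nu `<< mu); last first.
  by rewrite /rel_entropy asboolF// leey.
have [h hd] := has_density_ex numu.
have [rho [hdom rhoE <-]] := quantile_density hd.
have hr := quantile_rearrangement hdom.
set S := quant rho in hr *; set q := quant mu in rhoE *.
have mq : measurable_fun setT q by exact: measurable_quant.
have mS : measurable_fun setT S by exact: measurable_quant.
have mqS : measurable_fun setT (q \o S) by exact: measurableT_comp.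
have mpair : measurable_fun setT (fun v => (q v, (q \o S) v)) by exact: measurable_fun_pair.
have cpl : coupling mu nu (law (unif R) mpair).
  split => A mA.
  - transitivity (law (unif R) mq A); last exact: law_quant.
    transitivity (unif R (q @^-1` A)) => //.
    by congr (unif R _); apply/seteqP; split => v //= [].
  - rewrite -rhoE// (rearr_law hr); last exact: (measurable_preimage mq).
    by congr (unif R _); apply/seteqP; split => v //= [].
have mdist : measurable_fun setT (fun v => `|q v - q (S v)|).
  apply: measurableT_comp; first exact: normr_measurable.
  exact: measurable_funB.
have mF : measurable_fun setT (fun z : R * R => (dilate a beta `|z.1 - z.2|)%:E).
  apply/measurable_EFinP; apply: measurable_cost_comp => //.
  apply: measurableT_comp; first exact: normr_measurable.
  exact: measurable_funB.
have F0 (z : R) : 0 <= beta (a * `|z|).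
  by apply: (cost_ge0 hbeta); rewrite mulr_ge0// ltW.
apply: le_trans (ereal_inf_lbound _) _; first by exists (law (unif R) mpair).
rewrite ge0_integral_law//=; last by move=> z; rewrite lee_fin; exact: F0.
rewrite -(@lee_pmul2l _ 8%:E)// -ge0_integralZl//; last 2 first.
- by apply/measurable_EFinP; exact: measurable_cost_comp.
- by move=> v _; rewrite lee_fin; exact: F0.
have mf : measurable_fun setT (fun v => 8 * beta (a * `|q v - q (S v)|)).
  by apply: measurable_funM => //; exact: measurable_cost_comp.
have f0 v : 0 <= 8 * beta (a * `|q v - q (S v)|) by rewrite mulr_ge0.
apply: (ge0_integral_truncate mf f0) => n.
have c0 (x y : R) : 0 <= clog n `|x| `|y|.
  by case/andP: (@clog_itv _ n _ _ (normr_ge0 x) (normr_ge0 y)).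
apply: le_trans (rearr_cost hr n).
apply: ae_unif_ge0_le.
- by apply/measurable_EFinP; exact: measurable_minr.
- apply/measurable_EFinP; apply: measurable_funD.
    by apply: measurable_funD; apply: measurable_clog; apply: measurableT_comp => //;
      exact: normr_measurable.
  by apply: measurable_funD; apply: measurable_clog; apply: measurableT_comp;
    rewrite //; (exact: normr_measurable || exact: measurable_funB).
- by move=> v; rewrite lee_fin le_min f0/=.
- by move=> v; rewrite lee_fin !addr_ge0.
move=> v v0 v1; have [S0 S1] := rearr_itv hr v0 v1.
rewrite lee_fin; apply: le_trans (modulus_cost_clog hbeta hconv hto hzero n d0 hU v0 v1 S0 S1) _.
by rewrite !ger0_norm//; lra.
Qed.

Lemma weak_transport_entropy_of_modulus (mu : probability R R) d :
  finite_first_moment mu -> 0 < d -> Umap_modulus mu beta d ->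
  weak_transport_entropy mu (dilate (d * (to / (9 * cost_inv beta 2))) beta).
Proof.
have to0 := hto; move=> mu1 d0 hU.
have [B2to _] := cost_invP hbeta hconv hto hzero (ltr0Sn R 1).
apply: weak_transport_entropy_of_transport_entropy => //.
  by rewrite mulr_gt0// divr_gt0; lra.
exact: transport_entropy_of_modulus.
Qed.

End transport_entropy_of_modulus.

(** * Exponential tails from weak transport-entropy *)

Section weak_duality.
Context (R : realType) (beta : R -> R).
Hypotheses (hbeta : cost_function beta) (hconv : convex_cost beta).

(** In each fibre, the bound on f x is used at the barycentre of p x, and h is moved
    inside the kernel by Jensen's inequality, so as to integrate to its Q-mean.
    The function psi localizes the barycentres: its p x-integral vanishes for
    almost every x, hence so does its value at the barycentre. *)
Lemma weak_transport_duality a (P Q : probability R R) (f h psi : R -> R) (C : R) :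
  0 < a -> finite_first_moment Q ->
  measurable_fun setT f -> (forall x, 0 <= f x) ->
  convexR h -> (forall y, 0 <= h y) -> measurable_fun setT h ->
  convexR psi -> (forall y, 0 <= psi y) -> measurable_fun setT psi ->
  (\int[Q]_y (psi y)%:E = 0)%E -> (\int[Q]_y (h y)%:E <= C%:E)%E ->
  (forall x y, psi y = 0 -> f x <= h y + dilate a beta `|x - y|) ->
  (\int[P]_x (f x)%:E <= C%:E + weak_transport_cost (dilate a beta) Q P)%E.
Proof.
move=> a0 Q1 mf f0 ch h0 mh cpsi psi0 mpsi psiQ hC fh.
rewrite -leeBlDl//; apply: le_ereal_inf_tmp => _ [pi [p [cpl dis ->]]].
rewrite leeBlDl//.
have nuE := coupling_mixture cpl dis.
set mean := fun x => (\int[p x]_y y)%R.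
have mc : measurable_fun setT (fun x : R => dilate a beta `|x - mean x|).
  apply: measurable_cost_comp => //.
  apply: measurableT_comp; first exact: normr_measurable.
  by apply: measurable_funB => //; exact: measurable_kernel_mean.
have c0 (x : R) : 0 <= dilate a beta `|x - mean x|.
  by apply: (cost_ge0 hbeta); rewrite mulr_ge0// ltW.
have mI (g : R -> R) : measurable_fun setT g -> (forall y, 0 <= g y) ->
    measurable_fun setT (fun x : R => \int[p x]_y (g y)%:E)%E.
  move=> mg g0; apply: measurable_fun_integral_kernel => //.
  - exact: measurable_kernel.
  - exact/measurable_EFinP.
have I0 (g : R -> R) x : (forall y, 0 <= g y) -> (0 <= \int[p x]_y (g y)%:E)%E.
  by move=> g0; apply: integral_ge0 => y _; rewrite lee_fin.
apply: (@le_trans _ _ (\int[P]_x (\int[p x]_y (h y)%:E +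
    (dilate a beta `|x - mean x|)%:E))%E); last first.
  rewrite ge0_integralD//; last 4 first.
  - by move=> x _; exact: I0.
  - exact: mI.
  - by move=> x _; rewrite lee_fin.
  - exact/measurable_EFinP.
  apply: leeD => //; rewrite -(ge0_integral_mixture nuE)//.
  exact/measurable_EFinP.
have ipsi : {ae P, forall x, \int[p x]_y (psi y)%:E = 0}%E.
  have [+ _] := ae_eq_integral_abs P measurableT (mI psi mpsi psi0); case.
    rewrite -[RHS]psiQ (ge0_integral_mixture nuE)//; last exact/measurable_EFinP.
    by apply: eq_integral => x _; rewrite gee0_abs// I0.
  move=> N [mN N0 hN]; exists N; split => // x hx; apply: hN => h1; apply: hx.
  exact: h1.
apply: ae_ge0_le_integral => //.
- by move=> x _; rewrite lee_fin.
- exact/measurable_EFinP.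
- by move=> x _; rewrite adde_ge0 ?I0// lee_fin.
- by apply: emeasurable_funD; [exact: mI|exact/measurable_EFinP].
apply: filterS2 (kernel_mean_ae nuE Q1) ipsi => x ix ipx _.
have psi_mean : psi (mean x) = 0.
  have := kernel_jensen cpsi psi0 mpsi ix; rewrite ipx lee_fin -/(mean x) => le0.
  by apply/eqP; rewrite eq_le le0 psi0.
apply: le_trans (leeD (kernel_jensen ch h0 mh ix) (lexx _)).
by rewrite -EFinD lee_fin fh.
Qed.

End weak_duality.

Lemma density_first_moment (R : realType) (nu mu : probability R R) (k : R -> R) (M : R) :
  has_density nu mu k -> (forall x, k x <= M) ->
  finite_first_moment mu -> finite_first_moment nu.
Proof.
move=> hk kM; rewrite /finite_first_moment => mu1.
have mabs : measurable_fun setT (fun y : R => `|y|%:E).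
  by apply/measurable_EFinP; exact: normr_measurable.
have mk : measurable_fun setT (EFin \o k) by apply/measurable_EFinP; case: hk.
have k0 x : 0 <= k x by case: hk.
have M0 : 0 <= M by apply: le_trans (kM 0).
rewrite (density_integral hk)//.
apply: (@le_lt_trans _ _ (\int[mu]_x (M%:E * `|x|%:E))%E); last first.
  by rewrite ge0_integralZl// lte_mul_pinfty// lee_fin.
apply: ge0_le_integral => //.
- by move=> x _; rewrite mule_ge0// lee_fin.
- exact: emeasurable_funM.
- exact: emeasurable_funM.
- by move=> x _; rewrite muleC -!EFinM lee_fin ler_wpM2r.
Qed.

(** phi stands for the distance to a closed half-line A, the zero set of phi, and
    alpha for the mass of A. *)
Section exponential_concentration.
Context (R : realType) (beta : R -> R).
Hypotheses (hbeta : cost_function beta) (hconv : convex_cost beta).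
Variables (mu : probability R R) (a : R) (phi : R -> R).
Hypotheses (mu1 : finite_first_moment mu) (a0 : 0 < a)
  (wte : weak_transport_entropy mu (dilate a beta)).
Hypotheses (cphi : convexR phi) (phi0 : forall x, 0 <= phi x)
  (phi_lip : forall x y, phi x <= phi y + `|x - y|).
Local Notation A := [set u | phi u = 0].
Local Notation alpha := (fine (mu A)).
Hypothesis mphi : measurable_fun setT phi.
Hypothesis half_mass : ((2^-1)%:E <= mu A)%E.
Local Notation theta := (dilate a beta).

Let mA : measurable A.
Proof. by rewrite -[X in measurable X]setTI; exact: (mphi measurableT (measurable_set1 0)). Qed.

Let muA : mu A = alpha%:E. Proof. by rewrite fineK// fin_num_measure. Qed.
Let half : 2^-1 <= alpha. Proof. by rewrite -lee_fin -muA. Qed.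
Let alpha0 : 0 < alpha. Proof. by have := half; lra. Qed.
Let alpha1 : alpha <= 1.
Proof. by rewrite -lee_fin -muA probability_le1. Qed.

Let theta_phi_convex : convexR (fun y => theta (phi y)).
Proof. exact: (convexR_cost_comp hbeta hconv a0 cphi). Qed.

Let theta_phi_meas : measurable_fun setT (fun y => theta (phi y)).
Proof. exact: (measurable_cost_comp hbeta a0). Qed.

Let theta_phi0 y : 0 <= theta (phi y).
Proof. by apply: (cost_ge0 hbeta); rewrite mulr_ge0// ltW. Qed.

(** Compare mu with its conditioning nu on A, of entropy at most - ln alpha.  The
    barycentres of kernels that send mu to nu lie in A, and phi x <= |x - y| for
    y in A. *)
Lemma integral_cost_enlargement : (\int[mu]_x (theta (phi x))%:E <= (- ln alpha)%:E)%E.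
Proof.
pose k (x : R) : R := if phi x == 0 then alpha^-1 else 0.
have mk : measurable_fun setT k.
  apply: measurable_fun_ifT => //.
  exact: (measurable_fun_eqr mphi).
have k0 x : 0 <= k x by rewrite /k; case: ifP => // _; rewrite invr_ge0 ltW.
have kA : (fun x => (k x)%:E) = (fun x => (alpha^-1)%:E * (\1_A x)%:E)%E.
  apply/funext => x; rewrite /k indicE -EFinM; case: ifPn => /eqP px.
    by rewrite mem_set// mulr1.
  by rewrite memNset// mulr0.
have k1 : (\int[mu]_x (k x)%:E = 1)%E.
  rewrite kA ge0_integralZl//; last 2 first.
  - by apply/measurable_EFinP.
  - by rewrite lee_fin invr_ge0 ltW.
  rewrite integral_indic// setIT; transitivity (alpha^-1%:E * alpha%:E)%E.
    by rewrite -muA.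
  by rewrite -EFinM mulVf// gt_eqF.
have [nu hk] := density_prob mk k0 k1.
have nu1 : finite_first_moment nu.
  apply: (density_first_moment hk _ mu1) => x.
  by rewrite /k; case: ifP => // _; rewrite invr_ge0 ltW.
have [ent _] := wte nu1.
have nuphi : (\int[nu]_x (phi x)%:E = 0)%E.
  rewrite (density_integral hk); last 2 first.
  - exact/measurable_EFinP.
  - by move=> x; rewrite lee_fin.
  apply: integral0_eq => x _; rewrite -EFinM /k.
  by case: eqP => [->|]; rewrite ?mul0r ?mulr0.
have Hle : (rel_entropy nu mu <= (- ln alpha)%:E)%E.
  rewrite (density_entropy_pln hk) -[leRHS](prob_cst nu).
  have ln0 : 0 <= - ln alpha by rewrite oppr_ge0 ln_le0.
  have pE x : pln k x = if phi x == 0 then - ln alpha else 0.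
    rewrite /pln /k; case: eqP => _; last by rewrite ltxx.
    by rewrite invr_gt0 alpha0 lnV// posrE.
  apply: ge0_le_integral => //.
  - by move=> x _; rewrite lee_fin pE; case: ifP.
  - by apply/measurable_EFinP; exact: measurable_pln.
  - by move=> x _; rewrite lee_fin pE; case: ifP.
have c0 : convexR (fun _ : R => 0 : R) by move=> x y t _ _; rewrite !mulr0 addr0.
have dual : (\int[mu]_x (theta (phi x))%:E <= 0%:E + weak_transport_cost theta nu mu)%E.
  apply: (@weak_transport_duality _ _ hbeta a mu nu (fun x => theta (phi x))
    (fun=> 0) phi 0) => //.
  - by rewrite integral0.
  - move=> x y py; rewrite add0r; apply: (cost_le hbeta hconv).
      by rewrite mulr_ge0// ltW.
    by rewrite ler_pM2l//; have := phi_lip x y; rewrite py add0r.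
apply: (le_trans dual); rewrite add0e; exact: le_trans ent Hle.
Qed.

Let G u := 2 * beta (a / 2 * phi u).

Let a2 : 0 < a / 2. Proof. by rewrite divr_gt0. Qed.

Let mG : measurable_fun setT G.
Proof. by apply: measurable_funM => //; exact: (measurable_cost_comp hbeta a2). Qed.

Let G0 u : 0 <= G u.
Proof. by rewrite mulr_ge0//; apply: (cost_ge0 hbeta); rewrite mulr_ge0// ltW. Qed.

(** Convexity at the midpoint of a * phi y and a * |x - y|. *)
Let G_le x y : G x <= theta (phi y) + theta `|x - y|.
Proof.
rewrite /G /dilate.
have p0 : 0 <= a * phi y by rewrite mulr_ge0// ltW.
have d0 : 0 <= a * `|x - y| by rewrite mulr_ge0// ltW.
have := cost_midpoint hconv p0 d0.
have : beta (a / 2 * phi x) <= beta ((a * phi y + a * `|x - y|) / 2).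
  apply: (cost_le hbeta hconv); first by rewrite mulr_ge0// ltW.
  by rewrite -mulrDr mulrAC ler_pM2r// ler_pM2l.
by lra.
Qed.

(** Let nu have the density e^g / z with respect to mu, with g the truncated
    exponent.  By duality and G_le, the nu-mean of g is at most - ln alpha plus the
    entropy of nu, which is this same mean minus ln z.  Hence ln z <= - ln alpha.
    The truncation makes this mean finite, so that it may be cancelled. *)
Lemma integral_exp_truncated n :
  (\int[mu]_u (expR (Num.min (G u) n%:R))%:E <= (alpha^-1)%:E)%E.
Proof.
pose g u := Num.min (G u) n%:R.
have g0 u : 0 <= g u by rewrite le_min G0/=.
have gn u : g u <= n%:R by rewrite ge_min lexx orbT.
have mg : measurable_fun setT g by exact: measurable_minr.
have meg : measurable_fun setT (fun u => expR (g u)) by exact: measurable_expR_comp.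
rewrite -/(g _); set I := (\int[mu]_u (expR (g u))%:E)%E.
have I1 : (1 <= I)%E.
  rewrite -[leLHS](prob_cst mu); apply: ge0_le_integral => //.
  - exact/measurable_EFinP.
  - by move=> u _; rewrite lee_fin -expR0 ler_expR.
have In : (I <= (expR n%:R)%:E)%E.
  rewrite -[leRHS](prob_cst mu); apply: ge0_le_integral => //.
  - exact/measurable_EFinP.
  - by move=> u _; rewrite lee_fin ler_expR.
have [z IE] : exists z, I = z%:E.
  by case: (I) I1 In => [z| |]//; exists z.
rewrite IE; have z1 : 1 <= z by rewrite -lee_fin -IE.
have z0 : 0 < z by lra.
pose k u := expR (g u) / z.
have mk : measurable_fun setT k by exact: measurable_funM.
have k0 u : 0 <= k u by rewrite divr_ge0 ?expR_ge0 ?ltW.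
have k1 : (\int[mu]_x (k x)%:E = 1)%E.
  rewrite /k; under eq_integral do rewrite mulrC EFinM.
  rewrite ge0_integralZl//; last 2 first.
  - exact/measurable_EFinP.
  - by rewrite lee_fin invr_ge0 ltW.
  by rewrite -/I IE -EFinM mulVf// gt_eqF.
have [nu hk] := density_prob mk k0 k1.
have nu1 : finite_first_moment nu.
  apply: (density_first_moment hk (M := expR n%:R) _ mu1) => u.
  rewrite ler_pdivrMr//; apply: (@le_trans _ _ (expR n%:R)); first by rewrite ler_expR.
  by rewrite ler_peMr// expR_ge0.
have [_ ent] := wte nu1.
have ig : nu.-integrable setT (EFin \o g).
  by apply: (@integrable_bounded _ _ _ nu g n%:R) => // u; rewrite ger0_norm.
have ic (c : R) : nu.-integrable setT (EFin \o cst c).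
  exact: (@integrable_bounded _ _ _ nu (cst c) `|c|).
have HE : rel_entropy nu mu = (\int[nu]_u (g u)%:E - (ln z)%:E)%E.
  rewrite (density_entropy_pln hk) -[X in (_ - X)%E](prob_cst nu).
  rewrite -(integralB_EFin measurableT ig (ic (ln z))).
  apply: eq_integral => u _; rewrite -EFinB /pln /k divr_gt0 ?expR_gt0//.
  by rewrite ln_div ?posrE ?expR_gt0// expRK.
have c0 : convexR (fun _ : R => 0 : R) by move=> x y t _ _; rewrite !mulr0 addr0.
have dual : (\int[nu]_u (g u)%:E <= (- ln alpha)%:E + weak_transport_cost theta mu nu)%E.
  apply: (@weak_transport_duality _ _ hbeta a nu mu g (fun y => theta (phi y))
    (fun=> 0) (- ln alpha)) => //.
  - by rewrite integral0.
  - exact: integral_cost_enlargement.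
  - by move=> x y _; apply: le_trans (G_le x y); rewrite ge_min lexx.
have := le_trans dual (leeD2l _ ent); rewrite HE.
have : (\int[nu]_u (g u)%:E)%E \is a fin_num by exact: integrable_fin_num ig.
case: (\int[nu]_u (g u)%:E)%E => // r _.
rewrite -EFinB -EFinD !lee_fin => h.
by rewrite -(@ler_ln _ z) ?posrE ?invr_gt0// lnV ?posrE//; lra.
Qed.

Lemma integral_exp_cost : (\int[mu]_u (expR (G u))%:E <= (alpha^-1)%:E)%E.
Proof.
apply: ge0_integral_truncate.
- exact: measurable_expR_comp.
- by move=> u; exact: expR_ge0.
move=> n; apply: le_trans (integral_exp_truncated n).
apply: ge0_le_integral => //.
- by apply/measurable_EFinP; apply: measurable_minr => //; exact: measurable_expR_comp.
- by apply/measurable_EFinP; apply: measurable_expR_comp; exact: measurable_minr.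
- move=> u _; rewrite lee_fin; case: (leP (G u) n%:R) => Gn.
    by rewrite ge_min lexx.
  rewrite ge_min; apply/orP; right.
  by have := expR_ge1Dx (n%:R : R); lra.
Qed.

(** On A the integrand is 1, which leaves alpha^-1 - alpha for the complement, and
    alpha^-1 - alpha <= 3 * (1 - alpha) as alpha >= 1/2. *)
Lemma integral_exp_tail :
  (\int[mu]_(u in ~` A) (expR (beta (a / 2 * phi u)))%:E <= 3%:E * mu (~` A))%E.
Proof.
have mnA : measurable (~` A) by exact: measurableC.
have meG : measurable_fun setT (fun u => (expR (G u))%:E).
  by apply/measurable_EFinP; exact: measurable_expR_comp.
apply: (@le_trans _ _ (\int[mu]_(u in ~` A) (expR (G u))%:E)%E).
  apply: ge0_le_integral => //.
  - apply: measurable_funTS; apply/measurable_EFinP; apply: measurable_expR_comp.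
    exact: (measurable_cost_comp hbeta a2).
  - exact: measurable_funTS.
  - move=> u _; rewrite lee_fin ler_expR /G.
    by have := G0 u; rewrite /G; lra.
have := integral_exp_cost; rewrite -(setUv A) ge0_integral_setU//; last 2 first.
- by rewrite setUv.
- by rewrite disj_set2E setICr.
have -> : (\int[mu]_(u in A) (expR (G u))%:E = alpha%:E)%E.
  rewrite -muA -[RHS]mul1e -integral_cst//; apply: eq_integral => u; rewrite inE => pu.
  by rewrite /G pu mulr0 (cost0 hbeta) mulr0 expR0.
rewrite probability_setC// muA -EFinB -EFinM.
case: (\int[mu]_(u in _) _)%E => [r| |]//=; last by move=> _; rewrite leNye.
rewrite -EFinD !lee_fin => h.
have : alpha^-1 <= alpha + 3 * (1 - alpha).
  rewrite -(ler_pM2l alpha0) mulfV ?gt_eqF//; have := half; have := alpha1; nra.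
by lra.
Qed.

End exponential_concentration.

Section half_lines.
Context (R : realType) (beta : R -> R).
Hypotheses (hbeta : cost_function beta) (hconv : convex_cost beta).

(** beta is only measurable on the half-line, so the argument is replaced by its
    positive part, which agrees with it on A. *)
Lemma measurable_exp_cost (b s x : R) (A : set R) : 0 < b -> measurable A ->
  (forall u, A u -> 0 <= s * (u - x)) ->
  measurable_fun A (fun u => expR (beta (b * (s * (u - x))))).
Proof.
move=> b0 mA As.
pose g u := Num.max 0 (s * (u - x)).
apply: (@eq_measurable_fun _ _ _ _ _ (fun u => expR (beta (b * g u)))).
  by move=> u; rewrite inE => /As h; rewrite /g max_r.
apply: measurable_funTS; apply: measurable_expR_comp.
apply: (measurable_cost_comp hbeta b0) => [u|]; first by rewrite /g le_max lexx.
apply: measurable_maxr => //; apply: measurable_funM => //.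
exact: measurable_funB.
Qed.

(** s = 1 and s = - 1 give the two kinds of half-lines. *)
Lemma integral_exp_half_line (mu : probability R R) (a s x : R) : `|s| = 1 ->
  finite_first_moment mu -> 0 < a -> weak_transport_entropy mu (dilate a beta) ->
  ((2^-1)%:E <= mu [set u | (s * (u - x) <= 0)%R])%E ->
  (\int[mu]_(u in [set u | (0 < s * (u - x))%R])
      (expR (beta (a / 2 * (s * (u - x)))))%:E <=
   3%:E * mu [set u | (0 < s * (u - x))%R])%E.
Proof.
move=> s1 mu1 a0 wte half.
pose phi (u : R) : R := Num.max 0 (s * (u - x)).
have le_phi u : s * (u - x) <= phi u by rewrite le_max lexx orbT.
have phi0 u : 0 <= phi u by rewrite le_max lexx.
have phiA : [set u | phi u = 0] = [set u | s * (u - x) <= 0].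
  by apply/seteqP; split => u /=; rewrite /phi; [move=> <-|move=> h; rewrite max_l].
have phiAC : ~` [set u | phi u = 0] = [set u | 0 < s * (u - x)].
  by rewrite phiA; apply/seteqP; split => u /=; rewrite ltNge => /negP.
have cphi : convexR phi.
  move=> y z t t0 t1; rewrite {1}/phi ge_max; apply/andP; split.
    by rewrite addr_ge0// mulr_ge0// subr_ge0.
  have -> : s * (t * y + (1 - t) * z - x) =
            t * (s * (y - x)) + (1 - t) * (s * (z - x)) by ring.
  by rewrite lerD// ler_wpM2l// subr_ge0.
have phi_lip y z : phi y <= phi z + `|y - z|.
  rewrite {1}/phi ge_max; apply/andP; split; first by rewrite addr_ge0.
  have -> : s * (y - x) = s * (z - x) + s * (y - z) by ring.
  by rewrite lerD// (le_trans (ler_norm _))// normrM s1 mul1r.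
have mphi : measurable_fun setT phi.
  apply: measurable_maxr => //; apply: measurable_funM => //.
  exact: measurable_funB.
rewrite -phiA in half.
have := integral_exp_tail hbeta hconv mu1 a0 wte cphi phi0 phi_lip mphi half.
rewrite phiAC; apply: le_trans; rewrite le_eqVlt; apply/orP; left; apply/eqP.
by apply: eq_integral => u; rewrite inE/= => us; rewrite /phi max_r// ltW.
Qed.

(** The bound of Kplus and Kminus by K, in a form without quotients. *)
Definition exp_tail_bound (mu : probability R R) (m b K : R) : Prop :=
  (forall x, m <= x -> (\int[mu]_(u in `]x, +oo[) (expR (beta (b * (u - x))))%:E <=
     K%:E * mu `]x, +oo[%classic)%E) /\
  (forall x, x <= m -> (\int[mu]_(u in `]-oo, x[) (expR (beta (b * (x - u))))%:E <=
     K%:E * mu `]-oo, x[%classic)%E).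

Lemma exp_tail_bound_of_weak_transport_entropy (mu : probability R R) (m a : R) :
  finite_first_moment mu -> is_median mu m -> 0 < a ->
  weak_transport_entropy mu (dilate a beta) -> exp_tail_bound mu m (a / 2) 3.
Proof.
move=> mu1 [mlo mhi] a0 wte.
have n1 : `|-1| = 1 :> R by rewrite normrN normr1.
split => x hx.
- have := @integral_exp_half_line mu a 1 x (normr1 _) mu1 a0 wte.
  have -> : [set u | 0 < 1 * (u - x)] = `]x, +oo[%classic.
    by apply/seteqP; split => u /=; rewrite in_itv/= andbT mul1r subr_gt0.
  have -> : [set u | 1 * (u - x) <= 0] = `]-oo, x]%classic.
    by apply/seteqP; split => u /=; rewrite in_itv/= mul1r subr_le0.
  under eq_integral do rewrite mul1r.
  apply; apply: le_trans mlo _; apply: le_measure; rewrite ?inE//.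
  by move=> u /=; rewrite !in_itv/= => um; exact: le_trans hx.
- have := @integral_exp_half_line mu a (-1) x n1 mu1 a0 wte.
  have -> : [set u | 0 < -1 * (u - x)] = `]-oo, x[%classic.
    by apply/seteqP; split => u /=; rewrite in_itv/= mulN1r oppr_gt0 subr_lt0.
  have -> : [set u | -1 * (u - x) <= 0] = `[x, +oo[%classic.
    by apply/seteqP; split => u /=; rewrite in_itv/= andbT mulN1r oppr_le0 subr_ge0.
  under eq_integral do rewrite mulN1r opprB.
  apply; apply: le_trans mhi _; apply: le_measure; rewrite ?inE//.
  by move=> u /=; rewrite !in_itv/= !andbT; exact: le_trans.
Qed.

Let quotient_le (mu : probability R R) (A : set R) (f : R -> R) (K : R) :
  measurable A -> (forall u, A u -> 0 <= f u) ->
  measurable_fun A f -> 0 <= K ->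
  ((mu A)^-1 * \int[mu]_(u in A) (f u)%:E <= K%:E)%E <->
  (\int[mu]_(u in A) (f u)%:E <= K%:E * mu A)%E.
Proof.
move=> mA f0 mf K0.
have [A0|A0] := eqVneq (mu A) 0%E.
  rewrite null_set_integral//; last exact/measurable_EFinP.
  by rewrite A0 !mule0 lexx lee_fin.
have muE : mu A = (fine (mu A))%:E by rewrite fineK// fin_num_measure.
have r0 : 0 < fine (mu A).
  rewrite lt_neqAle fine_ge0// andbT eq_sym; apply/eqP => h.
  by move: A0; rewrite muE h eqxx.
rewrite muE inver gt_eqF// lee_pdivrMl// muleC.
by rewrite muleC -!EFinM mulrC.
Qed.

Let Kplus_quotient (mu : probability R R) (b K x : R) : 0 < b -> 0 <= K ->
  ((mu `]x, +oo[%classic)^-1 *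
      \int[mu]_(u in `]x, +oo[) (expR (beta (b * (u - x))))%:E <= K%:E)%E <->
  (\int[mu]_(u in `]x, +oo[) (expR (beta (b * (u - x))))%:E <=
     K%:E * mu `]x, +oo[%classic)%E.
Proof.
move=> b0 K0; apply: (@quotient_le mu _ (fun u => expR (beta (b * (u - x)))) K) => //.
rewrite [X in measurable_fun _ X](_ : _ = fun u => expR (beta (b * (1 * (u - x))))).
  by apply: measurable_exp_cost => // u /=; rewrite in_itv/= andbT mul1r subr_ge0 => /ltW.
by apply/funext => u; rewrite mul1r.
Qed.

Let Kminus_quotient (mu : probability R R) (b K x : R) : 0 < b -> 0 <= K ->
  ((mu `]-oo, x[%classic)^-1 *
      \int[mu]_(u in `]-oo, x[) (expR (beta (b * (x - u))))%:E <= K%:E)%E <->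
  (\int[mu]_(u in `]-oo, x[) (expR (beta (b * (x - u))))%:E <=
     K%:E * mu `]-oo, x[%classic)%E.
Proof.
move=> b0 K0; apply: (@quotient_le mu _ (fun u => expR (beta (b * (x - u)))) K) => //.
rewrite [X in measurable_fun _ X](_ : _ = fun u => expR (beta (b * (-1 * (u - x))))).
  by apply: measurable_exp_cost => // u /=; rewrite in_itv/= mulN1r opprB subr_ge0 => /ltW.
by apply/funext => u; rewrite mulN1r opprB.
Qed.

Lemma max_Kplus_Kminus_le (mu : probability R R) (m b K : R) : 0 < b -> 0 <= K ->
  (Order.max (Kplus mu beta m b) (Kminus mu beta m b) <= K%:E)%E <->
  exp_tail_bound mu m b K.
Proof.
move=> b0 K0; rewrite ge_max; split.
- move=> /andP[hp hm]; split => x hx.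
  + apply/(Kplus_quotient mu x b0 K0); apply: le_trans hp.
    by apply: ereal_sup_ubound; exists x => //=; rewrite in_itv/= hx.
  + apply/(Kminus_quotient mu x b0 K0); apply: le_trans hm.
    by apply: ereal_sup_ubound; exists x => //=; rewrite in_itv/= hx.
- move=> [hp hm]; apply/andP; split; apply: ge_ereal_sup; move=> c [x hx <-]; move: hx => /=.
  + rewrite in_itv/= andbT => hx; apply/(Kplus_quotient mu x b0 K0).
    exact: hp.
  + rewrite in_itv/= => hx; apply/(Kminus_quotient mu x b0 K0).
    exact: hm.
Qed.

Lemma max_Kplus_Kminus_fin (mu : probability R R) (m b : R) : 0 < b ->
  (Order.max (Kplus mu beta m b) (Kminus mu beta m b) < +oo)%E ->
  exists K, 1 < K /\ exp_tail_bound mu m b K.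
Proof.
move=> b0 Moo.
have [r hr] : exists r : R,
    (Order.max (Kplus mu beta m b) (Kminus mu beta m b) <= r%:E)%E.
  move: Moo; case: (Order.max _ _) => [r| |]// _; first by exists r.
  by exists 0; rewrite leNye.
have n0 : 0 <= `|r| by [].
exists (2 + `|r|); split; first by lra.
have K0 : 0 <= 2 + `|r| by lra.
apply/(max_Kplus_Kminus_le mu m b0 K0); apply: (le_trans hr).
by rewrite lee_fin; have := ler_norm r; lra.
Qed.

End half_lines.

(** * The modulus of the quantile map from exponential tails *)

Section tail_bound_modulus.
Context (R : realType) (beta : R -> R) (to : R).
Hypotheses (hbeta : cost_function beta) (hconv : convex_cost beta)
  (hto : 0 < to) (hzero : [set t | 0 <= t /\ beta t = 0] = `[0, to]%classic).

Lemma mass_below_quant (mu : probability R R) (w : R) : 0 < w -> w < 1 ->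
  (mu `]-oo, quant mu w[%classic <= w%:E)%E.
Proof.
move=> w0 w1; rewrite -(law_quant mu)//.
apply: (@le_trans _ _ (unif R [set v | v <= w])); last by rewrite unif_ray// ltW.
apply: unif_subset; first exact: (measurable_preimage (measurable_quant mu)).
  exact: measurable_rayc.
move=> v v0 v1 /=; rewrite in_itv/=; apply: contraTT; rewrite -ltNge -leNgt => wv.
by apply: quant_homo => //; exact: ltW.
Qed.

Variables (mu : probability R R) (m b K : R).
Hypotheses (hm : is_median mu m) (b0 : 0 < b) (K1 : 1 < K)
  (tails : exp_tail_bound beta mu m b K).

Let lnK0 : 0 < ln K. Proof. exact: ln_gt0. Qed.

(** Markov's inequality on B, followed by logarithms; the factors 1/2 cancel. *)
Let markov (A B : set R) (f : R -> R) (c p q : R) : measurable A -> measurable B ->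
  B `<=` A -> measurable_fun A f -> (forall u, A u -> 0 <= f u) ->
  (forall u, B u -> expR c <= f u) ->
  (\int[mu]_(u in A) (f u)%:E <= K%:E * mu A)%E ->
  (mu A <= (2^-1 * expR (- p))%:E)%E -> ((2^-1 * expR (- q))%:E <= mu B)%E ->
  c <= ln K + (q - p).
Proof.
move=> mA mB BA mf f0 fB hA Ap Bq.
have K0 : 0 < K by have := K1; lra.
have : (\int[mu]_(u in B) (expR c)%:E <= \int[mu]_(u in A) (f u)%:E)%E.
  apply: (@le_trans _ _ (\int[mu]_(u in B) (f u)%:E)%E).
    apply: ge0_le_integral => //.
    by apply/measurable_EFinP; exact: measurable_funS mf.
  by apply: ge0_subset_integral => //; exact/measurable_EFinP.
rewrite integral_cst// => h1.
have h2 : ((expR c)%:E * (2^-1 * expR (- q))%:E <= K%:E * (2^-1 * expR (- p))%:E)%E.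
  apply: (@le_trans _ _ ((expR c)%:E * mu B)%E); first by rewrite lee_pmul2l// lte_fin expR_gt0.
  apply: (le_trans h1); apply: (le_trans hA).
  by rewrite lee_pmul2l.
move: h2; rewrite -!EFinM lee_fin => h2.
have : expR (c - q) <= expR (ln K - p).
  rewrite !expRD lnK ?posrE//; lra.
by rewrite ler_expR; lra.
Qed.

Lemma upper_tail_cost x y p q : m <= x -> x <= y -> p <= q ->
  (mu `]x, +oo[%classic <= (2^-1 * expR (- p))%:E)%E ->
  ((2^-1 * expR (- q))%:E <= mu `[y, +oo[%classic)%E ->
  beta (b * (y - x)) <= ln K + (q - p).
Proof.
move=> mx xy pq hx hy; have := lnK0.
have [->|nxy] := eqVneq y x.
  by rewrite subrr mulr0 (cost0 hbeta); lra.
have {nxy}xy : x < y by rewrite lt_neqAle eq_sym nxy.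
move=> _; apply: (markov (A := `]x, +oo[%classic) (B := `[y, +oo[%classic)
  (f := fun u => expR (beta (b * (u - x)))) _ _ _ _ _ _ _ hx hy) => //.
- by move=> u /=; rewrite !in_itv/= !andbT; exact: lt_le_trans.
- rewrite [X in measurable_fun _ X](_ : _ = fun u => expR (beta (b * (1 * (u - x))))).
    by apply: (measurable_exp_cost hbeta b0) => // u /=; rewrite in_itv/= andbT mul1r subr_ge0 => /ltW.
  by apply/funext => u; rewrite mul1r.
- move=> u /=; rewrite in_itv/= andbT => yu; rewrite ler_expR.
  apply: (cost_le hbeta hconv); first by rewrite mulr_ge0// ?(ltW b0)// subr_ge0 ltW.
  by rewrite ler_pM2l// lerD2r.
- by case: tails => h _; exact: h.
Qed.

Lemma lower_tail_cost x y p q : y <= m -> x <= y -> p <= q ->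
  (mu `]-oo, y[%classic <= (2^-1 * expR (- p))%:E)%E ->
  ((2^-1 * expR (- q))%:E <= mu `]-oo, x]%classic)%E ->
  beta (b * (y - x)) <= ln K + (q - p).
Proof.
move=> ym xy pq hy hx; have := lnK0.
have [->|nxy] := eqVneq y x.
  by rewrite subrr mulr0 (cost0 hbeta); lra.
have {nxy}xy : x < y by rewrite lt_neqAle eq_sym nxy.
move=> _; apply: (markov (A := `]-oo, y[%classic) (B := `]-oo, x]%classic)
  (f := fun u => expR (beta (b * (y - u)))) _ _ _ _ _ _ _ hy hx) => //.
- by move=> u /=; rewrite !in_itv/= => ux; exact: le_lt_trans xy.
- rewrite [X in measurable_fun _ X](_ : _ = fun u => expR (beta (b * (-1 * (u - y))))).
    by apply: (measurable_exp_cost hbeta b0) => // u /=; rewrite in_itv/= mulN1r opprB subr_ge0 => /ltW.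
  by apply/funext => u; rewrite mulN1r opprB.
- move=> u /=; rewrite in_itv/= => ux; rewrite ler_expR.
  apply: (cost_le hbeta hconv); first by rewrite mulr_ge0// ?(ltW b0)// subr_ge0 ltW.
  by rewrite ler_pM2l// lerD2l lerN2.
- by case: tails => _ h; exact: h.
Qed.

Let rayC (x : R) : mu `]x, +oo[%classic = (1 - mu `]-oo, x]%classic)%E.
Proof. by rewrite -probability_setC// setCitvl. Qed.

Let rayC' (x : R) : mu `[x, +oo[%classic = (1 - mu `]-oo, x[%classic)%E.
Proof. by rewrite -probability_setC// setCitvl. Qed.

Let fin_ray (x : R) : exists r : R, mu `]-oo, x[%classic = r%:E.
Proof. by exists (fine (mu `]-oo, x[%classic)); rewrite fineK// fin_num_measure. Qed.

Let median_upper : (mu `]m, +oo[%classic <= (2^-1 * expR (- 0))%:E)%E.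
Proof.
case: hm => h _; rewrite rayC -/(dist_fun mu m); move: h.
rewrite -/(dist_fun mu m) dist_fun_fin oppr0 expR0 -EFinB !lee_fin; lra.
Qed.

Let median_lower : (mu `]-oo, m[%classic <= (2^-1 * expR (- 0))%:E)%E.
Proof.
case: hm => _; rewrite rayC'; have [r ->] := fin_ray m.
rewrite oppr0 expR0 -EFinB !lee_fin; lra.
Qed.

(** For u > 0, Umap mu u is the quantile of mu of order 1 - e^(- u) / 2. *)
Let Umap_upper u : 0 < u -> [/\ m <= Umap mu u,
  (mu `]Umap mu u, +oo[%classic <= (2^-1 * expR (- u))%:E)%E &
  ((2^-1 * expR (- u))%:E <= mu `[Umap mu u, +oo[%classic)%E].
Proof.
move=> u0; have [w0 w1] := expcdf_itv u.
have wE : expcdf u = 1 - 2^-1 * expR (- u) by rewrite /expcdf leNgt u0.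
have e1 : expR (- u) < 1 by rewrite -expR0 ltr_expR oppr_lt0.
rewrite UmapE; split.
- rewrite leNgt; apply/negP => qm.
  have := cumul_quant mu w0 w1.
  have : (dist_fun mu (quant mu (expcdf u)) <= (2^-1 * expR (- 0))%:E)%E.
    apply: le_trans median_lower; apply: le_measure; rewrite ?inE//.
    by move=> z /=; rewrite !in_itv/= => zq; exact: le_lt_trans qm.
  by rewrite dist_fun_fin lee_fin oppr0 expR0; lra.
- rewrite rayC -/(dist_fun mu _) dist_fun_fin -EFinB lee_fin.
  by have := cumul_quant mu w0 w1; lra.
- have := mass_below_quant mu w0 w1; rewrite rayC'.
  have [r ->] := fin_ray (quant mu (expcdf u)).
  by rewrite -EFinB !lee_fin; lra.
Qed.

Let Umap_lower u : u <= 0 -> [/\ Umap mu u <= m,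
  (mu `]-oo, Umap mu u[%classic <= (2^-1 * expR (- - u))%:E)%E &
  ((2^-1 * expR (- - u))%:E <= mu `]-oo, Umap mu u]%classic)%E].
Proof.
move=> u0; have [w0 w1] := expcdf_itv u.
have wE : expcdf u = 2^-1 * expR u by rewrite /expcdf u0.
have e1 : expR u <= 1 by rewrite -expR0 ler_expR.
rewrite UmapE opprK -wE; split.
- rewrite quant_le//; case: hm => h _; move: h.
  by rewrite -/(dist_fun mu m) dist_fun_fin lee_fin; lra.
- exact: mass_below_quant.
- by rewrite -/(dist_fun mu _) dist_fun_fin lee_fin cumul_quant.
Qed.

Let Umap_homo (u v : R) : v <= u -> Umap mu v <= Umap mu u.
Proof.
move=> vu; rewrite !UmapE; apply: quant_homo; last by case: (expcdf_itv u).
  by case: (expcdf_itv v).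
exact: expcdf_homo.
Qed.

Let half_le (D : R) : 0 <= D -> b / 2 * D <= b * D.
Proof. by move=> D0; rewrite ler_wpM2r// ler_pdivrMr// ler_peMr ?(ltW b0)// ler1n. Qed.

(** With the factor b / 2, the increment is the midpoint of the increments on each
    side of m. *)
Let two_sided_cost x y p q : x <= m -> m <= y -> 0 <= p -> 0 <= q ->
  beta (b * (y - m)) <= ln K + q -> beta (b * (m - x)) <= ln K + p ->
  beta (b / 2 * (y - x)) <= ln K + (q + p).
Proof.
move=> xm my p0 q0 hq hp.
have i1 : 0 <= b * (y - m) by rewrite mulr_ge0 ?(ltW b0)// subr_ge0.
have i2 : 0 <= b * (m - x) by rewrite mulr_ge0 ?(ltW b0)// subr_ge0.
have := cost_midpoint hconv i1 i2.
have -> : (b * (y - m) + b * (m - x)) / 2 = b / 2 * (y - x) by field.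
by lra.
Qed.

Lemma Umap_cost_lt u v : v < u ->
  beta (b / 2 * (Umap mu u - Umap mu v)) <= ln K + (u - v).
Proof.
move=> vu; have hU := Umap_homo (ltW vu).
have b2 : 0 <= b / 2 by rewrite divr_ge0// ltW.
have D0 : 0 <= Umap mu u - Umap mu v by rewrite subr_ge0.
have le_full := cost_le hbeta hconv (mulr_ge0 b2 D0) (half_le D0).
have [v0|v0] := ltP 0 v.
  have [mv hv _] := Umap_upper v0; have [_ _ hu] := Umap_upper (lt_trans v0 vu).
  apply: le_trans le_full _.
  exact: (upper_tail_cost mv hU (ltW vu) hv hu).
have [vm hv hv'] := Umap_lower v0.
have [u0|u0] := leP u 0.
  have [um hu hu'] := Umap_lower u0.
  apply: le_trans le_full _.
  have nvu : - u <= - v by rewrite lerN2 ltW.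
  rewrite (_ : u - v = - v - - u); last by rewrite opprK addrC.
  exact: (lower_tail_cost um hU nvu hu hv').
have [mu' hu hu'] := Umap_upper u0.
have h1 := upper_tail_cost (lexx m) mu' (ltW u0) median_upper hu'.
have nv0 : 0 <= - v by rewrite oppr_ge0.
have h2 := lower_tail_cost (lexx m) vm nv0 median_lower hv'.
by rewrite !subr0 in h1 h2; exact: (two_sided_cost vm mu' nv0 (ltW u0)).
Qed.

(** Let D be the increment of Umap mu, s that of the argument, A and B the inverses
    of ln K and s.  Then beta (b / 2 * D) <= ln K + s <= beta (A + B) by
    superadditivity, so b / 2 * D <= A + B, and A + B <= 2 * A * B / to because A
    and B exceed to. *)
Lemma Umap_modulus_of_tail_bound :
  Umap_modulus mu beta (b / 2 * (to / (2 * cost_inv beta (ln K)))).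
Proof.
move=> u v uv; set s := `|u - v|; set D := `|_ - _|.
have to0 := hto; have bb := b0.
have s0 : 0 < s by rewrite normr_gt0 subr_eq0.
have hD : beta (b / 2 * D) <= ln K + s.
  rewrite /D /s; case: (ltgtP u v) uv => // [uv|vu] _.
    rewrite distrC (distrC u) !ger0_norm ?subr_ge0 ?(ltW uv) ?Umap_homo ?(ltW uv)//.
    exact: Umap_cost_lt.
  rewrite !ger0_norm ?subr_ge0 ?(ltW vu) ?Umap_homo ?(ltW vu)//.
  exact: Umap_cost_lt.
have [] := cost_invP hbeta hconv hto hzero lnK0; set A := cost_inv beta (ln K) => Ato bA.
have [] := cost_invP hbeta hconv hto hzero s0; set B := cost_inv beta s => Bto bB.
have AB : b / 2 * D <= A + B.
  rewrite leNgt; apply/negP => lt.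
  have : beta (A + B) < beta (b / 2 * D).
    by apply: (cost_lt hbeta hconv hto hzero) => //; lra.
  have : beta A + beta B <= beta (A + B) by apply: (cost_superadd hbeta hconv); lra.
  by rewrite bA bB; lra.
have d0 : 0 < b / 2 * (to / (2 * A)).
  by rewrite mulr_gt0 ?divr_gt0//; lra.
rewrite mulrC ler_pdivlMr//.
have -> : D * (b / 2 * (to / (2 * A))) = b / 2 * D * to / (2 * A) by field; lra.
rewrite ler_pdivrMr; last by lra.
have : b / 2 * D * to <= (A + B) * to by rewrite ler_pM2r.
have : A * to <= A * B by rewrite ler_pM2l; lra.
have : to * B <= A * B by rewrite ler_pM2r; lra.
by lra.
Qed.

End tail_bound_modulus.

(** * The equivalence *)

Theorem theorem6p1 (R : realType) (mu : probability R R) (beta : R -> R) (to m : R)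
  (hmu : finite_first_moment mu)
  (hbeta : cost_function beta) (hconv : convex_cost beta)
  (hto : 0 < to) (hzero : [set t | 0 <= t /\ beta t = 0] = `[0, to]%classic)
  (hm : is_median mu m) :
  [<-> exists a, 0 < a /\ transport_entropy mu (dilate a beta);
       exists a', 0 < a' /\ weak_transport_entropy mu (dilate a' beta);
       exists b, 0 < b /\
         (Order.max (Kplus mu beta m b) (Kminus mu beta m b) < +oo)%E;
       exists d, 0 < d /\ Umap_modulus mu beta d] /\
  [/\ forall a, 0 < a ->
        transport_entropy mu (dilate a beta) ->
        weak_transport_entropy mu (dilate a beta),
      forall a', 0 < a' ->
        weak_transport_entropy mu (dilate a' beta) ->
        (Order.max (Kplus mu beta m (a' / 2)) (Kminus mu beta m (a' / 2))
          < +oo)%E,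
      forall a', 0 < a' ->
        weak_transport_entropy mu (dilate a' beta) ->
        Umap_modulus mu beta (a' * (to / (8 * cost_inv beta (ln 3)))) &
      forall d, 0 < d ->
        Umap_modulus mu beta d ->
        weak_transport_entropy mu
          (dilate (d * (to / (9 * cost_inv beta 2))) beta)].
Proof.
have weak_of_strong a : 0 < a -> transport_entropy mu (dilate a beta) ->
    weak_transport_entropy mu (dilate a beta).
  by move=> a0; exact: weak_transport_entropy_of_transport_entropy.
have tails_of_weak a : 0 < a -> weak_transport_entropy mu (dilate a beta) ->
    exp_tail_bound beta mu m (a / 2) 3.
  by move=> a0; exact: exp_tail_bound_of_weak_transport_entropy.
have half_gt0 (a : R) : 0 < a -> 0 < a / 2 by move=> a0; rewrite divr_gt0.
have K_of_weak a : 0 < a -> weak_transport_entropy mu (dilate a beta) ->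
    (Order.max (Kplus mu beta m (a / 2)) (Kminus mu beta m (a / 2)) < +oo)%E.
  move=> a0 wte; apply: (@le_lt_trans _ _ 3%:E); last exact: ltry.
  by apply/(max_Kplus_Kminus_le hbeta) => //; [exact: half_gt0|exact: tails_of_weak].
split; last split => //.
- tfae.
  + by move=> [a [a0 te]]; exists a; split => //; exact: weak_of_strong.
  + by move=> [a [a0 wte]]; exists (a / 2); split; [exact: half_gt0|exact: K_of_weak].
  + move=> [b [b0 /(max_Kplus_Kminus_fin hbeta b0)[K [K1 tails]]]].
    have [Lto _] := cost_invP hbeta hconv hto hzero (ln_gt0 K1).
    exists (b / 2 * (to / (2 * cost_inv beta (ln K)))); split.
      by rewrite mulr_gt0 ?half_gt0// divr_gt0// mulr_gt0// (lt_trans hto).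
    exact: (Umap_modulus_of_tail_bound hbeta hconv hto hzero hm b0 K1 tails).
  + move=> [d [d0 hU]]; have [B2to _] := cost_invP hbeta hconv hto hzero (ltr0Sn R 1).
    exists (d * (to / (9 * cost_inv beta 2))); split.
      by rewrite mulr_gt0// divr_gt0// mulr_gt0// (lt_trans hto).
    exact: (transport_entropy_of_modulus hbeta hconv hto hzero d0 hU).
- move=> a a0 wte; have K1 : 1 < 3 :> R by lra.
  have [Lto _] := cost_invP hbeta hconv hto hzero (ln_gt0 K1).
  have := Umap_modulus_of_tail_bound hbeta hconv hto hzero hm (half_gt0 a a0) K1
    (tails_of_weak a a0 wte).
  by congr Umap_modulus; field; rewrite gt_eqF// (lt_trans hto).
- by move=> d d0 hU; exact: (weak_transport_entropy_of_modulus hbeta hconv hto hzero).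
Qed.
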